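(* Let $Q$ be a quiver with vertex set $I=\{1,\dots,n\}$ without loops and oriented $2$-cycles, $W$ a finite potential on $Q$, and $\mathbf{k}=(k_1,\dots,k_l)\in I^l$ such that $(Q^{\mathrm{pf}},W)$ is successively f-mutatable with respect to $\mathbf{k}$. Then the $g$-vectors $\{g_{\mathbf{k},i}\}_{i\in I}$ form a $\mathbb{Z}$-basis of the lattice $\mathbb{Z}^n$.
   Context: $Q(i,j)$ is the number of arrows $i\to j$ in $Q$; $\bar Q(i,j):=Q(j,i)-Q(i,j)$. The quiver with principal framing $Q^{\mathrm{pf}}$ has vertices $I\sqcup I^*$, $I^*=\{1^*,\dots,n^*\}$, and arrows those of $Q$ together with one arrow $i^*\to i$ for each $i\in I$. Quiver mutation. $\mu_k^{\mathrm{pre}}Q$ is obtained from $Q$ by adding an arrow $[\beta\alpha]:u\to v$ for each pair $u\xrightarrow{\alpha}k\xrightarrow{\beta}v$ and replacing each arrow $a$ incident to $k$ by an opposite arrow $a^*$; $\mu_kQ$ is obtained by then removing a maximal collection of disjoint oriented $2$-cycles. Seeds. The mutation at $k$ of a seed $(Q\mid\underline u)$ is $(\mu_kQ\mid\underline u^{\mathrm{new}})$, where $u_k$ is replaced by $u_k^{-1}(\prod_iu_i^{Q(i,k)}+\prod_iu_i^{Q(k,i)})$ and other variables are unchanged. $\mathrm{FZ}_{\mathbf{k},i}(\underline x)$ is the $i$-th variable of $\mu_{k_l}\cdots\mu_{k_1}(Q\mid(x_1,\dots,x_n))$, and $\mathrm{FZ}^{\mathrm{pf}}_{\mathbf{k},i}(\underline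 X)$ the variable at $i$ of $\mu_{k_l}\cdots\mu_{k_1}(Q^{\mathrm{pf}}\mid\underline X)$, with initial variables $X_j,X_{j^*}$ ($j\in I$). The $F$-polynomial is $F_{\mathbf{k},i}(\underline y):=\mathrm{FZ}^{\mathrm{pf}}_{\mathbf{k},i}(\underline X)|_{X_j=1,\,X_{j^*}=y_j}$. The $g$-vector $g_{\mathbf{k},i}\in\mathbb{Z}^n$ is characterized by $\mathrm{FZ}_{\mathbf{k},i}(\underline x)=\mathbf{x}^{g_{\mathbf{k},i}}\cdot F_{\mathbf{k},i}(y_1^{-1},\dots,y_n^{-1})$, where $y_j=\prod_ix_i^{\bar Q(i,j)}$ and $\mathbf{x}^{g}=\prod_ix_i^{g_i}$. QP mutation. A finite potential $W$ is a finite linear combination of oriented cycles (up to rotation); a potential on $Q$ is also one on $Q^{\mathrm{pf}}$. The Jacobi algebra is $\mathbb{C}Q/\langle\partial_aW\rangle$ with $\partial_a(a_1\cdots a_m)=\sum_i\delta_{a,a_i}a_{i+1}\cdots a_ma_1\cdots a_{i-1}$. $\mu_k^{\mathrm{pre}}W:=[W]+\Delta$, where $[W]$ replaces each composition of $\alpha,\beta$ through $k$ by $[\beta\alpha]$ and $\Delta$ is the sum of the $3$-cycles formed by $[\beta\alpha],\beta^*,\alpha^*$. Two finite QPs are right f-equivalent if there is an algebra isomorphism of their (uncompleted) path algebras, fixing vertices, taking one potential to the other. A potential is reduced if it has no cycles of length $<3$; a QP is trivial if its Jacobi algebra is spanned by the vertex idempotents. A finite QP is f-reducible if right f-equivalent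 to a direct sum (union of arrow sets, sum of potentials) of a finite reduced QP and a finite trivial QP; $\mu_k(Q,W)$ is the reduced part of $(\mu_k^{\mathrm{pre}}Q,\mu_k^{\mathrm{pre}}W)$. $(Q,W)$ is f-mutatable at $k$ if $(\mu_k^{\mathrm{pre}}Q,\mu_k^{\mathrm{pre}}W)$ is f-reducible and the quiver of $\mu_k(Q,W)$ is $\mu_kQ$; it is successively f-mutatable with respect to $\mathbf{k}$ if $\mu_{k_{s-1}}\cdots\mu_{k_1}(Q,W)$ is f-mutatable at $k_s$ for all $s\le l$. *)

(* Defs.v *)
From HB Require Import structures.
From mathcomp Require Import classical_sets reals complex.
From mathcomp Require Import all_boot all_order all_algebra.
From mathcomp Require Import finmap.
From mathcomp Require Import -(notations) monalg.
From mathcomp Require Import mpoly.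

Set Implicit Arguments.
Unset Strict Implicit.
Unset Printing Implicit Defensive.

Import GRing.Theory.
Local Open Scope ring_scope.

(** * Quivers and their mutations *)

Record quiver (V : finType) : Type := Quiver {
  arrow : finType;
  src : arrow -> V;
  tgt : arrow -> V }.
Arguments Quiver {V} _ _ _.
Arguments arrow {V} _.
Arguments src {V q} _.
Arguments tgt {V q} _.

Section Quivers.
Variable V : finType.
Implicit Types Q : quiver V.

(* Q(i,j) *)
Definition narrows Q (i j : V) : nat :=
  #|[set a : arrow Q | (src a == i) && (tgt a == j)]|.

(* \bar Q(i,j) *)
Definition barQ Q (i j : V) : int := (narrows Q j i)%:Z - (narrows Q i j)%:Z.

Definition two_cycle Q (a b : arrow Q) : bool :=
  [&& src a != tgt a, src a == tgt b & tgt a == src b].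

Definition no_loops Q : Prop := forall a : arrow Q, src a != tgt a.
Definition no_two_cycles Q : Prop := forall a b : arrow Q, ~~ two_cycle a b.

Definition quiver_iso Q Q' : Prop :=
  exists f : arrow Q -> arrow Q',
    [/\ bijective f, forall a, src (f a) = src a & forall a, tgt (f a) = tgt a].

(* pairs (beta, alpha) with  u -alpha-> k -beta-> v *)
Definition through Q (k : V) : pred (arrow Q * arrow Q) :=
  fun p => (src p.1 == k) && (tgt p.2 == k).

(* [inl a] stands for the opposite arrow a^* if a is incident to k, and for a
   itself otherwise; [inr (beta, alpha)] stands for [beta alpha]. *)
Definition premut (k : V) Q : quiver V :=
  let incident (a : arrow Q) := (src a == k) || (tgt a == k) in
  Quiver (arrow Q + {p : arrow Q * arrow Q | through k p})%type
    (fun x => match x with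
              | inl a => if incident a then tgt a else src a
              | inr p => src (val p).2
              end)
    (fun x => match x with
              | inl a => if incident a then src a else tgt a
              | inr p => tgt (val p).1
              end).

Definition disjoint_two_cycles Q (C : {set {set arrow Q}}) : bool :=
  trivIset C &&
  [forall c in C, [exists a, [exists b, two_cycle a b && (c == [set a; b])]]].

(* An arbitrary choice of a maximal collection: another choice gives an
   isomorphic quiver after removal, hence the same seeds below. *)
Definition max_two_cycles Q : {set {set arrow Q}} :=
  odflt set0 [pick C | maxset (@disjoint_two_cycles Q) C].

Definition cancel_two_cycles Q : quiver V :=
  Quiver {a : arrow Q | a \notin cover (max_two_cycles Q)}
    (fun a => src (val a)) (fun a => tgt (val a)).

Definition mutation (k : V) Q : quiver V := cancel_two_cycles (premut k Q).

(* The framed quiver: [inl i] is the vertex i and [inr i] is i^*. *)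
Definition framed Q : quiver (V + V)%type :=
  Quiver (arrow Q + V)%type
    (fun x => match x with inl a => inl (src a) | inr i => inr i end)
    (fun x => match x with inl a => inl (tgt a) | inr i => inl i end).

Lemma max_two_cyclesP Q : maxset (@disjoint_two_cycles Q) (max_two_cycles Q).
Proof.
rewrite /max_two_cycles; case: pickP => [C //|none].
have d0 : @disjoint_two_cycles Q set0.
  apply/andP; split; first by apply/trivIsetP => A B; rewrite inE.
  by apply/forall_inP => c; rewrite inE.
have [C maxC _] := maxset_exists d0.
by have := none C; rewrite maxC.
Qed.

End Quivers.

(** * Seeds, cluster variables, F-polynomials and g-vectors *)

Section Seeds.
Variables (V : finType) (K : fieldType).

Definition seed_mutation (S : quiver V * (V -> K)) (k : V)
    : quiver V * (V -> K) :=
  let: (Q, u) := S in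
  (mutation k Q,
   fun v => if v == k
            then (u k)^-1 * (\prod_i u i ^+ narrows Q i k
                             + \prod_i u i ^+ narrows Q k i)
            else u v).

(* The variable at i of mu_{k_l} ... mu_{k_1} (Q | x), with ks = [k_1; ...; k_l]. *)
Definition FZ (Q : quiver V) (x : V -> K) (ks : seq V) (i : V) : K :=
  (foldl seed_mutation (Q, x) ks).2 i.

End Seeds.

Definition ratfun (m : nat) : fieldType := {fraction {mpoly rat[m]}}.
Definition to_ratfun m (p : {mpoly rat[m]}) : ratfun m := @tofrac _ p.
Definition rvar m (j : 'I_m) : ratfun m := to_ratfun 'X_j.

Definition poly_eval m m' (v : 'I_m -> ratfun m') (p : {mpoly rat[m]})
    : ratfun m' :=
  mpoly.mmap (fun c : rat => to_ratfun c%:MP) v p.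

(* The value f(v) of a rational function f = p / q at a point v where it is
   regular, i.e. for some presentation with q(v) <> 0; it does not depend on
   the presentation, see [ratfun_evalE].  (Default value 0 where f is not
   regular.) *)
Definition ratfun_eval m m' (f : ratfun m) (v : 'I_m -> ratfun m')
    : ratfun m' :=
  xget 0 [set w | exists p q : {mpoly rat[m]},
    [/\ poly_eval v q != 0, f = to_ratfun p / to_ratfun q
      & w = poly_eval v p / poly_eval v q]].

Lemma poly_evalM m m' (v : 'I_m -> ratfun m') :
  {morph poly_eval v : p q / p * q}.
Proof.
move=> p q; rewrite /poly_eval /to_ratfun.
exact: (rmorphM (mpoly.mmap (@tofrac {mpoly rat[m']} \o @mpolyC m' rat) v)).
Qed.

Lemma poly_eval0 m m' (v : 'I_m -> ratfun m') : poly_eval v 0 = 0.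
Proof.
rewrite /poly_eval /to_ratfun.
exact: (rmorph0 (mpoly.mmap (@tofrac {mpoly rat[m']} \o @mpolyC m' rat) v)).
Qed.

Lemma frac_transfer (R : comNzRingType) (F L : fieldType) (f : R -> F)
    (e : R -> L) (p q p' q' : R) :
  {morph f : x y / x * y} -> injective f -> {morph e : x y / x * y} ->
  f q != 0 -> f q' != 0 -> e q != 0 -> e q' != 0 ->
  f p / f q = f p' / f q' -> e p / e q = e p' / e q'.
Proof.
move=> fM finj eM fq fq' eq eq' /eqP; rewrite eqr_div // -!fM => /eqP/finj h.
by apply/eqP; rewrite eqr_div // -!eM h.
Qed.

Lemma to_ratfunM m : {morph @to_ratfun m : p q / p * q}.
Proof. exact: (@tofracM {mpoly rat[m]}). Qed.

Lemma to_ratfun_inj m : injective (@to_ratfun m).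
Proof. by move=> p q /eqP; rewrite /to_ratfun tofrac_eq => /eqP. Qed.

Lemma to_ratfun_neq0 m m' (v : 'I_m -> ratfun m') (p : {mpoly rat[m]}) :
  poly_eval v p != 0 -> to_ratfun p != 0.
Proof.
apply: contraNneq => p0; suff -> : p = 0 by rewrite poly_eval0.
by apply: (@to_ratfun_inj m); rewrite p0 /to_ratfun tofrac0.
Qed.

Lemma ratfun_evalE m m' (v : 'I_m -> ratfun m') (p q : {mpoly rat[m]}) :
  poly_eval v q != 0 ->
  ratfun_eval (to_ratfun p / to_ratfun q) v = poly_eval v p / poly_eval v q.
Proof.
move=> qv; rewrite /ratfun_eval.
set A := (X in xget 0 X).
have /(xgetPex 0) : exists w, A w.
  by exists (poly_eval v p / poly_eval v q), p, q.
case=> p' [q' [qv' e ->]]; apply/esym.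
exact: (frac_transfer (@to_ratfunM m) (@to_ratfun_inj m) (@poly_evalM m m' v)
  (to_ratfun_neq0 qv) (to_ratfun_neq0 qv') qv qv' e).
Qed.

Section GVectors.
Variables (n : nat) (Q : quiver 'I_n) (ks : seq 'I_n).

(* FZ_{k,i}(x_1, ..., x_n) *)
Definition FZ_var (i : 'I_n) : ratfun n := FZ Q (@rvar n) ks i.

(* FZ^pf_{k,i}(X); among the 2n variables, X_j is numbered by [lshift n j] and
   X_{j^*} by [rshift n j]. *)
Definition FZpf_var (i : 'I_n) : ratfun (n + n) :=
  FZ (framed Q) (fun v => rvar (unsplit v)) [seq inl k | k <- ks] (inl i).

(* F_{k,i}(y) = FZ^pf_{k,i} at X_j = 1, X_{j^*} = y_j *)
Definition Fpolynomial (i : 'I_n) : ratfun n :=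
  ratfun_eval (FZpf_var i)
    (fun m => match fintype.split m with inl _ => 1 | inr j => rvar j end).

Definition yvar (j : 'I_n) : ratfun n := \prod_i rvar i ^ barQ Q i j.

Definition is_gvector (i : 'I_n) (g : 'rV[int]_n) : Prop :=
  FZ_var i = \prod_j rvar j ^ g 0 j
             * ratfun_eval (Fpolynomial i) (fun j => (yvar j)^-1).

(* The vector characterized by [is_gvector].  Its existence is not presupposed:
   the default value 0 never belongs to a basis. *)
Definition gvector (i : 'I_n) : 'rV[int]_n := xget 0 [set g | is_gvector i g].

End GVectors.

Definition is_Zbasis n (g : 'I_n -> 'rV[int]_n) : Prop :=
  forall v : 'rV[int]_n, exists! c : 'rV[int]_n, v = \sum_i c 0 i *: g i.

(** * Path algebras *)

Section Paths.
Variables (V : finType) (Q : quiver V).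

Definition composable (b a : arrow Q) : bool := src b == tgt a.

Definition wf_path (p : V * seq (arrow Q)) : bool :=
  if p.2 is a :: s then (tgt a == p.1) && path composable a s else true.

(* A path is a pair (v, a_1 ... a_m) composed from right to left:
   v = tgt a_1 and src a_i = tgt a_{i+1}.  The pair (v, [::]) is the trivial
   path at v. *)
Record qpath : Type := QPath { path_val : V * seq (arrow Q); _ : wf_path path_val }.
HB.instance Definition _ := [isSub for path_val].
(* These instances are opaque: unfolding them slows unification down. *)
Fact qpath_hasDecEq : hasDecEq qpath.
Proof. by case: [Equality of qpath by <:]. Qed.
HB.instance Definition _ := qpath_hasDecEq.
Fact qpath_hasChoice : hasChoice qpath.
Proof. by case: [Choice of qpath by <:]. Qed.
HB.instance Definition _ := qpath_hasChoice.

Definition ptgt (p : qpath) : V := (val p).1.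
Definition word (p : qpath) : seq (arrow Q) := (val p).2.
Definition psrc (p : qpath) : V := last (ptgt p) (map src (word p)).

Definition trivial_path (v : V) : qpath := QPath (isT : wf_path (v, [::])).

Lemma arrow_path_subproof (a : arrow Q) : wf_path (tgt a, [:: a]).
Proof. by rewrite /wf_path /= eqxx. Qed.
Definition arrow_path (a : arrow Q) : qpath := QPath (arrow_path_subproof a).

(* concatenation, meaningful when [psrc p = ptgt q] *)
Definition pcat (p q : qpath) : qpath := insubd p (ptgt p, word p ++ word q).

Lemma val_pcat p q : psrc p = ptgt q -> val (pcat p q) = (ptgt p, word p ++ word q).
Proof.
move=> e; rewrite /pcat val_insubd; case: ifP => // /negP[].
case: p q e => [[v s] ws] [[v' s'] ws']; rewrite /psrc /ptgt /word /= => e.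
case: s ws e => [|a s] /= ws e; first by rewrite e.
move: ws; rewrite /wf_path /= => /andP[-> ws] /=.
rewrite cat_path ws /=.
case: s' ws' => [//|b s'] /= /andP[/eqP h ->]; rewrite andbT /composable h -e.
by rewrite last_map.
Qed.

Lemma ptgt_pcat p q : psrc p = ptgt q -> ptgt (pcat p q) = ptgt p.
Proof. by move=> e; rewrite /ptgt val_pcat. Qed.

Lemma psrc_pcat p q : psrc p = ptgt q -> psrc (pcat p q) = psrc q.
Proof.
move=> e; rewrite /psrc ptgt_pcat // /word val_pcat //= map_cat last_cat.
by rewrite -/(psrc p) e.
Qed.

Lemma pcatA p q r : psrc p = ptgt q -> psrc q = ptgt r ->
  pcat (pcat p q) r = pcat p (pcat q r).
Proof.
move=> e e'; apply: val_inj.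
rewrite !val_pcat ?psrc_pcat ?ptgt_pcat // /word !val_pcat //=.
by rewrite catA.
Qed.

Lemma pcat_trivl p : pcat (trivial_path (ptgt p)) p = p.
Proof.
by apply: val_inj; rewrite val_pcat //; case: p => [[]].
Qed.

Lemma pcat_trivr p : pcat p (trivial_path (psrc p)) = p.
Proof.
by apply: val_inj; rewrite val_pcat // cats0; case: p => [[]].
Qed.

End Paths.

Lemma lin0 (K : fieldType) (M N : lmodType K) (f : M -> N) : linear f -> f 0 = 0.
Proof.
move=> flin; have := flin 1 0 0; rewrite !scale1r addr0 => /eqP.
by rewrite -subr_eq0 opprD addNKr oppr_eq0 => /eqP.
Qed.

Lemma linZ (K : fieldType) (M N : lmodType K) (f : M -> N) c x :
  linear f -> f (c *: x) = c *: f x.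
Proof. by move=> flin; have := flin c x 0; rewrite (lin0 flin) !addr0. Qed.

Section PathAlgebra.
Variables (K : fieldType) (V : finType) (Q : quiver V).

Definition pathalg : Type := monalg.malg (qpath Q) K.
HB.instance Definition _ := GRing.Lmodule.on pathalg.

Definition pbasis (p : qpath Q) : pathalg := monalg.mkmalgU p 1.
Definition pcoef (x : pathalg) (p : qpath Q) : K := monalg.mcoeff p x.

Section Extend.
Variable (M : lmodType K).

(* linear extension of a function on paths *)
Definition extend (f : qpath Q -> M) (x : pathalg) : M :=
  \sum_(p <- monalg.msupp x) pcoef x p *: f p.

Lemma extendEw f (x : pathalg) (d : {fset qpath Q}%fset) :
  (monalg.msupp x `<=` d)%fset -> extend f x = \sum_(p <- d) pcoef x p *: f p.
Proof.
move=> sub; rewrite /extend (big_fset_incl _ sub) //= => p _ pN.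
by rewrite /pcoef monalg.mcoeff_outdom ?scale0r.
Qed.

Lemma extend_is_linear f : linear (extend f).
Proof.
move=> c x y.
pose d := (monalg.msupp x `|` monalg.msupp y `|` monalg.msupp (c *: x + y)%R)%fset.
have sx : (monalg.msupp x `<=` d)%fset.
  by rewrite /d -fsetUA; exact: fsubsetUl.
have sy : (monalg.msupp y `<=` d)%fset.
  by apply: fsubset_trans (fsubsetUl _ _); exact: fsubsetUr.
have sz : (monalg.msupp (c *: x + y) `<=` d)%fset by exact: fsubsetUr.
rewrite (extendEw f sx) (extendEw f sy) (extendEw f sz) scaler_sumr -big_split /=.
apply: eq_bigr => p _.
by rewrite /pcoef monalg.mcoeffD monalg.mcoeffZ scalerDl scalerA.
Qed.

Lemma extend_basis f p : extend f (pbasis p) = f p.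
Proof.
rewrite /pbasis.
rewrite (@extendEw f _ [fset p]%fset) ?monalg.msuppU_le //.
by rewrite big_seq_fset1 /pcoef monalg.mcoeffUU scale1r.
Qed.

End Extend.

HB.instance Definition _ (M : lmodType K) (f : qpath Q -> M) :=
  GRing.isLinear.Build K pathalg M *:%R (extend f) (extend_is_linear f).

Lemma pathalgE (x : pathalg) : x = \sum_(p <- monalg.msupp x) pcoef x p *: pbasis p.
Proof.
rewrite {1}[x]monalg.monalgE; apply: eq_bigr => p _.
apply/monalg.malgP => q; rewrite (@monalg.mcoeffZ (qpath Q) K).
have aux (c : K) (b : bool) : c *+ b = c * (1 *+ b) by rewrite mulrnAr mulr1.
rewrite /pbasis (@monalg.mcoeffU (qpath Q) K) aux.
by rewrite -(@monalg.mcoeffU (qpath Q) K).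
Qed.

Definition bmul (p q : qpath Q) : pathalg :=
  if psrc p == ptgt q then pbasis (pcat p q) else 0.

Definition pmul (x y : pathalg) : pathalg :=
  extend (fun p => extend (bmul p) y) x.

Definition vtx (v : V) : pathalg := pbasis (trivial_path Q v).
Definition arr (a : arrow Q) : pathalg := pbasis (arrow_path a).

Definition pone : pathalg := \sum_v vtx v.

Lemma pmulE x y : pmul x y = extend (fun p => extend (bmul p) y) x.
Proof. by []. Qed.

Lemma pmulDl : left_distributive pmul +%R.
Proof. by move=> x y z; rewrite !pmulE linearD. Qed.

Lemma pmul_is_linear x : linear (pmul x).
Proof.
move=> c y z; rewrite !pmulE /extend scaler_sumr -big_split /=.
apply: eq_bigr => p _.
rewrite -!/(extend _ _) linearP scalerDr !scalerA.
by rewrite [c * _]mulrC.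
Qed.

Lemma pmulDr : right_distributive pmul +%R.
Proof. by move=> x y z; have := pmul_is_linear x 1 y z; rewrite !scale1r. Qed.

Lemma pmulZr c x y : pmul x (c *: y) = c *: pmul x y.
Proof. exact: linZ (pmul_is_linear x). Qed.

Lemma pmulZl c x y : pmul (c *: x) y = c *: pmul x y.
Proof. by rewrite !pmulE linearZ. Qed.

Lemma pmul_suml I r (F : I -> pathalg) y :
  pmul (\sum_(i <- r) F i) y = \sum_(i <- r) pmul (F i) y.
Proof.
by rewrite pmulE linear_sum; apply: eq_bigr => i _; rewrite pmulE.
Qed.

Lemma pmul_sumr I r (F : I -> pathalg) x :
  pmul x (\sum_(i <- r) F i) = \sum_(i <- r) pmul x (F i).
Proof.
elim: r => [|i r IH]; last by rewrite !big_cons pmulDr IH.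
by rewrite !big_nil; exact: lin0 (pmul_is_linear x).
Qed.

Lemma pmul_basis p q : pmul (pbasis p) (pbasis q) = bmul p q.
Proof. by rewrite pmulE !extend_basis. Qed.

Lemma pathalg_ext (M : lmodType K) (f g : pathalg -> M) :
  linear f -> linear g -> (forall p, f (pbasis p) = g (pbasis p)) -> f =1 g.
Proof.
move=> flin glin fg x; rewrite [x]pathalgE.
elim: (enum_fset (monalg.msupp x)) => [|p s IH]; first by rewrite big_nil !lin0.
by rewrite big_cons flin glin fg IH.
Qed.

Lemma pmul_linearl y : linear (pmul^~ y).
Proof. by move=> c x x'; rewrite pmulDl pmulZl. Qed.

Lemma pmul0l y : pmul 0 y = 0.
Proof. exact: lin0 (pmul_linearl y). Qed.

Lemma pmul0r y : pmul y 0 = 0.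
Proof. exact: lin0 (pmul_is_linear y). Qed.

Lemma pmulA : associative pmul.
Proof.
move=> x y z; move: x; apply: pathalg_ext => [c u v|c u v|p].
- exact: pmul_linearl.
- by rewrite !pmul_linearl.
move: y; apply: pathalg_ext => [c u v|c u v|q].
- by rewrite pmul_linearl pmul_is_linear.
- by rewrite pmul_is_linear pmul_linearl.
move: z; apply: pathalg_ext => [c u v|c u v|r].
- by rewrite !pmul_is_linear.
- exact: pmul_is_linear.
rewrite !pmul_basis /bmul.
have [e|ne] := eqVneq (psrc p) (ptgt q); last first.
  rewrite pmul0l; case: ifP => [/eqP e'|_]; last by rewrite pmul0r.
  by rewrite pmul_basis /bmul ptgt_pcat // (negbTE ne).
have [e'|ne'] := eqVneq (psrc q) (ptgt r); last first.
  by rewrite pmul0r pmul_basis /bmul psrc_pcat // (negbTE ne').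
by rewrite !pmul_basis /bmul ptgt_pcat // psrc_pcat // e e' !eqxx pcatA.
Qed.

Lemma pmul1l : left_id pone pmul.
Proof.
apply: pathalg_ext => [c u v|c u v|p]; first exact: pmul_is_linear.
  by [].
rewrite /pone pmul_suml (bigD1 (ptgt p)) //= big1 => [|v /negPf ne].
  by rewrite addr0 /vtx pmul_basis /bmul /psrc /= eqxx pcat_trivl.
by rewrite /vtx pmul_basis /bmul /psrc /= ne.
Qed.

Lemma pmul1r : right_id pone pmul.
Proof.
apply: pathalg_ext => [c u v|c u v|p]; first exact: pmul_linearl.
  by [].
rewrite /pone pmul_sumr (bigD1 (psrc p)) //= big1 => [|v /negPf ne].
  by rewrite addr0 /vtx pmul_basis /bmul /ptgt /= eqxx pcat_trivr.
by rewrite /vtx pmul_basis /bmul /ptgt /= eq_sym ne.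
Qed.

(* The zero ring is allowed (quiver without vertices), hence [pzRingType]. *)
HB.instance Definition _ := GRing.Zmodule_isPzRing.Build pathalg
  pmulA pmul1l pmul1r pmulDl pmulDr.

End PathAlgebra.

(** * Finite quivers with potential *)

Section Potentials.
Variables (K : fieldType) (V : finType).
Implicit Types Q : quiver V.

Definition cyclic_word Q (s : seq (arrow Q)) : bool :=
  (s != [::]) && cycle (@composable V Q) s.

Definition word_elt Q (s : seq (arrow Q)) : pathalg K Q := \prod_(a <- s) arr K a.

(* A potential is represented by a linear combination of cyclic paths (with a
   base point); potentials are considered up to [cyc_equiv]. *)
Definition is_potential Q (W : pathalg K Q) : Prop :=
  forall p, pcoef W p != 0 -> cyclic_word (word p).

Definition cyc_equiv Q (x y : pathalg K Q) : Prop :=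
  exists2 s : seq (K * seq (arrow Q)), all (fun c => cyclic_word c.2) s
    & x - y = \sum_(c <- s) c.1 *: (word_elt c.2 - word_elt (rot 1 c.2)).

(* a finite quiver with potential; the potential is subject to [is_potential] *)
Record qp : Type := QP { qp_quiver : quiver V; qp_pot : pathalg K qp_quiver }.

Definition cyc_deriv Q (a : arrow Q) : pathalg K Q -> pathalg K Q :=
  extend (fun p => let s := word p in
    \sum_(i < size s | onth s i == Some a)
       vtx K Q (src a) * word_elt (drop i.+1 s ++ take i s)).

(* the two-sided ideal generated by the cyclic derivatives *)
Definition jacobi_ideal Q (W x : pathalg K Q) : Prop :=
  exists s : seq (pathalg K Q * arrow Q * pathalg K Q),
    x = \sum_(t <- s) t.1.1 * cyc_deriv t.1.2 W * t.2.

(* The Jacobi algebra is spanned by the vertex idempotents. *)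
Definition trivial_qp (P : qp) : Prop :=
  forall x : pathalg K (qp_quiver P), exists c : V -> K,
    jacobi_ideal (qp_pot P) (x - \sum_v c v *: vtx K (qp_quiver P) v).

Definition reduced_pot Q (W : pathalg K Q) : Prop :=
  exists2 W', cyc_equiv W W'
    & forall p, pcoef W' p != 0 -> cyclic_word (word p) /\ (3 <= size (word p))%N.

Definition right_f_equiv (P P' : qp) : Prop :=
  exists phi : pathalg K (qp_quiver P) -> pathalg K (qp_quiver P'),
    [/\ linear phi, monoid_morphism phi, bijective phi,
        forall v, phi (vtx K (qp_quiver P) v) = vtx K (qp_quiver P') v
      & cyc_equiv (phi (qp_pot P)) (qp_pot P')].

End Potentials.

(* the map of path algebras induced by a map of quivers *)
Definition push (K : fieldType) (V V' : finType) (Q : quiver V) (Q' : quiver V')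
    (fv : V -> V') (fa : arrow Q -> arrow Q') : pathalg K Q -> pathalg K Q' :=
  extend (fun p => vtx K Q' (fv (ptgt p)) * word_elt K (map fa (word p))).

Section QPMutation.
Variables (K : fieldType) (V : finType).
Implicit Types Q : quiver V.

Definition sum_quiver Q1 Q2 : quiver V :=
  Quiver (arrow Q1 + arrow Q2)%type
    (fun x => match x with inl a => src a | inr a => src a end)
    (fun x => match x with inl a => tgt a | inr a => tgt a end).

Definition sum_qp (P1 P2 : qp K V) : qp K V :=
  QP (@push K V V _ (sum_quiver (qp_quiver P1) (qp_quiver P2)) id inl (qp_pot P1)
      + @push K V V _ (sum_quiver (qp_quiver P1) (qp_quiver P2)) id inr (qp_pot P2)).

Section PreMutation.
Variables (k : V) (Q : quiver V).
Let Q' := premut k Q.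

(* The arrow [beta alpha] if (beta, alpha) passes through k (0 is a junk value). *)
Definition composite_arrow (b a : arrow Q) : pathalg K Q' :=
  if insub (b, a) is Some c then arr K (inr c : arrow Q') else 0.

(* Replaces the factors beta alpha through k of a cyclic word with base point
   different from k. *)
Fixpoint bracket_word (s : seq (arrow Q)) : pathalg K Q' :=
  match s with
  | [::] => 1
  | b :: s1 =>
      if src b == k then
        match s1 with
        | [::] => 0
        | a :: s2 => composite_arrow b a * bracket_word s2
        end
      else arr K (inl b : arrow Q') * bracket_word s1
  end.

(* [W]: in the absence of loops at k, a cyclic path based at k is no longer
   based at k after one rotation. *)
Definition bracket : pathalg K Q -> pathalg K Q' :=
  extend (fun p => bracket_word (if ptgt p == k then rot 1 (word p) else word p)).

Definition Delta : pathalg K Q' :=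
  \sum_(c : {p : arrow Q * arrow Q | through k p})
     arr K (inr c : arrow Q') * arr K (inl (val c).2 : arrow Q')
                              * arr K (inl (val c).1 : arrow Q').

End PreMutation.

Definition premut_qp (k : V) (P : qp K V) : qp K V :=
  QP (bracket k (qp_pot P) + Delta k (qp_quiver P)).

(* P is f-reducible with reduced part R. *)
Definition reduced_part (P R : qp K V) : Prop :=
  [/\ is_potential (qp_pot R), reduced_pot (qp_pot R)
    & exists T : qp K V, [/\ is_potential (qp_pot T), trivial_qp T
                           & right_f_equiv P (sum_qp R T)]].

(* P is f-mutatable at k, with mu_k P = R. *)
Definition f_mutation (k : V) (P R : qp K V) : Prop :=
  reduced_part (premut_qp k P) R /\
  quiver_iso (qp_quiver R) (mutation k (qp_quiver P)).

(* The reduced part is only defined up to right f-equivalence: some chain of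
   choices is required to exist. *)
Fixpoint succ_f_mutatable (P : qp K V) (ks : seq V) : Prop :=
  match ks with
  | [::] => True
  | k :: ks' => exists R, f_mutation k P R /\ succ_f_mutatable R ks'
  end.

End QPMutation.

(* (Q^pf, W) for a potential W on Q *)
Definition framed_qp (K : fieldType) (V : finType) (Q : quiver V) (W : pathalg K Q)
    : qp K (V + V)%type :=
  QP (push (inl : V -> V + V) (inl : arrow Q -> arrow (framed Q)) W).

(* Main.v *)
(* Write [N] for the numbers of arrows of the mutated framed quiver.  In the
   framed quiver the cluster variables at [X_j = 1], [X_{j^*} = y_j^-1] differ
   from those of [Q] by monomials [x^g], and the exchange relations give
     g_k' = - g_k + sum_l N(l,k) g_l - sum_j N(j^*,k) b_j,
   with [b_j] the exponent of [y_j^-1]; the relation [G B = B_0 C] shows that the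
   same holds with the arrows out of [k].  If no vertex has both an arrow from
   and an arrow to frozen vertices (sign coherence), one of the two formulas has
   no term [b_j], so mutation changes [g] by a reflection of Z^n.

   Sign coherence comes from the invariant that in the Jacobian algebra there is
   no nonzero path of positive length between frozen vertices.  It holds at the
   start, where frozen vertices are sources.  It forces sign coherence: a path
   l^* -> i -> j^* of length 2 could be a relation only as the derivative by an
   arrow j^* -> l^*, and coherence prevents such arrows from being created.  It
   survives mutation at a nonfrozen [k], because modulo the relation
   a^* b^* = - d[W]/d[ba] paths avoiding [k] at their ends are bracketed paths,
   and bracketing maps the Jacobian ideal into the Jacobian ideal. *)
Require Import Defs.
From HB Require Import structures.
From mathcomp Require Import classical_sets reals complex.
From mathcomp Require Import all_boot all_order all_algebra.
From mathcomp Require Import finmap zify ring.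
From mathcomp Require Import -(notations) monalg.
From mathcomp Require Import mpoly.

Set Implicit Arguments.
Unset Strict Implicit.
Unset Printing Implicit Defensive.

Import Order.TTheory GRing.Theory Num.Theory.
Local Open Scope ring_scope.

(** * Quiver mutation on numbers of arrows *)

(** A mutated QP is known only up to choices: its quiver up to isomorphism, its potential up to
    right f-equivalence. So seeds are followed through numbers of arrows alone, and the invariant on
    potentials is a statement about Jacobian ideals, which such equivalences transport.

    The cyclic derivative is not a derivation, which blocks induction on products. Opening cyclic
    words with an extra element inserted repairs this: it obeys a Leibniz rule and a chain rule, and
    these yield transport along isomorphisms and the effect of bracketing.

    Path algebras are not completed; lower bounds on path lengths do the work. A potential of degree
    at least 2 has derivatives without constant term, so sending the arrows of the trivial summand
    to 0 kills every derivative by them.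

    A g-vector is a chosen solution of an equation, and evaluation of rational functions has a
    default value. Subtraction-free expressions make all evaluations regular; existence comes from
    the recursion, uniqueness from the independence of Laurent monomials. *)

Section ArrowNumbers.
Variable V : finType.
Implicit Types (Q : quiver V) (N : V -> V -> nat).

(** Truncated subtraction is the cancellation of 2-cycles: only the excess in the stronger direction
    survives. *)
Definition mutate_numbers (k : V) N (i j : V) : nat :=
  (if (i == k) || (j == k) then N j i
   else (N i j + N i k * N k j) - (N j i + N j k * N k i))%N.

Definition acyclic2 N : Prop := forall i j, N i j = 0 \/ N j i = 0.

Lemma narrows_gt0 Q i j :
  reflect (exists2 a : arrow Q, src a = i & tgt a = j) (0 < narrows Q i j)%N.
Proof.
apply: (iffP card_gt0P) => [[a]|[a sa ta]].
  by rewrite inE => /andP[/eqP sa /eqP ta]; exists a.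
by exists a; rewrite inE sa ta !eqxx.
Qed.

Lemma narrows_eq0 Q i j :
  (forall a : arrow Q, src a = i -> tgt a = j -> False) -> narrows Q i j = 0%N.
Proof.
by move=> h; apply/eqP; rewrite -leqn0 leqNgt; apply/narrows_gt0 => -[a /h].
Qed.

Lemma narrows_loop Q i : no_loops Q -> narrows Q i i = 0%N.
Proof.
by move=> nl; apply: narrows_eq0 => a sa ta; have := nl a; rewrite sa ta eqxx.
Qed.

Lemma acyclic2_narrows Q :
  no_loops Q -> no_two_cycles Q -> acyclic2 (narrows Q).
Proof.
move=> nl n2 i j; have [/narrows_gt0[a sa ta]|] := boolP (0 < narrows Q i j)%N;
  last by rewrite lt0n negbK => /eqP; left.
right; apply: narrows_eq0 => b sb tb.
by have := n2 a b; rewrite /two_cycle nl sa ta sb tb !eqxx.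
Qed.

Lemma quiver_iso_narrows Q Q' : quiver_iso Q Q' -> narrows Q =2 narrows Q'.
Proof.
case=> f [[g fK gK] fs ft] i j; rewrite /narrows.
rewrite -(card_imset _ (can_inj fK)); apply: eq_card => b.
apply/imsetP/idP => [[a] |]; rewrite inE => h.
  by move=> ->; rewrite inE fs ft.
by exists (g b); rewrite ?gK // inE -fs -ft gK.
Qed.

Lemma no_loops_iso Q Q' : quiver_iso Q Q' -> no_loops Q' -> no_loops Q.
Proof. by case=> f [_ fs ft] nl a; rewrite -fs -ft. Qed.

Lemma no_two_cycles_iso Q Q' :
  quiver_iso Q Q' -> no_two_cycles Q' -> no_two_cycles Q.
Proof.
by case=> f [_ fs ft] n2 a b; have := n2 (f a) (f b); rewrite /two_cycle !fs !ft.
Qed.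

(** Each chosen 2-cycle consists of two distinct arrows, one in each direction, and therefore counts
    equally on both sides. *)
Lemma cover_two_cycles_sym Q (C : {set {set arrow Q}}) i j :
  disjoint_two_cycles C ->
  #|[set a in cover C | (src a == i) && (tgt a == j)]| =
  #|[set a in cover C | (src a == j) && (tgt a == i)]|.
Proof.
case/andP=> tC /forall_inP C2.
rewrite -!sum1dep_card !big_trivIset_cond //; apply: eq_bigr => c /C2.
case/existsP=> a /existsP[b /andP[/and3P[nl /eqP st /eqP ts] /eqP ->]].
have nab : a != b by apply: contraNneq nl => {2}->; rewrite st.
rewrite !big_mkcondr !big_setU1 ?inE // !big_set1 st ts /= [RHS]addnC.
by congr (_ + _)%N; rewrite andbC.
Qed.

Lemma narrows_cancel Q i j : 
  (narrows (cancel_two_cycles Q) i j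
   + #|[set a in cover (max_two_cycles Q) | (src a == i) && (tgt a == j)]|)%N
  = narrows Q i j.
Proof.
rewrite addnC -[narrows Q i j](cardsID (cover (max_two_cycles Q))); congr addn.
  by apply: eq_card => a; rewrite !inE andbC.
rewrite /narrows -(card_imset _ val_inj); apply: eq_card => a.
apply/imsetP/idP => [[b] |]; rewrite !inE => h.
  by move=> ->; rewrite h (valP b).
case/andP: h => h1 h2; exists (Sub a h1) => //; rewrite inE //.
Qed.

(** A surviving 2-cycle would be disjoint from all chosen ones, so adding it would contradict the
    maximality of the collection. *)
Lemma no_two_cycles_cancel Q : no_two_cycles (cancel_two_cycles Q).
Proof.
move=> a b; apply/negP => ab.
have [/andP[tC C2] maxC] := maxsetP (max_two_cyclesP Q).
set C := max_two_cycles Q in tC C2 maxC *.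
pose c := [set val a; val b].
have cN x : x \in c -> x \notin cover C.
  by rewrite !inE => /orP[] /eqP ->; [exact: (valP a) | exact: (valP b)].
have dis B : B \in C -> [disjoint c & B].
  move=> BC; apply/pred0P => x /=; apply/negP => /andP[xc xB].
  by case/negP: (cN _ xc); rewrite /cover; apply/bigcupP; exists B.
suff: c \in C.
  move=> cC; have /negP[] := cN (val a) (set21 _ _).
  by rewrite /cover; apply/bigcupP; exists c => //; rewrite set21.
suff d : disjoint_two_cycles (c |: C).
  by rewrite -(maxC _ d (subsetUr _ _)) setU11.
apply/andP; split.
  apply/trivIsetP => A B; rewrite !inE => /orP[/eqP ->|AC] /orP[/eqP ->|BC].
  - by rewrite eqxx.
  - by rewrite dis.
  - by rewrite disjoint_sym dis.
  - by move/trivIsetP: tC; apply.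
apply/forall_inP => A; rewrite !inE => /orP[/eqP ->|]; last by move/forall_inP: C2; apply.
by apply/existsP; exists (val a); apply/existsP; exists (val b); rewrite eqxx andbT.
Qed.

(** Equally many arrows are removed in both directions, and in at least one direction none remain;
    this determines the remaining number. *)
Lemma narrows_cancelE Q i j : no_loops Q ->
  narrows (cancel_two_cycles Q) i j = (narrows Q i j - narrows Q j i)%N.
Proof.
move=> nl; have nl' : no_loops (cancel_two_cycles Q) by move=> a; apply: nl.
have := acyclic2_narrows nl' (@no_two_cycles_cancel Q) i j.
have [dC _] := maxsetP (max_two_cyclesP Q).
have := narrows_cancel Q i j; have := narrows_cancel Q j i.
rewrite (cover_two_cycles_sym i j dC); lia.
Qed.

Lemma no_loops_premut k Q : no_loops Q -> no_two_cycles Q -> no_loops (premut k Q).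
Proof.
move=> nl n2 [a|[[b a] /= /andP[/= sb ta]]] /=.
  by case: ifP => _; rewrite ?nl // eq_sym nl.
apply/negP => /eqP st; have := n2 a b; rewrite /two_cycle nl.
by rewrite st (eqP sb) ta eqxx.
Qed.

Lemma narrows_premut k Q i j : no_loops Q ->
  narrows (premut k Q) i j =
  (if (i == k) || (j == k) then narrows Q j i
   else narrows Q i j + narrows Q i k * narrows Q k j)%N.
Proof.
move=> nl; rewrite /narrows.
pose il : arrow Q -> arrow (premut k Q) := inl.
pose ir : {p : arrow Q * arrow Q | through k p} -> arrow (premut k Q) := inr.
pose A := il @: [set a | (src (il a) == i) && (tgt (il a) == j)].
pose B := ir @: [set c | (src (ir c) == i) && (tgt (ir c) == j)].
have -> : [set a : arrow (premut k Q) | (src a == i) && (tgt a == j)] = A :|: B.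
  apply/setP => -[a|c]; rewrite !inE.
    rewrite [in X in _ || X](_ : _ \in _ = false) ?orbF; last first.
      by apply/negbTE/imsetP => -[].
    by rewrite mem_imset ?inE // => ? ? [].
  rewrite [in X in X || _](_ : _ \in _ = false) ?orFb; last first.
    by apply/negbTE/imsetP => -[].
  by rewrite mem_imset ?inE // => ? ? [].
have dAB : [disjoint A & B].
  by apply/pred0P => x /=; apply/negP => /andP[/imsetP[a _ ->] /imsetP[]].
rewrite cardsU disjoint_setI0 // cards0 subn0 /A /B !card_imset; try by move=> ? ? [].
(* Pairs through [k] form a product set: the arrow from [k] to [j] and the arrow from [i] to [k] are
   chosen independently. *)
have cB : #|[set c | (src (ir c) == i) && (tgt (ir c) == j)]|
  = (narrows Q i k * narrows Q k j)%N.
  rewrite mulnC /narrows -cardsX -(card_imset _ val_inj); apply: eq_card => -[b a].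
  apply/imsetP/idP => [[[[b' a'] /= th]] |].
    rewrite !inE /= => /andP[/eqP <- /eqP <-] [-> ->].
    by case/andP: th => /= -> ->; rewrite !eqxx.
  rewrite !inE /= => /andP[/andP[sb tb] /andP[sa ta]].
  have th : through k (b, a) by rewrite /through /= sb.
  by exists (Sub (b, a) th) => //; rewrite inE /= sa tb.
rewrite cB; case: ifP => [/orP[]/eqP e|/norP[ik jk]].
- rewrite e -/(narrows Q k k) narrows_loop // mul0n addn0; apply: eq_card => a.
  rewrite !inE /=; have nla := nl a.
  by case: (eqVneq (src a) k) nla => [->|/negbTE sk]; case: (eqVneq (tgt a) k)
    => [->|/negbTE tk]; rewrite /= ?eqxx ?sk ?tk ?andbT ?andbF.
- rewrite e -/(narrows Q k k) narrows_loop // muln0 addn0; apply: eq_card => a.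
  rewrite !inE /=; have nla := nl a.
  by case: (eqVneq (src a) k) nla => [->|/negbTE sk]; case: (eqVneq (tgt a) k)
    => [->|/negbTE tk]; rewrite /= ?eqxx ?sk ?tk ?andbT ?andbF.
congr (_ + _)%N; apply: eq_card => a; rewrite !inE /=.
by case: (eqVneq (src a) k) => [->|sk]; case: (eqVneq (tgt a) k) => [->|tk];
  rewrite //= ![k == _]eq_sym ?(negbTE ik) ?(negbTE jk) ?andbF.
Qed.

Lemma no_loops_mutation k Q :
  no_loops Q -> no_two_cycles Q -> no_loops (mutation k Q).
Proof. by move=> nl n2 a; apply: (no_loops_premut (k := k) nl n2). Qed.

Lemma narrows_mutation k Q :
  no_loops Q -> no_two_cycles Q ->
  narrows (mutation k Q) =2 mutate_numbers k (narrows Q).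
Proof.
move=> nl n2 i j; rewrite /mutation narrows_cancelE; last exact: no_loops_premut.
rewrite !narrows_premut // /mutate_numbers [(j == k) || _]orbC; case: ifP => // _.
(* Arrows at [k] are only reversed; without 2-cycles the truncated difference removes nothing
   there. *)
by case: (acyclic2_narrows nl n2 i j) => ->; rewrite ?sub0n ?subn0.
Qed.

Lemma eq_mutate_numbers k N N' :
  N =2 N' -> mutate_numbers k N =2 mutate_numbers k N'.
Proof. by move=> NN i j; rewrite /mutate_numbers !NN. Qed.

End ArrowNumbers.

(** * The path algebra and cyclic derivatives *)

(* A copy of the path algebra whose operations are locked, to keep unification
   from unfolding those of [pathalg]. *)
Definition palg (K : fieldType) (V : finType) (Q : quiver V) : Type := pathalg K Q.

Section LockedOperations.
Variables (K : fieldType) (V : finType) (Q : quiver V).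
Local Notation B := (pathalg K Q).
Local Notation A := (palg K Q).

HB.instance Definition _ := Choice.copy A B.

Definition to_palg (x : B) : A := x.
Definition of_palg (x : A) : B := x.

Fact palg_key : unit. Proof. by []. Qed.
Definition palg_zero : A := locked_with palg_key (0 : B).
Definition palg_one : A := locked_with palg_key (1 : B).
Definition palg_opp : A -> A := locked_with palg_key (fun x : B => - x).
Definition palg_add : A -> A -> A := locked_with palg_key (fun x y : B => x + y).
Definition palg_mul : A -> A -> A := locked_with palg_key (fun x y : B => x * y).
Definition palg_scale : K -> A -> A :=
  locked_with palg_key (fun k (x : B) => k *: x).

Fact palg_addA : associative palg_add.
Proof. by rewrite /palg_add unlock => x y z; exact: addrA. Qed.
Fact palg_addC : commutative palg_add.
Proof. by rewrite /palg_add unlock => x y; exact: addrC. Qed.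
Fact palg_add0 : left_id palg_zero palg_add.
Proof. by rewrite /palg_add /palg_zero !unlock => x; exact: add0r. Qed.
Fact palg_addN : left_inverse palg_zero palg_opp palg_add.
Proof. by rewrite /palg_add /palg_zero /palg_opp !unlock => x; exact: addNr. Qed.
HB.instance Definition _ :=
  GRing.isZmodule.Build A palg_addA palg_addC palg_add0 palg_addN.

Fact palg_mulA : associative palg_mul.
Proof. by rewrite /palg_mul unlock => x y z; exact: mulrA. Qed.
Fact palg_mul1 : left_id palg_one palg_mul.
Proof. by rewrite /palg_mul /palg_one !unlock => x; exact: mul1r. Qed.
Fact palg_mulr1 : right_id palg_one palg_mul.
Proof. by rewrite /palg_mul /palg_one !unlock => x; exact: mulr1. Qed.
Fact palg_mulDl : left_distributive palg_mul palg_add.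
Proof. by rewrite /palg_mul /palg_add !unlock => x y z; exact: mulrDl. Qed.
Fact palg_mulDr : right_distributive palg_mul palg_add.
Proof. by rewrite /palg_mul /palg_add !unlock => x y z; exact: mulrDr. Qed.
HB.instance Definition _ := GRing.Zmodule_isPzRing.Build A
  palg_mulA palg_mul1 palg_mulr1 palg_mulDl palg_mulDr.

Fact palg_scaleA a b x : palg_scale a (palg_scale b x) = palg_scale (a * b) x.
Proof. by rewrite /palg_scale unlock; exact: scalerA. Qed.
Fact palg_scale1 : left_id 1 palg_scale.
Proof. by rewrite /palg_scale unlock => x; exact: scale1r. Qed.
Fact palg_scaleDr : right_distributive palg_scale palg_add.
Proof. by rewrite /palg_scale /palg_add !unlock => k x y; exact: scalerDr. Qed.
Fact palg_scaleDl x : {morph palg_scale^~ x : a b / a + b >-> palg_add a b}.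
Proof. by rewrite /palg_scale /palg_add !unlock => k l; exact: scalerDl. Qed.
HB.instance Definition _ := GRing.Zmodule_isLmodule.Build K A
  palg_scaleA palg_scale1 palg_scaleDr palg_scaleDl.

Lemma to_palgD (x y : B) : to_palg (x + y) = to_palg x + to_palg y.
Proof. by rewrite [RHS]/(palg_add _ _) /palg_add unlock. Qed.
Lemma to_palgM (x y : B) : to_palg (x * y) = to_palg x * to_palg y.
Proof. by rewrite [RHS]/(palg_mul _ _) /palg_mul unlock. Qed.
Lemma to_palgZ k (x : B) : to_palg (k *: x) = k *: to_palg x.
Proof. by rewrite [RHS]/(palg_scale _ _) /palg_scale unlock. Qed.
Lemma to_palg0 : to_palg 0 = 0.
Proof. by rewrite (_ : 0 = palg_zero :> A) // /palg_zero unlock. Qed.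
Lemma to_palg1 : to_palg 1 = 1.
Proof. by rewrite (_ : 1 = palg_one :> A) // /palg_one unlock. Qed.
Lemma to_palg_linear : linear to_palg.
Proof. by move=> k x y; rewrite to_palgD to_palgZ. Qed.
Lemma of_palg_linear : linear of_palg.
Proof.
by move=> k x y; rewrite -[x]/(to_palg (of_palg x)) -[y]/(to_palg (of_palg y)) -to_palg_linear.
Qed.
Lemma to_palg_sum I (r : seq I) (F : I -> B) :
  to_palg (\sum_(i <- r) F i) = \sum_(i <- r) to_palg (F i).
Proof. exact: (big_morph to_palg to_palgD to_palg0). Qed.
Lemma to_palg_prod I (r : seq I) (F : I -> B) :
  to_palg (\prod_(i <- r) F i) = \prod_(i <- r) to_palg (F i).
Proof. exact: (big_morph to_palg to_palgM to_palg1). Qed.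

End LockedOperations.

Definition path_elt (K : fieldType) (V : finType) (Q : quiver V) (p : qpath Q)
  : palg K Q := locked (to_palg (pbasis K p)).
Definition idem (K : fieldType) (V : finType) (Q : quiver V) (v : V) : palg K Q :=
  path_elt K (trivial_path Q v).
Definition arrow_elt (K : fieldType) (V : finType) (Q : quiver V) (a : arrow Q)
  : palg K Q := path_elt K (arrow_path a).
Definition word_prod (K : fieldType) (V : finType) (Q : quiver V) (s : seq (arrow Q))
  : palg K Q := \prod_(a <- s) arrow_elt K a.

Section PathAlgebraTheory.
Variables (K : fieldType) (V : finType) (Q : quiver V).
Local Notation A := (palg K Q).
Local Notation e := (@idem K V Q).
Local Notation ar := (@arrow_elt K V Q).
Local Notation pb := (@path_elt K V Q).
Local Notation wordA := (@word_prod K V Q).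
Implicit Types (x y z : A) (a b c : arrow Q) (s : seq (arrow Q)) (p q : qpath Q).

Lemma scaleA_l (k : K) x y : (k *: x) * y = k *: (x * y).
Proof.
have h : (k *: of_palg x) * of_palg y = k *: (of_palg x * of_palg y) := pmulZl _ _ _.
by have := f_equal (@to_palg K V Q) h; rewrite !(to_palgM, to_palgZ).
Qed.

Lemma scaleA_r (k : K) x y : x * (k *: y) = k *: (x * y).
Proof.
have h : of_palg x * (k *: of_palg y) = k *: (of_palg x * of_palg y) := pmulZr _ _ _.
by have := f_equal (@to_palg K V Q) h; rewrite !(to_palgM, to_palgZ).
Qed.

Lemma path_eltE p : to_palg (pbasis K p) = pb p.
Proof. by rewrite /path_elt -lock. Qed.

Lemma vtxE v : to_palg (vtx K Q v) = e v.
Proof. exact: path_eltE. Qed.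

Lemma arrE a : to_palg (arr K a) = ar a.
Proof. exact: path_eltE. Qed.

Lemma word_eltE s : to_palg (word_elt K s) = wordA s.
Proof. by rewrite to_palg_prod; apply: eq_bigr => a _; rewrite arrE. Qed.

Lemma mul_path p q : pb p * pb q = if psrc p == ptgt q then pb (pcat p q) else 0.
Proof.
rewrite -!path_eltE -to_palgM [pbasis K p * _]pmul_basis /bmul.
by case: eqP => // _; rewrite to_palg0.
Qed.

Lemma vtx_basis v p : e v * pb p = if v == ptgt p then pb p else 0.
Proof.
rewrite mul_path -[psrc _]/v.
by case: eqP => // ->; rewrite pcat_trivl.
Qed.

Lemma basis_vtx v p : pb p * e v = if v == psrc p then pb p else 0.
Proof.
rewrite mul_path -[ptgt _]/v [in RHS]eq_sym.
by case: eqP => // <-; rewrite pcat_trivr.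
Qed.

Lemma vtxM v w : e v * e w = if v == w then e v else 0.
Proof. by rewrite vtx_basis -[ptgt _]/w; case: eqP => // ->. Qed.

Lemma vtx_arr v a : e v * ar a = if v == tgt a then ar a else 0.
Proof. by rewrite vtx_basis. Qed.

Lemma arr_vtx v a : ar a * e v = if v == src a then ar a else 0.
Proof. by rewrite basis_vtx. Qed.

Lemma one_vtx : 1 = \sum_v e v :> A.
Proof.
by rewrite -to_palg1 (to_palg_sum _ (vtx K Q)); apply: eq_bigr => v _; rewrite vtxE.
Qed.

Lemma qpath_nil p : word p = [::] -> p = trivial_path Q (ptgt p).
Proof. by case: p => -[v s] h; rewrite /word /= => s0; apply: val_inj; rewrite /= -s0. Qed.

Lemma qpath_cons p a s : word p = a :: s ->
  exists p', [/\ word p' = s, ptgt p = tgt a, ptgt p' = src a, psrc p' = psrc p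
               & pb p = ar a * pb p'].
Proof.
case: p => -[v t] h; rewrite {1}/word /= => st; subst t.
have /andP[/= /eqP ta ps] := h.
have wf' : wf_path (src a, s).
  rewrite /wf_path /=; case: s ps {h} => //= b s /andP[/eqP <-] ->.
  by rewrite eqxx.
exists (QPath wf'); split=> //.
rewrite mul_path /psrc /ptgt /= eqxx; congr path_elt; apply: val_inj.
by rewrite val_pcat //= -ta.
Qed.

Lemma word_cons a s : wordA (a :: s) = ar a * wordA s.
Proof. by rewrite /word_prod big_cons. Qed.

Lemma word_nil : wordA [::] = 1.
Proof. by rewrite /word_prod big_nil. Qed.

Lemma word_cat s1 s2 : wordA (s1 ++ s2) = wordA s1 * wordA s2.
Proof. by rewrite /word_prod big_cat. Qed.

Lemma basis_word_r p : pb p = wordA (word p) * e (psrc p).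
Proof.
elim: (word p) {-2}p (erefl (word p)) => [|a s IH] {}p wp.
  by rewrite wp word_nil mul1r (qpath_nil wp).
have [p' [w' _ _ <- ->]] := qpath_cons wp.
by rewrite wp word_cons -mulrA -w' -IH.
Qed.

Lemma basis_word_l p : pb p = e (ptgt p) * wordA (word p).
Proof.
elim: (word p) {-2}p (erefl (word p)) => [|a s IH] {}p wp.
  by rewrite wp word_nil mulr1 [in LHS](qpath_nil wp).
have [p' [w' tp tp' _ ep]] := qpath_cons wp.
by rewrite ep (IH p' w') tp tp' wp word_cons w' !mulrA vtx_arr arr_vtx !eqxx.
Qed.

Lemma palgE x : x = \sum_(p <- monalg.msupp (of_palg x)) pcoef (of_palg x) p *: pb p.
Proof.
rewrite -[LHS]/(to_palg (of_palg x)) [in LHS](pathalgE (of_palg x)) to_palg_sum.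
by apply: eq_bigr => p _; rewrite to_palgZ path_eltE.
Qed.

Lemma palg_basis_ind (P : A -> Prop) :
  P 0 -> (forall k x y, P x -> P y -> P (k *: x + y)) ->
  (forall p, P (pb p)) -> forall x, P x.
Proof.
move=> P0 PD Pb x; rewrite [x]palgE.
by elim: (enum_fset _) => [|p s IH]; rewrite ?big_nil // big_cons; apply: PD.
Qed.

Lemma palg_ext (M : lmodType K) (f g : A -> M) :
  linear f -> linear g -> (forall p, f (pb p) = g (pb p)) -> f =1 g.
Proof.
move=> fl gl fg; apply: palg_basis_ind => [|k x y fx fy|p]; last exact: fg.
  by rewrite (lin0 fl) (lin0 gl).
by rewrite fl gl fx fy.
Qed.

Definition lextend (M : lmodType K) (f : qpath Q -> M) (x : A) : M :=
  locked (extend f (of_palg x)).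

Lemma lextend_linear (M : lmodType K) (f : qpath Q -> M) : linear (lextend f).
Proof. by move=> k x y; rewrite /lextend -!lock of_palg_linear extend_is_linear. Qed.

Lemma lextend_basis (M : lmodType K) (f : qpath Q -> M) p : lextend f (pb p) = f p.
Proof. by rewrite /lextend -lock -path_eltE; exact: extend_basis. Qed.

Lemma palg_ind (P : A -> Prop) :
  P 0 -> (forall k x y, P x -> P y -> P (k *: x + y)) ->
  (forall x y, P x -> P y -> P (x * y)) ->
  (forall v, P (e v)) -> (forall a, P (ar a)) -> forall x, P x.
Proof.
move=> P0 PD PM Pv Pa; apply: palg_basis_ind => // p.
have PS x y : P x -> P y -> P (x + y) by move=> Px Py; rewrite -[x]scale1r; apply: PD.
rewrite basis_word_l; apply: (PM) => //.
elim: (word p) => [|a s IH]; last by rewrite word_cons; apply: PM.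
by rewrite word_nil one_vtx; elim/big_ind: _.
Qed.

(* [cut c x y] inserts [y] at the ends of [x] and opens the resulting cyclic
   words at each occurrence of [c] in [x]: on a path [x = s c t] it contributes
   [t y s].  It satisfies the Leibniz rule [cut_mul], and [cut c W 1] is the
   cyclic derivative of [W]. *)
Fixpoint cut_word c s y : A :=
  if s is a :: s' then
    (if a == c then wordA s' * y else 0) + cut_word c s' (y * ar a)
  else 0.

Definition cut c x y : A :=
  lextend (fun p => cut_word c (word p) (e (psrc p) * y * e (ptgt p))) x.

Lemma cut_word_cons c a s y : cut_word c (a :: s) y =
  (if a == c then wordA s * y else 0) + cut_word c s (y * ar a).
Proof. by []. Qed.

Lemma cut_word_nil c y : cut_word c [::] y = 0.
Proof. by []. Qed.

Lemma cut_word_linear c s : linear (cut_word c s).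
Proof.
elim: s => [|a s IH] k y z; first by rewrite !cut_word_nil scaler0 addr0.
rewrite !cut_word_cons.
rewrite mulrDl scaleA_l IH scalerDr addrACA; congr (_ + _).
by case: eqP => _; rewrite ?mulrDr ?scaleA_r // scaler0 addr0.
Qed.

Lemma cut_linear_l c y : linear (cut c ^~ y).
Proof. by move=> k x z; rewrite /cut lextend_linear. Qed.

Lemma cut_basis c p y :
  cut c (pb p) y = cut_word c (word p) (e (psrc p) * y * e (ptgt p)).
Proof. by rewrite /cut lextend_basis. Qed.

Lemma cut_linear_r c x : linear (cut c x).
Proof.
move=> k y z; move: x; apply: palg_ext => [l u v|l u v|p].
- by rewrite cut_linear_l.
- by rewrite !cut_linear_l !scalerDr !scalerA [k * l]mulrC addrACA.
by rewrite !cut_basis mulrDr scaleA_r mulrDl scaleA_l cut_word_linear.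
Qed.

Lemma cut_vtx c v y : cut c (e v) y = 0.
Proof. by rewrite cut_basis -[word _]/[::] cut_word_nil. Qed.

Lemma cut_arr c a y :
  cut c (ar a) y = if a == c then e (src a) * y * e (tgt a) else 0.
Proof.
rewrite cut_basis -[word _]/[:: a] -[psrc _]/(src a) -[ptgt _]/(tgt a).
by rewrite cut_word_cons cut_word_nil addr0 word_nil mul1r.
Qed.

Lemma cut_word_cat c s t y :
  cut_word c (s ++ t) y = cut_word c s (wordA t * y) + cut_word c t (y * wordA s).
Proof.
elim: s y => [|a s IH] y; first by rewrite word_nil mulr1 cut_word_nil add0r.
rewrite cat_cons !cut_word_cons IH word_cat word_cons !mulrA addrA.
by case: eqP => _; rewrite // mulrA.
Qed.

Lemma cut_word0 c s : cut_word c s 0 = 0.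
Proof. exact: lin0 (cut_word_linear c s). Qed.

(** An occurrence of [c] in [x1] is opened with [x2 * y] as the rest of the cyclic word, one in [x2]
    with [y * x1]. For paths that do not compose, the idempotents placed around [y] in [cut] make
    both terms vanish. *)
Lemma cut_mul c x1 x2 y :
  cut c (x1 * x2) y = cut c x1 (x2 * y) + cut c x2 (y * x1).
Proof.
move: x1; apply: palg_ext => [k u v|k u v|p].
- by rewrite mulrDl scaleA_l cut_linear_l.
- rewrite cut_linear_l mulrDr scaleA_r cut_linear_r.
  by rewrite scalerDr !addrA; congr (_ + _); rewrite -!addrA; congr (_ + _); rewrite addrC.
move: x2; apply: palg_ext => [k u v|k u v|q].
- by rewrite mulrDr scaleA_r cut_linear_l.
- rewrite cut_linear_l mulrDl scaleA_l cut_linear_r.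
  by rewrite scalerDr addrACA.
rewrite mul_path; case: eqP => [pq|npq].
  rewrite !cut_basis psrc_pcat // ptgt_pcat //.
  have -> : word (pcat p q) = word p ++ word q by rewrite /word val_pcat.
  rewrite cut_word_cat.
  have eq1 : e (psrc p) * pb q = pb q by rewrite vtx_basis pq eqxx.
  have eq2 : pb p * e (ptgt q) = pb p by rewrite basis_vtx -pq eqxx.
  have -> : wordA (word q) * (e (psrc q) * y * e (ptgt p)) =
            e (psrc p) * (pb q * y) * e (ptgt p).
    by rewrite !mulrA -basis_word_r eq1.
  have -> // : e (psrc q) * y * e (ptgt p) * wordA (word p) =
            e (psrc q) * (y * pb p) * e (ptgt q).
  by rewrite -!mulrA -basis_word_l eq2.
rewrite (lin0 (cut_linear_l c y)) !cut_basis !mulrA vtx_basis -!mulrA basis_vtx.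
case: eqP => [/npq[]|_]; case: eqP => [/esym/npq[]|_].
by rewrite !mulr0 mul0r !cut_word0 addr0.
Qed.

Lemma cut0l c y : cut c 0 y = 0.
Proof. exact: lin0 (cut_linear_l c y). Qed.

Lemma cut0r c x : cut c x 0 = 0.
Proof. exact: lin0 (cut_linear_r c x). Qed.

Lemma cutDl c x y z : cut c (x + y) z = cut c x z + cut c y z.
Proof. by have := cut_linear_l c z 1 x y; rewrite !scale1r. Qed.

Lemma cut_ends c x y : e (src c) * cut c x y * e (tgt c) = cut c x y.
Proof.
move: x y; apply: palg_ind => [y|k x1 x2 IH1 IH2 y|x1 x2 IH1 IH2 y|v y|a y].
- by rewrite cut0l mulr0 mul0r.
- by rewrite cut_linear_l mulrDr scaleA_r mulrDl scaleA_l IH1 IH2.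
- by rewrite cut_mul mulrDr mulrDl IH1 IH2.
- by rewrite cut_vtx mulr0 mul0r.
rewrite cut_arr; case: eqP => [->|]; last by rewrite mulr0 mul0r.
by rewrite !mulrA vtxM eqxx -!mulrA vtxM eqxx.
Qed.

Definition cyc_diff c x := cut c x 1.

(** With 1 inserted, [cut_mul] gives the same two terms for [x1 * x2] and [x2 * x1], so rotating a
    cyclic word by one letter does not affect the derivative. *)
Lemma cyc_diff_cyc x y c : cyc_equiv (of_palg x) (of_palg y) -> cyc_diff c x = cyc_diff c y.
Proof.
case=> s _ h; have -> : x = y + (x - y) by rewrite addrC subrK.
have {h} -> : x - y = \sum_(c <- s) c.1 *: (wordA c.2 - wordA (rot 1 c.2)).
  have subE u v : to_palg (of_palg u - of_palg v) = u - v.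
    by rewrite addrC -scaleN1r (to_palg_linear _ (of_palg v)) scaleN1r addrC.
  rewrite -subE h to_palg_sum; apply: eq_bigr => -[k w] _ /=.
  by rewrite to_palgZ -!word_eltE -subE.
rewrite /cyc_diff cutDl -[RHS]addr0; congr (_ + _).
elim: s => [|[k w] s IH]; first by rewrite big_nil cut0l.
rewrite big_cons cut_linear_l IH addr0 /=.
case: w => [|a w]; first by rewrite subrr cut0l scaler0.
rewrite rot1_cons -cats1 word_cat !word_cons word_nil mulr1 addrC -scaleN1r.
by rewrite cut_linear_l !cut_mul !mulr1 !mul1r scaleN1r addrC [X in X - _]addrC subrr scaler0.
Qed.

End PathAlgebraTheory.

(** * Path length filtration and augmentations *)

Section Gradings.
Variables (K : fieldType) (V : finType) (Q : quiver V).
Local Notation A := (palg K Q).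
Local Notation e := (@idem K V Q).
Local Notation ar := (@arrow_elt K V Q).
Local Notation pb := (@path_elt K V Q).
Local Notation wordA := (@word_prod K V Q).
Implicit Types (x y z : A) (a b c : arrow Q) (s : seq (arrow Q)) (p q : qpath Q).

Definition path_coef x p : K := pcoef (of_palg x) p.

Lemma path_coef_linear k x y p : path_coef (k *: x + y) p = k * path_coef x p + path_coef y p.
Proof.
rewrite /path_coef /pcoef of_palg_linear monalg.mcoeffD.
by rewrite (@monalg.mcoeffZ (qpath Q) K).
Qed.

Lemma path_coef0 p : path_coef 0 p = 0.
Proof. by have := path_coef_linear (-1) 0 0 p; rewrite scaleN1r addNr mulN1r addNr. Qed.

Lemma path_coefD x y p : path_coef (x + y) p = path_coef x p + path_coef y p.
Proof. by have := path_coef_linear 1 x y p; rewrite scale1r mul1r. Qed.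

Lemma path_coefZ k x p : path_coef (k *: x) p = k * path_coef x p.
Proof. by rewrite -[k *: x]addr0 path_coef_linear path_coef0 addr0. Qed.

Lemma path_coef_basis p q : path_coef (pb p) q = (p == q)%:R.
Proof.
rewrite /path_coef -path_eltE /pcoef /of_palg /to_palg /pbasis.
by rewrite (@monalg.mcoeffU (qpath Q) K).
Qed.

(** Membership in the [d]-th power of the ideal spanned by the paths of positive length. *)
Definition deg_ge d x := forall p, path_coef x p != 0 -> (d <= size (word p))%N.

Lemma deg_ge_ind d (P : A -> Prop) :
  P 0 -> (forall k x y, P x -> P y -> P (k *: x + y)) ->
  (forall p, (d <= size (word p))%N -> P (pb p)) -> forall x, deg_ge d x -> P x.
Proof.
move=> P0 PD Pb x dx; rewrite [x]palgE big_seq.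
elim/big_rec: _ => // p y px Py; apply: PD => //; apply: Pb; apply: dx.
by rewrite /path_coef /pcoef monalg.mcoeff_neq0.
Qed.

Lemma deg_ge_linear d k x y : deg_ge d x -> deg_ge d y -> deg_ge d (k *: x + y).
Proof.
move=> dx dy p; rewrite path_coef_linear => h.
have [cx|/dx//] := eqVneq (path_coef x p) 0; apply: dy.
by move: h; rewrite cx mulr0 add0r.
Qed.

Lemma deg_ge0 d : deg_ge d 0.
Proof. by move=> p; rewrite path_coef0 eqxx. Qed.

Lemma deg_geD d x y : deg_ge d x -> deg_ge d y -> deg_ge d (x + y).
Proof. by move=> dx dy; rewrite -[x]scale1r; apply: deg_ge_linear. Qed.

Lemma deg_ge_basis p : deg_ge (size (word p)) (pb p).
Proof. by move=> q; rewrite path_coef_basis; case: (p =P q) => [->|_] //; rewrite eqxx. Qed.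

Lemma deg_ge_le d d' x : (d' <= d)%N -> deg_ge d x -> deg_ge d' x.
Proof. by move=> dd dx p /dx; apply: leq_trans. Qed.

Lemma deg_ge_any x : deg_ge 0 x.
Proof. by move=> p _. Qed.

Lemma deg_ge_mul d d' x y : deg_ge d x -> deg_ge d' y -> deg_ge (d + d') (x * y).
Proof.
move=> dx dy; move: x dx; apply: deg_ge_ind => [|k u v hu hv|p dp].
- by rewrite mul0r; apply: deg_ge0.
- by rewrite mulrDl scaleA_l; apply: deg_ge_linear.
move: y dy; apply: deg_ge_ind => [|k u v hu hv|q dq].
- by rewrite mulr0; apply: deg_ge0.
- by rewrite mulrDr scaleA_r; apply: deg_ge_linear.
rewrite mul_path; case: eqP => [pq|_]; last exact: deg_ge0.
apply: (@deg_ge_le (size (word (pcat p q)))); last exact: deg_ge_basis.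
by rewrite /word val_pcat //= size_cat leq_add.
Qed.

Lemma deg_ge_arr a : deg_ge 1 (ar a).
Proof. exact: (@deg_ge_basis (arrow_path a)). Qed.

Lemma deg_ge_word s : deg_ge (size s) (wordA s).
Proof.
elim: s => [|a s IH]; first exact: deg_ge_any.
by rewrite word_cons -[size _]/(1 + size s)%N; apply: deg_ge_mul => //; apply: deg_ge_arr.
Qed.

(** Opening a word deletes exactly one letter, the occurrence of [c]; this is the origin of the
    predecessor. *)
Lemma deg_ge_cut_word c s y d :
  deg_ge d y -> deg_ge (size s + d).-1 (cut_word c s y).
Proof.
elim: s y d => [|a s IH] y d dy; first by rewrite cut_word_nil; apply: deg_ge0.
rewrite cut_word_cons; apply: deg_geD.
  case: eqP => _; last exact: deg_ge0.
  by apply: deg_ge_mul => //; apply: deg_ge_word.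
rewrite [size (a :: s)]/= addSn -addnS -addn1; apply: IH.
by apply: deg_ge_mul => //; apply: deg_ge_arr.
Qed.

Lemma deg_ge_cut c d x y : deg_ge d x -> deg_ge d.-1 (cut c x y).
Proof.
move: x; apply: deg_ge_ind => [|k u v hu hv|p dp].
- by rewrite cut0l; apply: deg_ge0.
- by rewrite cut_linear_l; apply: deg_ge_linear.
rewrite cut_basis; apply: (@deg_ge_le (size (word p) + 0).-1); first by rewrite addn0; lia.
by apply: deg_ge_cut_word; apply: deg_ge_any.
Qed.

(** The character of the path algebra at [v]. Together the characters detect the ideal of
    positive-length paths, see [deg_ge1P]. *)
Definition aug v x : K := path_coef x (trivial_path Q v).

Lemma aug_vtx v w : aug v (e w) = (v == w)%:R.
Proof.
rewrite /aug path_coef_basis; congr (nat_of_bool _)%:R.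
by apply/eqP/eqP => [[->]|->].
Qed.

Lemma aug_arr v a : aug v (ar a) = 0.
Proof. by rewrite /aug path_coef_basis; case: eqP. Qed.

Lemma deg_ge1P x : deg_ge 1 x <-> forall v, aug v x = 0.
Proof.
split=> [dx v|h p]; last first.
  by rewrite lt0n; apply: contra_neq => /size0nil/qpath_nil ->; apply: h.
by apply/eqP; apply: contraTT isT => /dx.
Qed.

Lemma deg_ge1_aug x : deg_ge 1 (x - \sum_v aug v x *: e v).
Proof.
have aug_sum v (F : V -> K) : aug v (\sum_w F w *: e w) = F v.
  rewrite /aug (big_morph (fun z => path_coef z _) (id1 := 0) (op1 := +%R)); first last.
  - exact: path_coef0.
  - by move=> ? ?; rewrite path_coefD.
  rewrite (bigD1 v) //= big1 ?addr0 => [|w /negPf wv].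
    by rewrite path_coefZ [path_coef _ _]aug_vtx eqxx mulr1.
  by rewrite path_coefZ [path_coef _ _]aug_vtx eq_sym wv mulr0.
apply/deg_ge1P => v; rewrite /aug addrC -scaleN1r path_coef_linear mulN1r.
by rewrite [X in - X + _]aug_sum addNr.
Qed.

(** Modulo positive degree both factors are combinations of vertex idempotents, on which
    multiplication is componentwise. *)
Lemma augM v x y : aug v (x * y) = aug v x * aug v y.
Proof.
have h1 u z : deg_ge 1 u -> aug v (u * z) = 0.
  move=> hu; have /deg_ge1P -> // : deg_ge 1 (u * z).
  by rewrite -[1%N]addn0; apply: deg_ge_mul => //; apply: deg_ge_any.
have h2 u z : deg_ge 1 u -> aug v (z * u) = 0.
  move=> hu; have /deg_ge1P -> // : deg_ge 1 (z * u).
  by rewrite -[1%N]add0n; apply: deg_ge_mul => //; apply: deg_ge_any.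
have augB z u : aug v (z - u) = aug v z - aug v u.
  by rewrite /aug addrC -scaleN1r path_coef_linear mulN1r addrC.
have augS I (r : seq I) (F : I -> A) : aug v (\sum_(i <- r) F i) = \sum_(i <- r) aug v (F i).
  apply: (big_morph (fun z => path_coef z _)); last exact: path_coef0.
  by move=> ? ?; rewrite path_coefD.
have ex := h1 _ y (@deg_ge1_aug x).
have /eqP := ex; rewrite mulrBl augB subr_eq0 => /eqP ->.
rewrite mulr_suml augS (bigD1 v) //= big1 ?addr0 => [|w wv]; last first.
  rewrite scaleA_l /aug path_coefZ -/(aug v (e w * y)).
  have /eqP := h2 _ (e w) (@deg_ge1_aug y); rewrite mulrBr augB subr_eq0 => /eqP ->.
  rewrite mulr_sumr augS big1 ?mulr0 // => u _; rewrite scaleA_r vtxM /aug path_coefZ.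
  case: eqP => _; last by rewrite path_coef0 mulr0.
  by rewrite -/(aug v (e w)) aug_vtx eq_sym (negbTE wv) mulr0.
rewrite scaleA_l /aug path_coefZ -/(aug v (e v * y)) -/(aug v x) -/(aug v y); congr (_ * _).
have /eqP := h2 _ (e v) (@deg_ge1_aug y); rewrite mulrBr augB subr_eq0 => /eqP ->.
rewrite mulr_sumr augS (bigD1 v) //= big1 ?addr0 => [|w wv]; last first.
  by rewrite scaleA_r vtxM eq_sym (negbTE wv) scaler0 /aug path_coef0.
by rewrite scaleA_r vtxM eqxx /aug path_coefZ -/(aug v (e v)) aug_vtx eqxx mulr1.
Qed.

Lemma deg_ge1_ends x v w : v != w -> e v * x * e w = x -> deg_ge 1 x.
Proof.
move=> vw <-; apply/deg_ge1P => u; rewrite !augM !aug_vtx.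
case: (eqVneq u v) => [->|_]; last by rewrite !mul0r.
by rewrite (negbTE vw) mulr0.
Qed.

Lemma deg_ge1_paths_ind (P : A -> Prop) v w :
  P 0 -> (forall k x y, P x -> P y -> P (k *: x + y)) ->
  (forall p, (0 < size (word p))%N -> ptgt p = v -> psrc p = w -> P (pb p)) ->
  forall x, e v * x * e w = x -> deg_ge 1 x -> P x.
Proof.
move=> P0 PD Pp x xe dx; rewrite -xe; move: x dx {xe}.
apply: deg_ge_ind => [|k x y IHx IHy|p dp]; first by rewrite mulr0 mul0r.
  by rewrite mulrDr scaleA_r mulrDl scaleA_l; apply: PD.
rewrite vtx_basis; case: eqP => [pv|_]; last by rewrite mul0r.
by rewrite basis_vtx; case: eqP => // pw; apply: Pp.
Qed.

End Gradings.

(** * Jacobian ideals and morphisms of path algebras *)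

Section JacobianIdeal.
Variables (K : fieldType) (V : finType) (Q : quiver V).
Local Notation A := (palg K Q).
Local Notation e := (@idem K V Q).
Local Notation ar := (@arrow_elt K V Q).
Implicit Types (x y z W : A) (a b c : arrow Q).

Record two_sided (I : A -> Prop) : Prop := TwoSided {
  two_sided0 : I 0;
  two_sidedD : forall x y, I x -> I y -> I (x + y);
  two_sidedMl : forall u x, I x -> I (u * x);
  two_sidedMr : forall u x, I x -> I (x * u) }.

Lemma two_sidedZ I k x : two_sided I -> I x -> I (k *: x).
Proof. by move=> iI Ix; rewrite -[x]mul1r -scaleA_l; apply: two_sidedMl. Qed.

Lemma two_sidedN I x : two_sided I -> I x -> I (- x).
Proof. by move=> iI Ix; rewrite -scaleN1r; apply: two_sidedZ. Qed.

Lemma two_sidedB I x y : two_sided I -> I x -> I y -> I (x - y).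
Proof. by move=> iI Ix Iy; apply: two_sidedD => //; apply: two_sidedN. Qed.

Lemma two_sided_linear I k x y : two_sided I -> I x -> I y -> I (k *: x + y).
Proof. by move=> iI Ix Iy; apply: two_sidedD => //; apply: two_sidedZ. Qed.

Lemma two_sided_sum I (J : Type) (r : seq J) (P : pred J) (F : J -> A) :
  two_sided I -> (forall j, P j -> I (F j)) -> I (\sum_(j <- r | P j) F j).
Proof.
by move=> iI h; elim/big_ind: _ => //; [apply: two_sided0 | apply: two_sidedD].
Qed.

(** Each term [t y s] of a cut keeps the inserted element as a factor. Combined with [cut_chain],
    this compares Jacobian ideals across morphisms. *)
Lemma two_sided_cut I c x y : two_sided I -> I y -> I (cut c x y).
Proof.
move=> iI; move: x y; apply: palg_ind => [y|k u v hu hv y|u v hu hv y|v y|a y] Iy.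
- by rewrite cut0l; apply: two_sided0.
- by rewrite cut_linear_l; apply: two_sided_linear; [|apply: hu|apply: hv].
- rewrite cut_mul; apply: (two_sidedD iI); first by apply: hu; apply: (two_sidedMl iI).
  by apply: hv; apply: (two_sidedMr iI).
- by rewrite cut_vtx; apply: two_sided0.
rewrite cut_arr; case: eqP => _; last exact: two_sided0.
by apply: (two_sidedMr iI); apply: (two_sidedMl iI).
Qed.

(** Explicit sums of multiples of derivatives rather than a closure under ideal operations: a map
    that is not multiplicative, such as [br], can then be treated by induction over the summands. *)
Inductive jac W : A -> Prop :=
| jac0 : jac W 0
| jac_add u c v x : jac W x -> jac W (u * cyc_diff c W * v + x).

Lemma jac_min W (I : A -> Prop) x :
  two_sided I -> (forall c, I (cyc_diff c W)) -> jac W x -> I x.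
Proof.
move=> iI gI; elim=> [|u c v y _ Iy]; first exact: two_sided0.
by apply: (two_sidedD iI) => //; apply: (two_sidedMr iI); apply: (two_sidedMl iI).
Qed.

Lemma jac_ideal W : two_sided (jac W).
Proof.
split=> [|x y jx jy|u x jx|u x jx]; first exact: jac0.
- by elim: jx => [|u c v z _ IH]; rewrite ?add0r // -addrA; apply: jac_add.
- elim: jx => [|w c v z _ IH]; first by rewrite mulr0; apply: jac0.
  by rewrite mulrDr !mulrA; apply: jac_add.
- elim: jx => [|w c v z _ IH]; first by rewrite mul0r; apply: jac0.
  by rewrite mulrDl -mulrA; apply: jac_add.
Qed.

Lemma jac_gen W c : jac W (cyc_diff c W).
Proof.
have := jac_add 1 c 1 (jac0 W); rewrite mul1r mulr1 addr0; exact: id.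
Qed.

Lemma eq_jac W W' x : (forall c, cyc_diff c W = cyc_diff c W') -> jac W x -> jac W' x.
Proof.
move=> h; apply: jac_min; first exact: jac_ideal.
by move=> c; rewrite h; apply: jac_gen.
Qed.

Lemma two_sided_deg_ge d : two_sided (@deg_ge K V Q d).
Proof.
split=> [|x y|u x dx|u x dx]; [exact: deg_ge0|exact: deg_geD| |].
  by rewrite -[d]add0n; apply: deg_ge_mul => //; apply: deg_ge_any.
by rewrite -[d]addn0; apply: deg_ge_mul => //; apply: deg_ge_any.
Qed.

End JacobianIdeal.

(** * Morphisms of path algebras fixing the vertices *)

Section AlgebraMorphisms.
Variables (K : fieldType) (V : finType).
Implicit Types Q : quiver V.

Record ahom Q Q' (f : palg K Q -> palg K Q') : Prop := AHom {
  ahom_linear : linear f;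
  ahomM : {morph f : x y / x * y};
  ahom_idem : forall v, f (idem K Q v) = idem K Q' v }.

Variables Q Q' : quiver V.
Implicit Types (f g : palg K Q -> palg K Q').

Lemma ahom0 f : ahom f -> f 0 = 0.
Proof. by case=> fl _ _; apply: lin0. Qed.

Lemma ahomD f x y : ahom f -> f (x + y) = f x + f y.
Proof. by case=> fl _ _; have := fl 1 x y; rewrite !scale1r. Qed.

Lemma ahom_sum f (I : Type) (r : seq I) (F : I -> palg K Q) :
  ahom f -> f (\sum_(i <- r) F i) = \sum_(i <- r) f (F i).
Proof.
move=> hf; apply: (big_morph f); last exact: ahom0.
by move=> x y; apply: ahomD.
Qed.

Lemma ahom1 f : ahom f -> f 1 = 1.
Proof.
move=> hf; rewrite !one_vtx ahom_sum //; apply: eq_bigr => v _.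
exact: ahom_idem.
Qed.

Lemma ahom_ends f x v w : ahom f -> idem K Q v * x * idem K Q w = x ->
  idem K Q' v * f x * idem K Q' w = f x.
Proof. by move=> hf {2}<-; rewrite !(ahomM hf) !(ahom_idem hf). Qed.

Lemma arrow_ends a : idem K Q (tgt a) * arrow_elt K a * idem K Q (src a) = arrow_elt K a.
Proof. by rewrite vtx_arr eqxx arr_vtx eqxx. Qed.

Lemma ahom_ext f g : ahom f -> ahom g ->
  (forall a, f (arrow_elt K a) = g (arrow_elt K a)) -> f =1 g.
Proof.
move=> hf hg fg; apply: palg_ind => [|k x y ex ey|x y ex ey|v|a].
- by rewrite !ahom0.
- by rewrite (ahom_linear hf) (ahom_linear hg) ex ey.
- by rewrite (ahomM hf) (ahomM hg) ex ey.
- by rewrite (ahom_idem hf) (ahom_idem hg).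
- exact: fg.
Qed.

(** Chain rule: an occurrence of [c] in [f x] lies in the image of an occurrence of some arrow [a]
    in [x]. So [x] is opened at [a], and the result is inserted into the opening of the image of [a]
    at [c]. *)
Lemma cut_chain f c x z : ahom f ->
  cut c (f x) (f z) = \sum_a cut c (f (arrow_elt K a)) (f (cut a x z)).
Proof.
move=> hf; move: x z.
apply: palg_ind => [z|k x y hx hy z|x y hx hy z|v z|b z].
- by rewrite ahom0 // cut0l big1 // => a _; rewrite cut0l ahom0 // cut0r.
- rewrite (ahom_linear hf) cut_linear_l hx hy scaler_sumr -big_split /=.
  by apply: eq_bigr => a _; rewrite cut_linear_l (ahom_linear hf) cut_linear_r.
- rewrite (ahomM hf) cut_mul -!(ahomM hf) hx hy -big_split /=.
  apply: eq_bigr => a _; rewrite cut_mul ahomD //.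
  by have := cut_linear_r c (f (arrow_elt K a)) 1 (f (cut a x (y * z))) (f (cut a y (z * x)));
    rewrite !scale1r.
- by rewrite (ahom_idem hf) cut_vtx big1 // => a _; rewrite cut_vtx ahom0 // cut0r.
rewrite (bigD1 b) //= big1 => [|a ab]; last first.
  by rewrite cut_arr eq_sym (negbTE ab) ahom0 // cut0r.
rewrite addr0 cut_arr eqxx 2!(ahomM hf) 2!(ahom_idem hf).
have := ahom_ends hf (arrow_ends b); set y := f (arrow_elt K b) => ey.
by rewrite -{1}ey !cut_mul !cut_vtx addr0 add0r.
Qed.

Lemma ahom_two_sided f (I : palg K Q' -> Prop) :
  ahom f -> two_sided I -> two_sided (fun x => I (f x)).
Proof.
move=> hf iI; split=> [|x y|u x|u x].
- by rewrite ahom0 //; apply: two_sided0.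
- by rewrite ahomD //; apply: two_sidedD.
- by rewrite (ahomM hf); apply: two_sidedMl.
- by rewrite (ahomM hf); apply: two_sidedMr.
Qed.

(** The leading idempotent provides the image of a trivial path, whose word is empty. *)
Definition extend_arrows (g : arrow Q -> palg K Q') : palg K Q -> palg K Q' :=
  lextend (fun p => idem K Q' (ptgt p) * \prod_(a <- word p) g a).

Lemma extend_arrows_path (g : arrow Q -> palg K Q') p : extend_arrows g (path_elt K p) =
  idem K Q' (ptgt p) * \prod_(a <- word p) g a.
Proof. exact: lextend_basis. Qed.

Lemma extend_arrows_linear (g : arrow Q -> palg K Q') : linear (extend_arrows g).
Proof. exact: lextend_linear. Qed.

Section ExtendArrows.
Variable g : arrow Q -> palg K Q'.
Hypothesis g_ends : forall a, idem K Q' (tgt a) * g a * idem K Q' (src a) = g a.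

Lemma extend_arrows_arr a : extend_arrows g (arrow_elt K a) = g a.
Proof.
rewrite extend_arrows_path -[word _]/[:: a] big_seq1 -[ptgt _]/(tgt a).
by rewrite -g_ends !mulrA vtxM eqxx.
Qed.

Lemma extend_arrows_src p :
  idem K Q' (ptgt p) * \prod_(a <- word p) g a =
  idem K Q' (ptgt p) * (\prod_(a <- word p) g a) * idem K Q' (psrc p).
Proof.
elim: (word p) {-2}p (erefl (word p)) => [|a s IH] {}p wp.
  by rewrite wp big_nil mulr1 (qpath_nil wp) vtxM eqxx.
have [p' [w' _ t' <- _]] := qpath_cons K wp.
rewrite wp big_cons -[g a]g_ends -t' -w' -!mulrA; congr (_ * (_ * (_ * _))).
by rewrite mulrA -IH.
Qed.

Lemma ahom_extend_arrows : ahom (extend_arrows g).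
Proof.
split.
- exact: extend_arrows_linear.
- move=> x y; move: x; apply: palg_ext => [k u v|k u v|p].
  + by rewrite mulrDl scaleA_l extend_arrows_linear.
  + by rewrite extend_arrows_linear mulrDl scaleA_l.
  move: y; apply: palg_ext => [k u v|k u v|q].
  + by rewrite mulrDr scaleA_r extend_arrows_linear.
  + by rewrite extend_arrows_linear mulrDr scaleA_r.
  rewrite mul_path !extend_arrows_path [in RHS]extend_arrows_src mulrA.
  case: eqP => [pq|npq]; last first.
    rewrite -[X in X * _]mulrA vtxM; case: eqP => // _.
    by rewrite mulr0 mul0r; exact: lin0 (extend_arrows_linear g).
  rewrite extend_arrows_path ptgt_pcat //.
  have -> : word (pcat p q) = word p ++ word q by rewrite /word val_pcat.
  rewrite big_cat /= -pq.
  rewrite -[_ * idem K Q' (psrc p) * idem K Q' (psrc p)]mulrA vtxM eqxx.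
  by rewrite -extend_arrows_src mulrA.
move=> v; rewrite extend_arrows_path -[word _]/[::] big_nil mulr1.
by [].
Qed.
End ExtendArrows.
End AlgebraMorphisms.

Lemma jac_iso (K : fieldType) (V : finType) (Q Q' : quiver V)
    (f : palg K Q -> palg K Q') (g : palg K Q' -> palg K Q) W x :
  ahom f -> ahom g -> cancel f g -> cancel g f -> jac W x -> jac (f W) (f x).
Proof.
move=> hf hg fK gK; pose I y := jac (f W) (f y).
have iI : two_sided I by apply: ahom_two_sided (jac_ideal _).
apply: (@jac_min _ _ _ W I) => // c.
(* Writing [W] as [g (f W)] lets the chain rule for [g] express its derivatives through those of
   [f W], which generate the target ideal. *)
rewrite /cyc_diff -{1}[W]fK -[1](ahom1 hg) cut_chain //.
apply: two_sided_sum => // a _; apply: two_sided_cut => //.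
by rewrite /I gK; apply: jac_gen.
Qed.

(** * Frozen vertices and the reduction of potentials *)

Section FrozenVertices.
Variables (K : fieldType) (V : finType) (F : pred V).
Implicit Types Q : quiver V.
Local Notation e := (idem K).
Local Notation ar := (arrow_elt K).

Definition frozen_trivial Q (W : palg K Q) : Prop := forall u v x,
  F u -> F v -> e Q v * x * e Q u = x -> deg_ge 1 x -> jac W x.

Definition no_frozen_arrows Q : Prop :=
  forall a : arrow Q, ~~ (F (src a) && F (tgt a)).

Lemma mul_arr Q (b a : arrow Q) : src b = tgt a ->
  ar b * ar a = path_elt K (pcat (arrow_path b) (arrow_path a)).
Proof. by move=> ba; rewrite mul_path -[psrc _]/(src b) -[ptgt _]/(tgt a) ba eqxx. Qed.

(* A relation has degree at least 2, so the path [b a] of length 2 could lie in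
   the Jacobian two_sided only as the derivative by an arrow between frozen
   vertices. *)
Lemma frozen_trivial_no_transit Q (W : palg K Q) (a b : arrow Q) :
  no_frozen_arrows Q -> deg_ge 3 W -> frozen_trivial W ->
  F (src a) -> F (tgt b) -> src b = tgt a -> False.
Proof.
move=> nF W3 WF Fa Fb ba.
have xe : e Q (tgt b) * (ar b * ar a) * e Q (src a) = ar b * ar a.
  by rewrite !mulrA vtx_arr eqxx -mulrA arr_vtx eqxx.
have jx : jac W (ar b * ar a).
  apply: WF Fa Fb xe _; apply: (@deg_ge_le _ _ _ 2) => //.
  by rewrite -[2%N]/(1 + 1)%N; apply: deg_ge_mul; apply: deg_ge_arr.
have : deg_ge 3 (ar b * ar a).
  rewrite -xe; elim: jx => [|u c v x _ IH]; first by rewrite mulr0 mul0r; apply: deg_ge0.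
  rewrite mulrDr mulrDl; apply: deg_geD => //.
  have g2 : deg_ge 2 (cyc_diff c W) by exact: (@deg_ge_cut _ _ _ c 3 W 1 W3).
  rewrite /cyc_diff -cut_ends -/(cyc_diff c W).
  set g := cyc_diff c W in g2 *.
  rewrite (_ : _ * _ = (e Q (tgt b) * u * e Q (src c)) * g * (e Q (tgt c) * v * e Q (src a)));
    last by rewrite !mulrA.
  have idemM (y : palg K Q) w1 w2 : e Q w1 * (e Q w1 * y * e Q w2) * e Q w2 = e Q w1 * y * e Q w2.
    by rewrite !mulrA vtxM eqxx -!mulrA vtxM eqxx.
  have [sb|sb] := eqVneq (tgt b) (src c).
    have ta : tgt c != src a.
      by have := nF c; rewrite -sb Fb /=; apply: contraNneq => ->.
    rewrite -[3%N]/(0 + 2 + 1)%N; apply: deg_ge_mul; last exact: deg_ge1_ends ta (idemM _ _ _).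
    by apply: deg_ge_mul => //; apply: deg_ge_any.
  rewrite -[3%N]/(1 + 2 + 0)%N; apply: deg_ge_mul; last exact: deg_ge_any.
  by apply: deg_ge_mul => //; apply: deg_ge1_ends sb (idemM _ _ _).
rewrite mul_arr // => /(_ (pcat (arrow_path b) (arrow_path a))).
by rewrite path_coef_basis eqxx oner_eq0 /word val_pcat // => /(_ isT).
Qed.

End FrozenVertices.

(** * Passing to the reduced part of a potential *)

Section Reduction.
Variables (K : fieldType) (V : finType).
Implicit Types Q : quiver V.

Lemma cyclic_word_size Q (s : seq (arrow Q)) :
  no_loops Q -> no_two_cycles Q -> cyclic_word s -> (3 <= size s)%N.
Proof.
move=> nl n2; case: s => [|a [|b [|c s]]] //.
  by case/andP=> _ /= /andP[/eqP h]; have := nl a; rewrite h eqxx.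
case/andP=> _ /= /and3P[/eqP h /eqP h' _]; have := n2 a b.
by rewrite /two_cycle nl h -h' !eqxx.
Qed.

Lemma deg_ge_potential Q (W : pathalg K Q) :
  no_loops Q -> no_two_cycles Q -> is_potential W -> deg_ge 3 (to_palg W).
Proof. by move=> nl n2 pW p /pW; apply: cyclic_word_size. Qed.

Lemma ahom_id Q : ahom (fun x : palg K Q => x).
Proof. by []. Qed.

Lemma ahom_comp Q Q' Q'' (f : palg K Q -> palg K Q') (g : palg K Q' -> palg K Q'') :
  ahom f -> ahom g -> ahom (fun x => g (f x)).
Proof.
move=> hf hg; split=> [k x y|x y|v].
- by rewrite (ahom_linear hf) (ahom_linear hg).
- by rewrite (ahomM hf) (ahomM hg).
- by rewrite (ahom_idem hf) (ahom_idem hg).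
Qed.

Lemma ahom_deg_ge Q Q' (f : palg K Q -> palg K Q') d x : ahom f ->
  (forall a, deg_ge 1 (f (arrow_elt K a))) -> deg_ge d x -> deg_ge d (f x).
Proof.
move=> hf h; move: x; apply: deg_ge_ind => [|k x y hx hy|p dp].
- by rewrite ahom0 //; apply: deg_ge0.
- by rewrite (ahom_linear hf); apply: deg_ge_linear.
apply: deg_ge_le dp _; rewrite basis_word_l (ahomM hf).
rewrite -[size _]add0n; apply: deg_ge_mul; first exact: deg_ge_any.
elim: (word p) => [|a s IH]; first exact: deg_ge_any.
rewrite word_cons (ahomM hf) -[size _]/(1 + size s)%N; exact: deg_ge_mul.
Qed.

Lemma aug_ahom Q Q' (f : palg K Q -> palg K Q') v x : ahom f ->
  (forall a, deg_ge 1 (f (arrow_elt K a))) -> aug v (f x) = aug v x.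
Proof.
move=> hf h; move: x; apply: palg_ind => [|k x y hx hy|x y hx hy|w|a].
- by rewrite ahom0 // /aug !path_coef0.
- by rewrite (ahom_linear hf) /aug !path_coef_linear -!/(aug _ _) hx hy.
- by rewrite (ahomM hf) !augM hx hy.
- by rewrite (ahom_idem hf) !aug_vtx.
- by rewrite aug_arr; have /deg_ge1P := h a.
Qed.

Definition map_arrows Q Q' (t : arrow Q -> arrow Q') : palg K Q -> palg K Q' :=
  extend_arrows (fun a => arrow_elt K (t a)).

Section MapArrows.
Variables (Q Q' : quiver V) (t : arrow Q -> arrow Q').
Hypotheses (t_src : forall a, src (t a) = src a) (t_tgt : forall a, tgt (t a) = tgt a).

Let ends a : idem K Q' (tgt a) * arrow_elt K (t a) * idem K Q' (src a) = arrow_elt K (t a).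
Proof. by rewrite -t_src -t_tgt arrow_ends. Qed.

Lemma ahom_map_arrows : ahom (map_arrows t).
Proof. exact: ahom_extend_arrows ends. Qed.

Lemma map_arrows_arr a : map_arrows t (arrow_elt K a) = arrow_elt K (t a).
Proof. exact: extend_arrows_arr ends a. Qed.

Lemma push_map_arrows (W : pathalg K Q) :
  to_palg (push id t W) = map_arrows t (to_palg W).
Proof.
have lin : linear (fun x => to_palg (push id t (of_palg x)) : palg K Q').
  by move=> k x y; rewrite of_palg_linear /push linearP to_palg_linear.
apply: (palg_ext lin (extend_arrows_linear _)) => p.
rewrite -{1}path_eltE -[of_palg _]/(pbasis K p) /push extend_basis to_palgM vtxE.
by rewrite word_eltE /map_arrows extend_arrows_path /word_prod big_map.
Qed.

End MapArrows.

Lemma ahom_right_f_equiv Q Q' (f : pathalg K Q -> pathalg K Q') :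
  linear f -> monoid_morphism f ->
  (forall v, f (vtx K Q v) = vtx K Q' v) -> ahom (fun x => to_palg (f (of_palg x))).
Proof.
move=> fl [_ fM] fv; split=> [k x y|x y|v].
- by rewrite of_palg_linear fl to_palg_linear.
- rewrite -to_palgM -fM; congr (to_palg (f _)).
  by rewrite -[x in LHS]/(to_palg (of_palg x)) -[y in LHS]/(to_palg (of_palg y)) -to_palgM.
- by rewrite -[in LHS]vtxE -vtxE -fv.
Qed.

Section DirectSum.
Variables (P1 P2 : qp K V).
Let Q1 := qp_quiver P1.
Let Q2 := qp_quiver P2.
Let S := sum_quiver Q1 Q2.
Let W1 : palg K Q1 := to_palg (qp_pot P1).
Let W2 : palg K Q2 := to_palg (qp_pot P2).
Let WS : palg K S := to_palg (qp_pot (sum_qp P1 P2)).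
Let i1 : palg K Q1 -> palg K S := map_arrows (fun a => inl a : arrow S).
Let i2 : palg K Q2 -> palg K S := map_arrows (fun a => inr a : arrow S).

Lemma sum_potE : WS = i1 W1 + i2 W2.
Proof. by rewrite /WS to_palgD !push_map_arrows. Qed.

Let hi1 : ahom i1. Proof. exact: ahom_map_arrows. Qed.
Let hi2 : ahom i2. Proof. exact: ahom_map_arrows. Qed.

(** A retraction of [i1]: the quotient of the path algebra of the sum by the arrows of the second
    summand. *)
Definition kill_right : palg K S -> palg K Q1 :=
  extend_arrows (fun c : arrow S => if c is inl a then arrow_elt K a else 0).

Let kill_ends (c : arrow S) :
  idem K Q1 (tgt c) * (if c is inl a then arrow_elt K a else 0) * idem K Q1 (src c)
  = if c is inl a then arrow_elt K a else 0.
Proof. by case: c => [a|b]; [exact: arrow_ends | rewrite mulr0 mul0r]. Qed.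

Lemma ahom_kill_right : ahom kill_right.
Proof. exact: ahom_extend_arrows kill_ends. Qed.

Lemma kill_right_i1 x : kill_right (i1 x) = x.
Proof.
apply: (ahom_ext (ahom_comp hi1 ahom_kill_right) (ahom_id Q1)) => a.
by rewrite /i1 map_arrows_arr // /kill_right (extend_arrows_arr kill_ends).
Qed.

Lemma kill_right_i2 x : deg_ge 1 x -> kill_right (i2 x) = 0.
Proof.
have hk := ahom_comp hi2 ahom_kill_right.
move: x; apply: deg_ge_ind => [|k x y hx hy|p].
- by rewrite (ahom0 hk).
- by rewrite (ahom_linear hk) hx hy scaler0 addr0.
case E : (word p) => [|a s] // _.
have [p' [_ _ _ _ ->]] := qpath_cons K E.
rewrite (ahomM hk) {1}/i2 map_arrows_arr // /kill_right.
by rewrite (extend_arrows_arr kill_ends) mul0r.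
Qed.

Lemma cyc_diff_inl a : cyc_diff (inl a : arrow S) WS =
  idem K S (src a) * i1 (cyc_diff a W1) * idem K S (tgt a).
Proof.
rewrite /cyc_diff sum_potE cutDl -{1}(ahom1 hi1) -{1}(ahom1 hi2) (cut_chain _ _ _ hi1) (cut_chain _ _ _ hi2).
rewrite [X in _ + X]big1 => [|b _]; last by rewrite /i2 map_arrows_arr // cut_arr.
rewrite addr0 (bigD1 a) //= big1 => [|b ba].
  by rewrite addr0 {1}/i1 map_arrows_arr // cut_arr eqxx.
rewrite {1}/i1 map_arrows_arr // cut_arr; case: eqP => // -[e].
by rewrite e eqxx in ba.
Qed.

Lemma cyc_diff_inr b : cyc_diff (inr b : arrow S) WS =
  idem K S (src b) * i2 (cyc_diff b W2) * idem K S (tgt b).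
Proof.
rewrite /cyc_diff sum_potE cutDl -{1}(ahom1 hi1) -{1}(ahom1 hi2) (cut_chain _ _ _ hi1) (cut_chain _ _ _ hi2).
rewrite [X in X + _]big1 => [|a _]; last by rewrite /i1 map_arrows_arr // cut_arr.
rewrite add0r (bigD1 b) //= big1 => [|a ab].
  by rewrite addr0 {1}/i2 map_arrows_arr // cut_arr eqxx.
rewrite {1}/i2 map_arrows_arr // cut_arr; case: eqP => // -[e].
by rewrite e eqxx in ab.
Qed.

(** A derivative by an arrow of the second summand is a combination of paths in that summand.
    Without constant term it is sent to 0 by [kill_right]; a constant term would survive as an
    idempotent. *)
Lemma kill_right_jac x : (forall b : arrow Q2, deg_ge 1 (cyc_diff (inr b : arrow S) WS)) ->
  jac WS (i1 x) -> jac W1 x.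
Proof.
move=> h jx; rewrite -(kill_right_i1 x).
apply: (@jac_min _ _ _ WS (fun y => jac W1 (kill_right y))) jx.
  exact: ahom_two_sided ahom_kill_right (jac_ideal _).
have jI := jac_ideal W1.
case=> [a|b].
  rewrite cyc_diff_inl 2!(ahomM ahom_kill_right) 2!(ahom_idem ahom_kill_right).
  by rewrite kill_right_i1; apply: (two_sidedMr jI); apply: (two_sidedMl jI); apply: jac_gen.
have := h b; rewrite cyc_diff_inr; set z := cyc_diff b W2 => hz.
have -> : idem K S (src b) * i2 z * idem K S (tgt b) =
  i2 (idem K Q2 (src b) * z * idem K Q2 (tgt b)).
  by rewrite 2!(ahomM hi2) 2!(ahom_idem hi2).
rewrite kill_right_i2; first exact: jac0.
have arr1 a : deg_ge 1 (i2 (arrow_elt K a)) by rewrite /i2 map_arrows_arr //; apply: deg_ge_arr.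
apply/deg_ge1P => v; rewrite -(aug_ahom v _ hi2 arr1) 2!(ahomM hi2) 2!(ahom_idem hi2).
by have /deg_ge1P := hz.
Qed.

End DirectSum.

(** The element [x] is pushed into the direct sum and pulled back to [P] by the inverse equivalence,
    where the hypothesis places it in the Jacobian ideal. The ideal is then carried forward and the
    trivial summand killed. *)
Lemma frozen_trivial_reduced (F : pred V) (P R : qp K V) :
  no_loops (qp_quiver P) -> deg_ge 2 (to_palg (qp_pot P)) -> reduced_part P R ->
  frozen_trivial F (to_palg (qp_pot P)) -> frozen_trivial F (to_palg (qp_pot R)).
Proof.
move=> nl W2 [_ _ [T [_ _ [phi [phil phiM [psi phiK psiK] phiv phiW]]]]] PF.
pose f x := to_palg (phi (of_palg x)).
pose g x := to_palg (psi (of_palg x)).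
have hf : ahom f by apply: ahom_right_f_equiv.
have fK : cancel f g by move=> x; apply: phiK.
have gK : cancel g f by move=> x; apply: psiK.
have hg : ahom g.
  split=> [k x y|x y|v]; apply: (can_inj fK).
  - by rewrite (ahom_linear hf) !gK.
  - by rewrite (ahomM hf) !gK.
  - by rewrite (ahom_idem hf) gK.
have f1 a : deg_ge 1 (f (arrow_elt K a)).
  apply: (deg_ge1_ends _ (ahom_ends hf (arrow_ends K a))).
  by rewrite eq_sym.
have eqW c : cyc_diff c (f (to_palg (qp_pot P))) = cyc_diff c (to_palg (qp_pot (sum_qp R T))).
  exact: cyc_diff_cyc.
move=> u v x Fu Fv xe x1.
apply: kill_right_jac => [b|].
  suff h : deg_ge 1 (cyc_diff (inr b : arrow (qp_quiver (sum_qp R T)))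
                        (to_palg (qp_pot (sum_qp R T)))) by exact: h.
  rewrite -eqW; apply: (@deg_ge_cut _ _ _ _ 2 _ 1).
  exact: ahom_deg_ge.
set y := map_arrows _ x.
have hi : ahom (@map_arrows (qp_quiver R) (qp_quiver (sum_qp R T)) (fun a => inl a)).
  exact: ahom_map_arrows.
rewrite -[y]gK; apply: (eq_jac eqW); apply: (jac_iso hf hg fK gK).
apply: (PF u v) => //; first by apply: (ahom_ends hg); apply: (ahom_ends hi).
(* The hypothesis excludes loops in [P], so it is [f] that is known to preserve constant terms;
   those of [g y] are read off from [f (g y) = y]. *)
apply/deg_ge1P => w; rewrite -(aug_ahom w _ hf f1) gK (aug_ahom w _ hi).
  by have /deg_ge1P := x1.
by move=> a; rewrite map_arrows_arr //; apply: deg_ge_arr.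
Qed.

End Reduction.

(** * Premutation *)

Section Premutation.
Variables (K : fieldType) (V : finType) (k : V) (Q : quiver V).
Hypotheses (nl : no_loops Q) (n2 : no_two_cycles Q).
Local Notation Q' := (premut k Q).
Local Notation A := (palg K Q).
Local Notation A' := (palg K Q').
Local Notation e := (idem K Q).
Local Notation ar := (@arrow_elt K V Q).
Local Notation e' := (idem K (premut k Q)).
Local Notation ar' := (@arrow_elt K V (premut k Q)).
Local Notation pb := (@path_elt K V Q).
Implicit Types (x y z : A) (v : V) (a b : arrow Q) (p q : qpath Q).

Let il a : arrow Q' := inl a.
Let ir (c : {p : arrow Q * arrow Q | through k p}) : arrow Q' := inr c.

Definition composite b a : A' := to_palg (composite_arrow K k b a).

Lemma compositeE (c : {p : arrow Q * arrow Q | through k p}) :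
  composite (val c).1 (val c).2 = ar' (ir c).
Proof.
rewrite /composite /composite_arrow -surjective_pairing.
by rewrite (@valK _ _ {p : arrow Q * arrow Q | through k p} c) arrE.
Qed.

Definition lift b a (sb : src b = k) (ta : tgt a = k) :
  {c : {p : arrow Q * arrow Q | through k p} | val c = (b, a)}.
Proof.
have th : through k (b, a) by rewrite /through /= sb ta !eqxx.
by exists (Sub (b, a) th).
Defined.

Lemma src_il a : src a != k -> tgt a != k -> src (il a) = src a.
Proof. by move=> /negbTE sa /negbTE ta; rewrite /= sa ta. Qed.
Lemma tgt_il a : src a != k -> tgt a != k -> tgt (il a) = tgt a.
Proof. by move=> /negbTE sa /negbTE ta; rewrite /= sa ta. Qed.
Lemma src_il_in a : tgt a = k -> src (il a) = k.
Proof. by move=> ta; rewrite /= ta eqxx orbT. Qed.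
Lemma tgt_il_in a : tgt a = k -> tgt (il a) = src a.
Proof. by move=> ta; rewrite /= ta eqxx orbT. Qed.
Lemma src_il_out b : src b = k -> src (il b) = tgt b.
Proof. by move=> sb; rewrite /= sb eqxx. Qed.
Lemma tgt_il_out b : src b = k -> tgt (il b) = k.
Proof. by move=> sb; rewrite /= sb eqxx. Qed.

Fixpoint bracket_prod (s : seq (arrow Q)) : A' :=
  match s with
  | [::] => 1
  | b :: s1 =>
      if src b == k then
        match s1 with
        | [::] => 0
        | a :: s2 => composite b a * bracket_prod s2
        end
      else ar' (il b) * bracket_prod s1
  end.

Lemma bracket_prod_cons b a s : bracket_prod (b :: a :: s) =
  if src b == k then composite b a * bracket_prod s
  else ar' (il b) * bracket_prod (a :: s).
Proof. by []. Qed.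

Lemma bracket_prodE s : to_palg (bracket_word K k s) = bracket_prod s.
Proof.
have [n] := ubnP (size s); elim: n s => // n IH [|b [|a s]] lt.
- by rewrite to_palg1.
- by rewrite /=; case: eqP => _; rewrite ?to_palg0 // to_palgM arrE to_palg1.
rewrite bracket_prod_cons -!IH; [|by move: lt => /=; lia..].
by rewrite /=; case: eqP => _; rewrite to_palgM // arrE.
Qed.

(** Letters are grouped from the left into single arrows and passages through [k]; the condition
    keeps the boundary between [s1] and [s2] from splitting a passage. *)
Lemma bracket_prod_cat s1 s2 :
  (if s1 is a :: s then src (last a s) != k else true) ->
  bracket_prod (s1 ++ s2) = bracket_prod s1 * bracket_prod s2.
Proof.
have [n] := ubnP (size s1); elim: n s1 => // n IH [|b [|a s]] lt h.
- by rewrite mul1r.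
- by move: h => /= /negbTE ->; rewrite mulr1.
rewrite !cat_cons !bracket_prod_cons; case: eqP => _.
  by rewrite IH ?mulrA //; [move: lt => /=; lia | case: (s) h].
by rewrite -cat_cons IH // mulrA.
Qed.

(** A path with both ends off [k] is a succession of arrows not incident to [k] and of passages
    [b a] through [k]. Peeling off whole passages keeps the remaining path in the same class. *)
Lemma avoid_ind (P : qpath Q -> Prop) :
  (forall v, v != k -> P (trivial_path Q v)) ->
  (forall a p p', src a != k -> tgt a != k -> ptgt p = tgt a -> ptgt p' = src a ->
     psrc p' = psrc p -> psrc p != k -> word p = a :: word p' ->
     pb p = ar a * pb p' -> P p' -> P p) ->
  (forall b a p p', src b = k -> tgt a = k -> tgt b != k -> src a != k ->
     ptgt p = tgt b -> ptgt p' = src a -> psrc p' = psrc p -> psrc p != k ->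
     word p = b :: a :: word p' ->
     pb p = ar b * ar a * pb p' -> P p' -> P p) ->
  forall p, ptgt p != k -> psrc p != k -> P p.
Proof.
move=> P0 P1 P2 p; have [n] := ubnP (size (word p)); elim: n p => // n IH p.
case E: (word p) => [|b s] lt tp sp; first by rewrite (qpath_nil E); apply: P0.
have [p' [w' t1 t2 s2 ep]] := qpath_cons K E.
have [sb|sb] := eqVneq (src b) k; last first.
  by apply: (P1 b p p'); rewrite -?t1 ?w' ?s2 //; apply: IH; rewrite ?w' ?t2 ?s2.
(* A letter leaving [k] cannot be the last one, since the path would then start at [k]. *)
case: s E lt w' => [|a s] E lt w'.
  by move: sp; rewrite -s2 (qpath_nil w') /psrc /= t2 sb eqxx.
have [p2 [w2 t3 t4 s4 ep2]] := qpath_cons K w'.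
have ta : tgt a = k by rewrite -t3 t2.
have sa : src a != k by rewrite -ta.
apply: (P2 b a p p2) => //; rewrite -?t1 ?s4 ?s2 ?w2 //; first by rewrite ep ep2 mulrA.
by apply: IH; rewrite ?w2 ?t4 ?s4 ?s2 //; move: lt => /=; lia.
Qed.

Lemma composite_ends b a : src b = k -> tgt a = k ->
  e' (tgt b) * composite b a * e' (src a) = composite b a.
Proof.
move=> sb ta; have [d E] := lift sb ta.
have := compositeE d; rewrite E => ->.
have -> : tgt b = tgt (ir d) by rewrite /= E.
have -> : src a = src (ir d) by rewrite /= E.
exact: arrow_ends.
Qed.

Lemma bracket_prod_src p : ptgt p != k -> psrc p != k ->
  e' (ptgt p) * bracket_prod (word p) * e' (psrc p) = e' (ptgt p) * bracket_prod (word p).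
Proof.
move: p; apply: avoid_ind.
- by move=> v vk; rewrite mulr1 vtxM eqxx.
- move=> a p p' sa ta t1 t2 <- _ -> _; rewrite t2 /= (negbTE sa).
  have <- : src (il a) = src a by rewrite src_il.
  move=> IH; have <- : ar' (il a) * e' (src (il a)) = ar' (il a) by rewrite arr_vtx eqxx.
  rewrite -!mulrA; congr (_ * (_ * _)); by rewrite mulrA IH.
- move=> b a p p' sb ta tb sa t1 t2 <- _ -> _; rewrite t2 /= sb eqxx => IH.
  rewrite -(composite_ends sb ta) -!mulrA; congr (_ * (_ * (_ * _))); by rewrite mulrA IH.
Qed.

(* The map [W |-> [W]] of the premutation; it is multiplicative only across
   vertices other than [k], see [brM_avoid]. *)
Definition br : A -> A' := lextend (fun p =>
  if (ptgt p != k) && (psrc p != k) then e' (ptgt p) * bracket_prod (word p) else 0).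

Lemma br_linear : linear br.
Proof. exact: lextend_linear. Qed.

Lemma br0 : br 0 = 0.
Proof. exact: lin0 br_linear. Qed.

Lemma brD x y : br (x + y) = br x + br y.
Proof. by have := br_linear 1 x y; rewrite !scale1r. Qed.

Lemma brZ l x : br (l *: x) = l *: br x.
Proof. exact: linZ br_linear. Qed.

Lemma brB x y : br (x - y) = br x - br y.
Proof. by rewrite -scaleN1r brD brZ scaleN1r. Qed.

Lemma br_sum (I : Type) (r : seq I) (P : pred I) (F : I -> A) :
  br (\sum_(i <- r | P i) F i) = \sum_(i <- r | P i) br (F i).
Proof. exact: (big_morph br brD br0). Qed.

Lemma br_path p : br (pb p) =
  if (ptgt p != k) && (psrc p != k) then e' (ptgt p) * bracket_prod (word p) else 0.
Proof. exact: lextend_basis. Qed.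

Lemma br_idem v : br (e v) = if v != k then e' v else 0.
Proof. by rewrite br_path mulr1 andbb. Qed.

Lemma br_arr a : src a != k -> tgt a != k -> br (ar a) = ar' (il a).
Proof.
move=> sa ta; rewrite br_path -[ptgt _]/(tgt a) -[psrc _]/(src a) sa ta /=.
by rewrite (negbTE sa) mulr1 -(tgt_il sa ta) vtx_arr eqxx.
Qed.

Lemma br_incident a : (src a == k) || (tgt a == k) -> br (ar a) = 0.
Proof.
move=> h; rewrite br_path -[ptgt _]/(tgt a) -[psrc _]/(src a).
by rewrite -negb_or orbC h.
Qed.

Lemma br_composite b a : src b = k -> tgt a = k -> br (ar b * ar a) = composite b a.
Proof.
move=> sb ta; have tb : tgt b != k by rewrite -sb eq_sym.
have sa : src a != k by rewrite -ta.
have ba : psrc (arrow_path b) = ptgt (arrow_path a) by rewrite -[psrc _]/(src b) sb -ta.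
rewrite mul_path ba eqxx br_path ptgt_pcat // psrc_pcat //.
rewrite -[ptgt _]/(tgt b) -[psrc _]/(src a) sa tb /word val_pcat //= sb eqxx mulr1.
by rewrite -(composite_ends sb ta) !mulrA vtxM eqxx.
Qed.

(** The factor [1 - e k] discards the products whose junction lies at [k]; at any other junction no
    passage is split and [bracket_prod_cat] applies. *)
Lemma brM_avoid x y : br (x * ((1 - e k) * y)) = br x * br y.
Proof.
move: y; apply: palg_ext => [l u w|l u w|q].
- by rewrite !mulrDr !scaleA_r br_linear.
- by rewrite br_linear mulrDr scaleA_r.
move: x; apply: palg_ext => [l u v|l u v|p].
- by rewrite mulrDl scaleA_l br_linear.
- by rewrite br_linear mulrDl scaleA_l.
rewrite mulrBl mul1r vtx_basis eq_sym; case: eqP => [tq|/eqP tq].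
  by rewrite subrr mulr0 br0 [br (pb q)]br_path tq eqxx mulr0.
rewrite subr0 mul_path; case: eqP => [pq|npq].
  rewrite !br_path ptgt_pcat // psrc_pcat // tq pq tq andbT /=.
  case: eqP => [_|/eqP tp] /=; first by rewrite mul0r.
  case: eqP => [_|/eqP sq] /=; first by rewrite mulr0.
  have -> : word (pcat p q) = word p ++ word q by rewrite /word val_pcat.
  rewrite bracket_prod_cat; last first.
    have := tq; rewrite -pq /psrc; case: (word p) => // a s.
    by rewrite /= last_map.
  by rewrite [in RHS]mulrA -pq bracket_prod_src // ?pq // mulrA.
rewrite br0 !br_path.
case: ifP => [/andP[tp sp]|_]; last by rewrite mul0r.
case: ifP => _; last by rewrite mulr0.
rewrite -(bracket_prod_src tp sp) mulrA -[X in X * _]mulrA vtxM.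
by case: eqP => // _; rewrite mulr0 mul0r.
Qed.

(** Membership in the corner [(1 - e k) A (1 - e k)], on which [br] is multiplicative. *)
Definition avoids x : Prop := e k * x = 0 /\ x * e k = 0.

Lemma brMl x y : x * e k = 0 -> br (x * y) = br x * br y.
Proof. by move=> h; rewrite -brM_avoid mulrA mulrBr mulr1 h subr0. Qed.

Lemma brMr x y : e k * y = 0 -> br (x * y) = br x * br y.
Proof. by move=> h; rewrite -brM_avoid mulrBl mul1r h subr0. Qed.

Lemma big_through (R : nmodType) (G : arrow Q -> arrow Q -> R) :
  \sum_(c : {p : arrow Q * arrow Q | through k p}) G (val c).1 (val c).2 =
  \sum_(b | src b == k) \sum_(a | tgt a == k) G b a.
Proof.
rewrite pair_big_dep /=.
pose T := {p : arrow Q * arrow Q | through k p}.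
rewrite [RHS](reindex_omap (val : T -> _) insub) /=; last first.
  by move=> i h; rewrite insubT.
by apply: eq_bigl => c; rewrite valK eqxx andbT; have /andP[-> ->] := valP c.
Qed.

(* [X b a] is the second derivative of the cyclic words of [x] by the factor
   [b a]: it computes the derivatives by [a], by [b] and, after bracketing, by
   the composite arrow. *)
Record second_diff x z (X : arrow Q -> arrow Q -> A) : Prop := SecondDiff {
  sd_ends : forall b a, e (src a) * X b a * e (tgt b) = X b a;
  sd_composite : forall c,
    br (X (val c).1 (val c).2) = cut (ir c) (br x) (br z);
  sd_in : forall a, tgt a = k -> cut a x z = \sum_(b | src b == k) X b a * ar b;
  sd_out : forall b, src b = k -> cut b x z = \sum_(a | tgt a == k) ar a * X b a;
  sd_other : forall a, src a != k -> tgt a != k ->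
    br (cut a x z) = cut (il a) (br x) (br z);
  sd_incident : forall a, (src a == k) || (tgt a == k) ->
    cut (il a) (br x) (br z) = 0 }.

(** All inserted [z] avoiding [k] are allowed, since the Leibniz rule for a product replaces [z] by
    [y * z] and [z * x]. *)
Definition brackets x : Prop :=
  avoids x /\ forall z, avoids z -> exists X, second_diff x z X.

Lemma avoids0 : avoids 0.
Proof. by rewrite /avoids mulr0 mul0r. Qed.

Lemma avoids_linear l x y : avoids x -> avoids y -> avoids (l *: x + y).
Proof.
case=> x1 x2 [y1 y2].
by rewrite /avoids mulrDr mulrDl scaleA_l scaleA_r x1 x2 y1 y2 scaler0 addr0.
Qed.

Lemma avoidsM x y : avoids x -> avoids y -> avoids (x * y).
Proof.
by case=> x1 _ [_ y2]; rewrite /avoids mulrA x1 mul0r -mulrA y2 mulr0.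
Qed.

Lemma avoids_ends v w x : v != k -> w != k -> e v * x * e w = x -> avoids x.
Proof.
move=> /negbTE vk /negbTE wk <-; rewrite /avoids !mulrA vtxM eq_sym vk !mul0r.
by rewrite -!mulrA vtxM wk !mulr0.
Qed.

Lemma br_ends v w x : v != k -> w != k -> br (e v * x * e w) = e' v * br x * e' w.
Proof.
move=> vk wk; rewrite brMr; last by rewrite vtxM eq_sym (negbTE wk).
by rewrite brMl ?vtxM ?(negbTE vk) // !br_idem vk wk.
Qed.

Lemma second_diff0 z : second_diff 0 z (fun _ _ => 0).
Proof.
split=> [b a|c|a _|b _|a _ _|a _]; rewrite ?br0 ?cut0l ?br0 ?mulr0 ?mul0r //.
- by rewrite big1 // => b _; rewrite mul0r.
- by rewrite big1 // => a _; rewrite mulr0.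
Qed.

Lemma second_diff_linear l x y z X Y : second_diff x z X -> second_diff y z Y ->
  second_diff (l *: x + y) z (fun b a => l *: X b a + Y b a).
Proof.
case=> x1 x2 x3 x4 x5 x6 [y1 y2 y3 y4 y5 y6].
split=> [b a|c|a ta|b sb|a sa ta|a h].
- by rewrite mulrDr scaleA_r mulrDl scaleA_l x1 y1.
- by rewrite !br_linear cut_linear_l x2 y2.
- rewrite cut_linear_l x3 // y3 // scaler_sumr -big_split /=.
  by apply: eq_bigr => b _; rewrite mulrDl scaleA_l.
- rewrite cut_linear_l x4 // y4 // scaler_sumr -big_split /=.
  by apply: eq_bigr => a _; rewrite mulrDr scaleA_r.
- by rewrite br_linear !cut_linear_l br_linear x5 // y5.
- by rewrite br_linear cut_linear_l x6 // y6 // scaler0 addr0.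
Qed.

Lemma second_diff_mul x y z X Y : avoids x -> avoids y -> avoids z ->
  second_diff x (y * z) X -> second_diff y (z * x) Y ->
  second_diff (x * y) z (fun b a => X b a + Y b a).
Proof.
move=> [_ hx] [_ hy] [_ hz] [x1 x2 x3 x4 x5 x6] [y1 y2 y3 y4 y5 y6].
split=> [b a|c|a ta|b sb|a sa ta|a h].
- by rewrite mulrDr mulrDl x1 y1.
- by rewrite brD (brMl _ hx) cut_mul x2 y2 (brMl _ hy) (brMl _ hz).
- rewrite cut_mul x3 // y3 // -big_split /=.
  by apply: eq_bigr => b _; rewrite mulrDl.
- rewrite cut_mul x4 // y4 // -big_split /=.
  by apply: eq_bigr => a _; rewrite mulrDr.
- by rewrite (brMl _ hx) !cut_mul brD x5 // y5 // (brMl _ hy) (brMl _ hz).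
- by rewrite (brMl _ hx) cut_mul -(brMl _ hy) -(brMl _ hz) x6 // y6 // addr0.
Qed.

Lemma brackets0 : brackets 0.
Proof.
by split=> [|z _]; [exact: avoids0 | exists (fun _ _ => 0); exact: second_diff0].
Qed.

Lemma brackets_linear l x y : brackets x -> brackets y -> brackets (l *: x + y).
Proof.
case=> ax hx [ay hy]; split=> [|z az]; first exact: avoids_linear.
have [X hX] := hx z az; have [Y hY] := hy z az.
by exists (fun b a => l *: X b a + Y b a); apply: second_diff_linear.
Qed.

Lemma bracketsM x y : brackets x -> brackets y -> brackets (x * y).
Proof.
case=> ax hx [ay hy]; split=> [|z az]; first exact: avoidsM.
have [X hX] := hx _ (avoidsM ay az); have [Y hY] := hy _ (avoidsM az ax).
by exists (fun b a => X b a + Y b a); apply: second_diff_mul.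
Qed.

Lemma brackets_idem v : v != k -> brackets (e v).
Proof.
move=> vk; split=> [|z _].
  by rewrite /avoids !vtxM (negbTE vk) eq_sym (negbTE vk).
exists (fun _ _ => 0).
split=> [b a|c|a _|b _|a _ _|a _]; rewrite ?br_idem ?vk ?cut_vtx ?br0 ?mulr0 ?mul0r //.
- by rewrite big1 // => b _; rewrite mul0r.
- by rewrite big1 // => a _; rewrite mulr0.
Qed.

Lemma brackets_arr a : src a != k -> tgt a != k -> brackets (ar a).
Proof.
move=> sa ta; split=> [|z _].
  exact: avoids_ends ta sa (arrow_ends K a).
exists (fun _ _ => 0).
have inc b : (src b == k) || (tgt b == k) -> a == b = false.
  by apply: contraTF => /eqP <-; rewrite negb_or sa.
split=> [b a'|c|a' ta'|b sb|a' sa' ta'|a' h]; rewrite ?br_arr ?cut_arr ?br0 ?mulr0 ?mul0r //.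
- rewrite inc ?ta' ?eqxx ?orbT // big1 // => b _; by rewrite mul0r.
- rewrite inc ?sb ?eqxx // big1 // => a' _; by rewrite mulr0.
- rewrite /il (inj_eq (fun _ _ => @inl_inj _ _ _ _)).
  case: eqP => // _; last exact: br0.
  by rewrite br_ends // src_il // tgt_il.
- rewrite /il (inj_eq (fun _ _ => @inl_inj _ _ _ _)) inc //.
Qed.

Lemma brackets_composite b a : src b = k -> tgt a = k -> brackets (ar b * ar a).
Proof.
move=> sb ta; have tb : tgt b != k by rewrite -sb eq_sym.
have sa : src a != k by rewrite -ta.
have ax : avoids (ar b * ar a).
  by apply: (avoids_ends tb sa); rewrite !mulrA vtx_arr eqxx -mulrA arr_vtx eqxx.
split=> // z az.
(* The word is a single passage: removing both letters leaves only [z], restricted to run from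
   [tgt b] to [src a]. *)
exists (fun b' a' => if (b', a') == (b, a) then e (src a) * z * e (tgt b) else 0).
have ab : a == b = false by apply: contraNF sa => /eqP ->; rewrite sb.
split=> [b' a'|c|a' ta'|b' sb'|a' sa' ta'|a' h].
- case: eqP => [[-> ->]|_]; last by rewrite mulr0 mul0r.
  by rewrite !mulrA vtxM eqxx -!mulrA vtxM eqxx.
- rewrite br_composite //; have [c0 E0] := lift sb ta.
  have := compositeE c0; rewrite E0 /= => ->; rewrite cut_arr -surjective_pairing.
  rewrite -E0 (inj_eq val_inj) /ir (inj_eq (fun _ _ => @inr_inj _ _ _ _)) eq_sym.
  case: eqP => _; last exact: br0.
  by rewrite br_ends //= E0.
- have ba' : b == a' = false by apply: contraNF tb => /eqP ->; rewrite ta'.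
  rewrite cut_mul !cut_arr ba' add0r; case: (eqVneq a a') => [<-|naa'].
    rewrite (bigD1 b) ?sb //= eqxx big1 ?addr0 => [|b' /andP[_ /negbTE bb']]; last first.
      by rewrite xpair_eqE bb' mul0r.
    by rewrite -[in RHS]mulrA vtx_arr eqxx ta -sb !mulrA -mulrA arr_vtx eqxx.
  rewrite big1 // => b' _; rewrite xpair_eqE [a' == a]eq_sym (negbTE naa') andbF.
  by rewrite mul0r.
- have ab' : a == b' = false by apply: contraNF sa => /eqP ->; rewrite sb'.
  rewrite cut_mul !cut_arr ab' addr0; case: (eqVneq b b') => [<-|nbb'].
    rewrite (bigD1 a) ?ta //= eqxx big1 ?addr0 => [|a' /andP[_ /negbTE aa']]; last first.
      by rewrite xpair_eqE aa' andbF mulr0.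
    by rewrite !mulrA arr_vtx eqxx sb -ta vtx_arr eqxx.
  rewrite big1 // => a' _; rewrite xpair_eqE [b' == b]eq_sym (negbTE nbb') /=.
  by rewrite mulr0.
- rewrite br_composite //; have [c0 E0] := lift sb ta.
  have := compositeE c0; rewrite E0 /= => ->; rewrite cut_arr /=.
  rewrite cut_mul !cut_arr.
  case: (eqVneq b a') => [e1|_]; first by move: sa'; rewrite -e1 sb eqxx.
  case: (eqVneq a a') => [e1|_]; first by move: ta'; rewrite -e1 ta eqxx.
  by rewrite addr0 br0.
- rewrite br_composite //; have [c0 E0] := lift sb ta.
  by have := compositeE c0; rewrite E0 /= => ->; rewrite cut_arr /=.
Qed.

Lemma brackets_path p : ptgt p != k -> psrc p != k -> brackets (pb p).
Proof.
move: p; apply: avoid_ind => [v vk|a p p' sa ta _ _ _ _ _ -> hp'|b a p p' sb ta _ _ _ _ _ _ _ -> hp'].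
- exact: brackets_idem.
- by apply: bracketsM => //; apply: brackets_arr.
- by apply: bracketsM => //; apply: brackets_composite.
Qed.

Lemma deg_ge_composite b a : deg_ge 1 (composite b a).
Proof.
rewrite /composite /composite_arrow; case: insub => [c|]; last first.
  by rewrite to_palg0; apply: deg_ge0.
by rewrite arrE; apply: deg_ge_arr.
Qed.

(** Bracketing merges at most two letters into one arrow, hence the half rounded up. *)
Lemma deg_ge_br_path p : ptgt p != k -> psrc p != k ->
  deg_ge (uphalf (size (word p))) (br (pb p)).
Proof.
move: p; apply: avoid_ind.
- by move=> v vk; apply: deg_ge_any.
- move=> a p p' sa ta _ _ _ _ -> -> IH; rewrite brMl; last first.
    by rewrite arr_vtx eq_sym (negbTE sa).
  apply: (@deg_ge_le _ _ _ (1 + uphalf (size (word p')))); first by rewrite /=; lia.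
  by apply: deg_ge_mul => //; rewrite br_arr //; apply: deg_ge_arr.
- move=> b a p p' sb ta tb sa _ _ _ _ -> -> IH; rewrite brMl; last first.
    by rewrite -mulrA arr_vtx eq_sym (negbTE sa) mulr0.
  rewrite -[uphalf _]/(1 + uphalf (size (word p')))%N; apply: deg_ge_mul => //.
  by rewrite br_composite //; apply: deg_ge_composite.
Qed.

Lemma bracket_path p : ptgt p != k -> psrc p != k -> word p != [::] ->
  br (pb p) = bracket_prod (word p).
Proof.
move=> tp sp; rewrite br_path tp sp /=; move: p tp sp.
apply: avoid_ind => [v _ //|a p p' sa ta t1 _ _ _ w _ _ _|b a p p' sb ta tb sa t1 _ _ _ w _ _ _].
  by rewrite w /= (negbTE sa) t1 -(tgt_il sa ta) mulrA vtx_arr eqxx.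
by rewrite w /= sb eqxx t1 -(composite_ends sb ta) !mulrA vtxM eqxx.
Qed.

Lemma br_avoids x : e' k * br x = 0 /\ br x * e' k = 0.
Proof.
move: x; apply: palg_basis_ind => [|l x y [x1 x2] [y1 y2]|p].
- by rewrite br0 mulr0 mul0r.
- rewrite br_linear mulrDr mulrDl scaleA_l scaleA_r x1 x2 y1 y2.
  by rewrite scaler0 addr0.
rewrite br_path; case: ifP => [/andP[tp sp]|_]; last by rewrite mulr0 mul0r.
rewrite mulrA vtxM eq_sym (negbTE tp) mul0r; split=> //.
by rewrite -bracket_prod_src // -mulrA vtxM (negbTE sp) mulr0.
Qed.

Lemma cut1l (Q0 : quiver V) c (y : palg K Q0) : cut c 1 y = 0.
Proof.
rewrite one_vtx; elim/big_rec: _ => [|v z _ IH]; first exact: cut0l.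
by rewrite cutDl cut_vtx IH addr0.
Qed.

(** The unit does not avoid [k], while [brackets] gives second derivatives only for inserted
    elements that do; [1 - e k] can take its place. *)
Lemma cyc_diff_avoid (Q0 : quiver V) c (x : palg K Q0) :
  idem K Q0 k * x = 0 -> cyc_diff c x = cut c x (1 - idem K Q0 k).
Proof.
move=> h; have {1}-> : x = (1 - idem K Q0 k) * x by rewrite mulrBl mul1r h subr0.
have h0 (y : palg K Q0) : cut c (1 - idem K Q0 k) y = 0.
  by rewrite addrC -scaleN1r cut_linear_l cut_vtx cut1l scaler0 addr0.
by rewrite /cyc_diff cut_mul mul1r h0 add0r.
Qed.

Lemma avoids_one : avoids (1 - e k).
Proof. by rewrite /avoids mulrBr mulrBl mulr1 mul1r vtxM eqxx subrr. Qed.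

Lemma br_one : br (1 - e k) = 1 - e' k.
Proof.
rewrite brB br_idem eqxx subr0 !one_vtx br_sum.
have -> : \sum_v e' v = e' k + \sum_(v | v != k) e' v by rewrite (bigD1 k).
rewrite [RHS]addrC addKr [RHS]big_mkcond /=.
by apply: eq_bigr => v _; apply: br_idem.
Qed.

Lemma second_diff_cyc x : brackets x -> exists X : arrow Q -> arrow Q -> A,
  [/\ forall b a, e (src a) * X b a * e (tgt b) = X b a,
      forall c, br (X (val c).1 (val c).2) = cyc_diff (ir c) (br x),
      forall a, tgt a = k -> cyc_diff a x = \sum_(b | src b == k) X b a * ar b,
      forall b, src b = k -> cyc_diff b x = \sum_(a | tgt a == k) ar a * X b a
    & forall a, src a != k -> tgt a != k ->
        br (cyc_diff a x) = cyc_diff (il a) (br x)] /\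
  forall a, (src a == k) || (tgt a == k) -> cyc_diff (il a) (br x) = 0.
Proof.
case=> -[ax _] /(_ _ avoids_one) [X [x1 x2 x3 x4 x5 x6]]; exists X.
have [bx _] := br_avoids x.
have h1 c : cyc_diff c x = cut c x (1 - e k) by apply: cyc_diff_avoid.
have h2 c : cyc_diff c (br x) = cut c (br x) (br (1 - e k)).
  by rewrite br_one; apply: cyc_diff_avoid.
split; last by move=> a h; rewrite h2 x6.
split=> [//|c|a ta|b sb|a sa ta]; first by rewrite h2.
- by rewrite h1 x3.
- by rewrite h1 x4.
by rewrite h1 h2 x5.
Qed.

(** Meant for [w] obtained from [x] by rotating once each cyclic path based at [k]. Rotation keeps
    the derivatives, hence the Jacobian ideal, and moves the base point to where [br] applies. *)
Definition bracketing (x w : A) : Prop :=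
  [/\ brackets w, forall c, cyc_diff c x = cyc_diff c w,
      to_palg (bracket k (of_palg x)) = br w & deg_ge 2 (br w)].

Lemma bracket_linear : linear (fun x : A => to_palg (bracket k (of_palg x))).
Proof.
by move=> l x y; rewrite of_palg_linear /bracket extend_is_linear to_palg_linear.
Qed.

Lemma cyclic_word_closed p : cyclic_word (word p) -> psrc p = ptgt p.
Proof.
case E: (word p) => [|a s] // /andP[_ /=].
have [_ [_ tp _ _ _]] := qpath_cons K E.
rewrite rcons_path => /andP[_ /eqP h].
by rewrite /psrc E /= last_map h tp.
Qed.

Lemma bracketing_path p : cyclic_word (word p) -> exists w, bracketing (pb p) w.
Proof.
move=> cp; have sp := cyclic_word_closed cp.
(* Length at least 3 is what leaves degree at least 2 after bracketing. *)
have p3 := cyclic_word_size nl n2 cp.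
have brE : to_palg (bracket k (of_palg (pb p))) =
           bracket_prod (if ptgt p == k then rot 1 (word p) else word p).
  by rewrite -path_eltE /bracket extend_basis bracket_prodE.
case: (eqVneq (ptgt p) k) brE => [tp|tp] brE; last first.
  exists (pb p); split=> //; first by apply: brackets_path; rewrite ?sp.
    by rewrite brE bracket_path ?sp //; case: (word p) p3.
  by apply: deg_ge_le (deg_ge_br_path _ _); rewrite ?sp //; case: (word p) p3 => [|? [|? []]].
case E: (word p) p3 => [|b s] // p3.
have [p' [w' t1 t2 s2 ep]] := qpath_cons K E.
have pq : psrc p' = ptgt (arrow_path b) by rewrite s2 sp t1.
pose q := pcat p' (arrow_path b).
have wq : word q = s ++ [:: b] by rewrite /word val_pcat //= w'.
have tq : ptgt q != k by rewrite ptgt_pcat // t2 -tp t1.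
have sq : psrc q != k by rewrite psrc_pcat // -[psrc _]/(src b) -tp t1.
have epq : pb q = pb p' * ar b by rewrite mul_path pq eqxx.
exists (pb q); split.
- exact: brackets_path.
- by move=> c; rewrite ep epq /cyc_diff !cut_mul !mulr1 !mul1r addrC.
- rewrite brE E rot1_cons -cats1 -wq bracket_path // wq.
  by case: (s).
apply: deg_ge_le (deg_ge_br_path tq sq).
by rewrite wq size_cat /=; move: p3 => /=; case: (s) => [|? []] //= *; lia.
Qed.

Lemma bracketing_potential (W : pathalg K Q) :
  is_potential W -> exists w, bracketing (to_palg W) w.
Proof.
move=> pW; rewrite [to_palg W]palgE big_seq.
elim/big_rec: _ => [|p x pW' [w [w1 w2 w3 w4]]].
  exists 0; split=> //; first exact: brackets0.
    by rewrite (lin0 bracket_linear) br0.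
  by rewrite br0; apply: deg_ge0.
have [y [y1 y2 y3 y4]] : exists w, bracketing (pb p) w.
  by apply: bracketing_path; apply: pW; rewrite /pcoef monalg.mcoeff_neq0.
set l := pcoef _ _; exists (l *: y + w); split.
- exact: brackets_linear.
- by move=> c; rewrite /cyc_diff !cut_linear_l -!/(cyc_diff _ _) w2 y2.
- by rewrite bracket_linear br_linear w3 y3.
- by rewrite br_linear; apply: deg_ge_linear.
Qed.

Local Notation D := (to_palg (Delta K k Q) : A').

Lemma DeltaE :
  D = \sum_c ar' (ir c) * ar' (il (val c).2) * ar' (il (val c).1).
Proof. by rewrite to_palg_sum; apply: eq_bigr => c _; rewrite !to_palgM !arrE. Qed.

Lemma Delta_composite : D = \sum_(b | src b == k) \sum_(a | tgt a == k)
  composite b a * ar' (il a) * ar' (il b).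
Proof.
rewrite DeltaE -big_through.
by apply: eq_bigr => c _; rewrite compositeE.
Qed.

Lemma cut_sum (Q0 : quiver V) c (I : Type) (r : seq I) (P : pred I) (F : I -> palg K Q0)
    (y : palg K Q0) : cut c (\sum_(i <- r | P i) F i) y = \sum_(i <- r | P i) cut c (F i) y.
Proof.
apply: (big_morph (fun x : palg K Q0 => cut c x y)); last exact: cut0l.
by move=> ? ?; apply: cutDl.
Qed.

Lemma cyc_diff3 (Q0 : quiver V) c (x y z : palg K Q0) : cyc_diff c (x * y * z) =
  cut c x (y * z) + cut c y (z * x) + cut c z (x * y).
Proof. by rewrite /cyc_diff !cut_mul mulr1 mul1r. Qed.

Lemma cut_composite b a c (y : A') : src b = k -> tgt a = k -> cut (il c) (composite b a) y = 0.
Proof.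
move=> sb ta; have [d E] := lift sb ta.
by have := compositeE d; rewrite E => ->; rewrite cut_arr.
Qed.

Lemma Delta_ir c : cyc_diff (ir c) D = ar' (il (val c).2) * ar' (il (val c).1).
Proof.
have /andP[/eqP sb /eqP ta] := valP c.
rewrite DeltaE /cyc_diff cut_sum (bigD1 c) //= big1 => [|c' cc'].
  rewrite -/(cyc_diff _ _) cyc_diff3 !cut_arr eqxx !addr0.
  have -> : src (ir c) = tgt (il (val c).2) by rewrite tgt_il_in.
  have -> : tgt (ir c) = src (il (val c).1) by rewrite src_il_out.
  by rewrite mulrA vtx_arr eqxx -mulrA arr_vtx eqxx.
rewrite -/(cyc_diff _ _) cyc_diff3 !cut_arr !addr0.
by rewrite /ir (inj_eq (fun _ _ => @inr_inj _ _ _ _)) (negbTE cc').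
Qed.

Lemma il_eq a b : (il a == il b) = (a == b).
Proof. by rewrite /il (inj_eq (fun _ _ => @inl_inj _ _ _ _)). Qed.

Lemma out_neq_in b a : src b = k -> tgt a = k -> (b == a) = false.
Proof. by move=> sb ta; apply: contraNF (nl b) => /eqP e1; rewrite sb e1 ta. Qed.

Lemma src_in_neq a : tgt a = k -> src a != k.
Proof. by move=> <-. Qed.

Lemma composite_l b a : src b = k -> tgt a = k -> e' (tgt b) * composite b a = composite b a.
Proof. by move=> sb ta; rewrite -(composite_ends sb ta) !mulrA vtxM eqxx. Qed.

Lemma composite_r b a : src b = k -> tgt a = k -> composite b a * e' (src a) = composite b a.
Proof. by move=> sb ta; rewrite -(composite_ends sb ta) -!mulrA vtxM eqxx. Qed.

Lemma Delta_in a : tgt a = k ->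
  cyc_diff (il a) D = \sum_(b | src b == k) ar' (il b) * composite b a.
Proof.
move=> ta; rewrite Delta_composite /cyc_diff cut_sum; apply: eq_bigr => b /eqP sb.
rewrite cut_sum (bigD1 a) ?ta //= big1 => [|a' /andP[/eqP ta' /negbTE aa']].
  rewrite -/(cyc_diff _ _) cyc_diff3 cut_composite // !cut_arr eqxx il_eq.
  rewrite out_neq_in // add0r !addr0 src_il_in // tgt_il_in // -mulrA.
  by rewrite -[_ * _ * e' _]mulrA composite_r // mulrA vtx_arr tgt_il_out // eqxx.
rewrite -/(cyc_diff _ _) cyc_diff3 cut_composite // !cut_arr !il_eq aa'.
by rewrite out_neq_in // !addr0.
Qed.

Lemma Delta_out b : src b = k ->
  cyc_diff (il b) D = \sum_(a | tgt a == k) composite b a * ar' (il a).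
Proof.
move=> sb; rewrite Delta_composite /cyc_diff cut_sum (bigD1 b) ?sb //=.
rewrite [X in _ + X]big1 => [|b' /andP[/eqP sb' /negbTE bb']].
  rewrite addr0 cut_sum; apply: eq_bigr => a /eqP ta.
  rewrite -/(cyc_diff _ _) cyc_diff3 cut_composite // !cut_arr eqxx il_eq.
  rewrite [a == b]eq_sym out_neq_in // !add0r src_il_out // tgt_il_out //.
  by rewrite mulrA composite_l // -mulrA arr_vtx src_il_in // eqxx.
rewrite cut_sum big1 // => a /eqP ta.
rewrite -/(cyc_diff _ _) cyc_diff3 cut_composite // !cut_arr !il_eq bb'.
by rewrite [a == b]eq_sym out_neq_in // !addr0.
Qed.

Lemma Delta_other a : src a != k -> tgt a != k -> cyc_diff (il a) D = 0.
Proof.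
move=> sa ta; rewrite Delta_composite /cyc_diff cut_sum big1 // => b /eqP sb.
rewrite cut_sum big1 // => a' /eqP ta'.
rewrite -/(cyc_diff _ _) cyc_diff3 cut_composite // !cut_arr !il_eq.
case: eqP => [e1|_]; first by rewrite -e1 ta' eqxx in ta.
case: eqP => [e1|_]; first by rewrite -e1 sb eqxx in sa.
by rewrite !addr0.
Qed.

(** A path starting at [k] is trivial or its rightmost arrow leaves [k]. When an arrow into [k] is
    appended on the right, a passage is completed, which makes [br] computable. *)
Lemma tail_decomposition x : exists l Y,
  x * e k = l *: e k + \sum_(b | src b == k) Y b * ar b.
Proof.
move: x; apply: palg_ind => [|l x y [lx [X hX]] [ly [Y hY]]|x y [lx [X hX]] [ly [Y hY]]|v|a].
- exists 0, (fun _ => 0); rewrite mul0r scale0r add0r big1 // => b _; exact: mul0r.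
- exists (l * lx + ly), (fun b => l *: X b + Y b).
  rewrite mulrDl scaleA_l hX hY scalerDr scalerA scalerDl addrACA; congr (_ + _).
  rewrite scaler_sumr -big_split; apply: eq_bigr => b _ /=.
  by rewrite mulrDl scaleA_l.
- exists (ly * lx), (fun b => ly *: X b + x * Y b).
  rewrite -mulrA hY mulrDr scaleA_r hX scalerDr scalerA -addrA; congr (_ + _).
  rewrite scaler_sumr mulr_sumr -big_split; apply: eq_bigr => b _ /=.
  by rewrite mulrDl scaleA_l mulrA.
- exists (v == k)%:R, (fun _ => 0); rewrite vtxM big1 => [|b _]; last exact: mul0r.
  by rewrite addr0; case: eqP => [->|_]; rewrite ?scale1r ?scale0r.
- exists 0, (fun b => (b == a)%:R); rewrite scale0r add0r arr_vtx eq_sym.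
  case: eqP => [sa|sa].
    rewrite (bigD1 a) ?sa //= eqxx mul1r big1 ?addr0 // => b /andP[_ /negbTE ->].
    exact: mul0r.
  rewrite big1 // => b /eqP sb; case: eqP => [ba|_]; last exact: mul0r.
  by case: sa; rewrite -ba.
Qed.

Lemma head_decomposition x : exists l Y,
  e k * x = l *: e k + \sum_(a | tgt a == k) ar a * Y a.
Proof.
move: x; apply: palg_ind => [|l x y [lx [X hX]] [ly [Y hY]]|x y [lx [X hX]] [ly [Y hY]]|v|b].
- exists 0, (fun _ => 0); rewrite mulr0 scale0r add0r big1 // => b _; exact: mulr0.
- exists (l * lx + ly), (fun b => l *: X b + Y b).
  rewrite mulrDr scaleA_r hX hY scalerDr scalerA scalerDl addrACA; congr (_ + _).
  rewrite scaler_sumr -big_split; apply: eq_bigr => b _ /=.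
  by rewrite mulrDr scaleA_r.
- exists (lx * ly), (fun b => lx *: Y b + X b * y).
  rewrite mulrA hX mulrDl scaleA_l hY scalerDr scalerA -addrA; congr (_ + _).
  rewrite scaler_sumr mulr_suml -big_split; apply: eq_bigr => b _ /=.
  by rewrite mulrDr scaleA_r mulrA.
- exists (v == k)%:R, (fun _ => 0); rewrite vtxM big1 => [|b _]; last exact: mulr0.
  by rewrite addr0 eq_sym; case: eqP => _; rewrite ?scale1r ?scale0r.
- exists 0, (fun a => (a == b)%:R); rewrite scale0r add0r vtx_arr eq_sym.
  case: eqP => [ta|ta].
    rewrite (bigD1 b) ?ta //= eqxx mulr1 big1 ?addr0 // => a /andP[_ /negbTE ->].
    exact: mulr0.
  rewrite big1 // => a /eqP ta'; case: eqP => [ab|_]; last exact: mulr0.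
  by case: ta; rewrite -ab.
Qed.

(** * Bracketing and the Jacobian ideal of the premutation *)

Section JacobianBracket.
Variables W w : A.
Hypothesis Ww : bracketing W w.
Local Notation W' := (br w + D).

Let W'J : two_sided (jac W'). Proof. exact: jac_ideal. Qed.

Lemma jac_other a : src a != k -> tgt a != k -> jac W' (br (cyc_diff a W)).
Proof.
move=> sa ta; have [ww -> _ _] := Ww.
have [X [[_ _ _ _ h] _]] := second_diff_cyc ww.
rewrite h // -[cyc_diff _ _]addr0 -(Delta_other sa ta) -cutDl.
exact: jac_gen.
Qed.

(** [Delta] contributes the product of starred arrows to the derivative by the composite arrow,
    which identifies that product with minus the bracketed second derivative modulo the ideal. *)
Lemma jac_second : exists X : arrow Q -> arrow Q -> A,
  [/\ forall b a, e (src a) * X b a * e (tgt b) = X b a,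
      forall b a, src b = k -> tgt a = k ->
        jac W' (br (X b a) + ar' (il a) * ar' (il b)),
      forall a, tgt a = k -> cyc_diff a W = \sum_(b | src b == k) X b a * ar b
    & forall b, src b = k -> cyc_diff b W = \sum_(a | tgt a == k) ar a * X b a].
Proof.
have [ww eW _ _] := Ww; have [X [[h1 h2 h3 h4 _] _]] := second_diff_cyc ww.
exists X; split=> // [b a sb ta|a ta|b sb]; rewrite ?eW; [|exact: h3|exact: h4].
have [c E] := lift sb ta.
have := h2 c; have := Delta_ir c; rewrite E /= => <- ->.
by rewrite -cutDl; apply: jac_gen.
Qed.

(** No starred arrow occurs in [br w], so the derivative by [il a] sees [Delta] alone. *)
Lemma jac_in a : tgt a = k ->
  jac W' (\sum_(b | src b == k) ar' (il b) * composite b a).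
Proof.
move=> ta; have [ww _ _ _] := Ww; have [X [_ h]] := second_diff_cyc ww.
rewrite -(Delta_in ta) -[cyc_diff _ _]add0r -(h a) ?ta ?eqxx ?orbT // -cutDl.
exact: jac_gen.
Qed.

Lemma jac_out b : src b = k ->
  jac W' (\sum_(a | tgt a == k) composite b a * ar' (il a)).
Proof.
move=> sb; have [ww _ _ _] := Ww; have [X [_ h]] := second_diff_cyc ww.
rewrite -(Delta_out sb) -[cyc_diff _ _]add0r -(h b) ?sb ?eqxx ?orbT // -cutDl.
exact: jac_gen.
Qed.

(** Split at its left end, [x] exposes arrows into [k] and gives multiples of the relations of
    [jac_in]. The idempotent part leaves [br (ar b)], which is 0 because [b] is incident to [k]. *)
Lemma jac_in_mul x : jac W' (\sum_(b | src b == k) ar' (il b) * br (ar b * x)).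
Proof.
have [l [Y hY]] := head_decomposition x.
rewrite (eq_bigr (fun b => \sum_(a | tgt a == k)
                     (ar' (il b) * composite b a) * br (Y a))) => [|b /eqP sb].
  rewrite exchange_big /=; apply: two_sided_sum => // a /eqP ta.
  by rewrite -mulr_suml; apply: (two_sidedMr W'J); apply: jac_in.
have bk : ar b * e k = ar b by rewrite arr_vtx sb eqxx.
have -> : ar b * x = l *: ar b + \sum_(a | tgt a == k) ar b * (ar a * Y a).
  by rewrite -{1}bk -mulrA hY mulrDr scaleA_r bk mulr_sumr.
rewrite brD brZ br_incident ?sb ?eqxx // scaler0 add0r br_sum mulr_sumr.
apply: eq_bigr => a /eqP ta.
have sa : src a != k by rewrite -ta.
rewrite mulrA brMl; last by rewrite -mulrA arr_vtx eq_sym (negbTE sa) mulr0.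
by rewrite br_composite // mulrA.
Qed.

Lemma jac_out_mul x : jac W' (\sum_(a | tgt a == k) br (x * ar a) * ar' (il a)).
Proof.
have [l [Y hY]] := tail_decomposition x.
rewrite (eq_bigr (fun a => \sum_(b | src b == k)
                     br (Y b) * (composite b a * ar' (il a)))) => [|a /eqP ta].
  rewrite exchange_big /=; apply: two_sided_sum => // b /eqP sb.
  by rewrite -mulr_sumr; apply: (two_sidedMl W'J); apply: jac_out.
have ak : e k * ar a = ar a by rewrite vtx_arr ta eqxx.
have -> : x * ar a = l *: ar a + \sum_(b | src b == k) Y b * ar b * ar a.
  by rewrite -{1}ak mulrA hY mulrDl scaleA_l ak mulr_suml.
rewrite brD brZ br_incident ?ta ?eqxx ?orbT // scaler0 add0r br_sum mulr_suml.
apply: eq_bigr => b /eqP sb.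
have tb : tgt b != k by rewrite -sb eq_sym.
rewrite -[Y b * ar b * ar a]mulrA brMr; last by rewrite mulrA vtx_arr eq_sym (negbTE tb) mul0r.
by rewrite br_composite // mulrA.
Qed.

(** Since [br] is multiplicative only across vertices other than [k], the induction runs over the
    summands of the ideal. A derivative by an arrow not incident to [k] splits off directly; one by
    an arrow at [k] begins or ends at [k], and second derivatives move the junction away from it. *)
Lemma jac_br x : jac W x -> jac W' (br x).
Proof.
have [X [Xe Xj Xin Xout]] := jac_second.
have kX b a : tgt a = k -> e k * X b a = 0.
  move=> ta; have sa : src a != k by rewrite -ta.
  by rewrite -Xe !mulrA vtxM eq_sym (negbTE sa) !mul0r.
have Xk b a : src b = k -> X b a * e k = 0.
  move=> sb; have tb : tgt b != k by rewrite -sb eq_sym.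
  by rewrite -Xe -!mulrA vtxM (negbTE tb) !mulr0.
elim=> [|u c v y _ IH]; first by rewrite br0; apply: jac0.
rewrite brD; apply: (two_sidedD W'J) => //.
have [tc|tc] := eqVneq (tgt c) k.
  rewrite Xin // mulr_sumr mulr_suml br_sum.
  (* Both ends of [X b c] are off [k], so [br] splits on either side of it. The product of starred
     arrows is added to form the relation of [jac_second] and subtracted again in a sum covered by
     [jac_in_mul]. *)
  have -> : \sum_(b | src b == k) br (u * (X b c * ar b) * v) =
    \sum_(b | src b == k) br u * (br (X b c) + ar' (il c) * ar' (il b)) * br (ar b * v)
    - br u * ar' (il c) * \sum_(b | src b == k) ar' (il b) * br (ar b * v).
    rewrite mulr_sumr -sumrB; apply: eq_bigr => b /eqP sb.
    rewrite -!mulrA [u * _]mulrA brMl; last by rewrite -mulrA Xk // mulr0.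
    by rewrite (brMr _ (kX b c tc)) mulrDl mulrDr !mulrA addrK.
  apply: (two_sidedB W'J).
    apply: two_sided_sum => // b /eqP sb.
    by apply: (two_sidedMr W'J); apply: (two_sidedMl W'J); apply: Xj.
  by apply: (two_sidedMl W'J); apply: jac_in_mul.
have [sc|sc] := eqVneq (src c) k.
  rewrite Xout // mulr_sumr mulr_suml br_sum.
  have -> : \sum_(a | tgt a == k) br (u * (ar a * X c a) * v) =
    \sum_(a | tgt a == k) br (u * ar a) * (br (X c a) + ar' (il a) * ar' (il c)) * br v
    - (\sum_(a | tgt a == k) br (u * ar a) * ar' (il a)) * (ar' (il c) * br v).
    rewrite mulr_suml -sumrB; apply: eq_bigr => a /eqP ta.
    rewrite mulrA -[u * ar a * X c a * v]mulrA brMr; last by rewrite mulrA kX // mul0r.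
    by rewrite (brMl _ (Xk c a sc)) mulrDr mulrDl !mulrA addrK.
  apply: (two_sidedB W'J).
    apply: two_sided_sum => // a /eqP ta.
    by apply: (two_sidedMr W'J); apply: (two_sidedMl W'J); apply: Xj.
  by apply: (two_sidedMr W'J); apply: jac_out_mul.
have ge1 : cyc_diff c W * e k = 0.
  by rewrite /cyc_diff -cut_ends -mulrA vtxM (negbTE tc) mulr0.
have ge2 : e k * cyc_diff c W = 0.
  by rewrite /cyc_diff -cut_ends !mulrA vtxM eq_sym (negbTE sc) !mul0r.
rewrite brMl; last by rewrite -mulrA ge1 mulr0.
rewrite brMr //; apply: (two_sidedMr W'J); apply: (two_sidedMl W'J).
exact: jac_other.
Qed.

(* Modulo the Jacobian ideal every path avoiding [k] at its ends comes from a
   bracketed element, since [a^* b^*] is minus a derivative of the bracket. *)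
Definition bracketed v u (y : A') : Prop :=
  exists2 x, e v * x * e u = x & jac W' (y - br x).

Lemma bracketed_mul v t u (y z : A') : t != k ->
  bracketed v t y -> bracketed t u z -> bracketed v u (y * z).
Proof.
move=> tk [x xe hx] [x' xe' hx']; exists (x * x').
  have vx : e v * x = x by rewrite -xe !mulrA vtxM eqxx.
  have xu : x' * e u = x' by rewrite -xe' -!mulrA vtxM eqxx.
  by rewrite mulrA vx -mulrA xu.
rewrite brMl; last by rewrite -xe -mulrA vtxM (negbTE tk) mulr0.
have -> : y * z - br x * br x' = (y - br x) * z + br x * (z - br x').
  by rewrite mulrBl mulrBr addrA subrK.
by apply: (two_sidedD W'J); [apply: (two_sidedMr W'J)|apply: (two_sidedMl W'J)].
Qed.

Lemma bracketed_br x v u : e v * x * e u = x -> bracketed v u (br x).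
Proof. by move=> xe; exists x => //; rewrite subrr; apply: jac0. Qed.

Lemma bracketed_starred b a : src b = k -> tgt a = k ->
  bracketed (src a) (tgt b) (ar' (il a) * ar' (il b)).
Proof.
move=> sb ta; have [X [Xe Xj _ _]] := jac_second.
exists (- X b a); first by rewrite mulrN mulNr Xe.
have -> : br (- X b a) = - br (X b a) by rewrite -scaleN1r brZ scaleN1r.
by rewrite opprK [ar' _ * _ + _]addrC; apply: Xj.
Qed.

(** Only starred arrows meet [k] in the premutation, so a path with ends off [k] passes through it
    in pairs handled by [bracketed_starred]. All other arrows are brackets themselves. *)
Lemma bracketed_path (p : qpath Q') : ptgt p != k -> psrc p != k ->
  bracketed (ptgt p) (psrc p) (path_elt K p).
Proof.
have [n] := ubnP (size (word p)); elim: n p => // n IH p.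
case E: (word p) => [|y s] lt tp sp.
  have h : bracketed (ptgt p) (ptgt p) (e' (ptgt p)).
    have -> : e' (ptgt p) = br (e (ptgt p)) by rewrite br_idem tp.
    by apply: bracketed_br; rewrite vtxM eqxx vtxM eqxx.
  by rewrite (qpath_nil E); exact: h.
have [p' [w' t1 t2 s2 ep]] := qpath_cons K E.
rewrite ep -s2.
have step : src y != k -> bracketed (tgt y) (src y) (ar' y) ->
    bracketed (ptgt p) (psrc p') (ar' y * path_elt K p').
  move=> sy hy; rewrite t1; apply: (bracketed_mul sy hy).
  by rewrite -t2; apply: IH; rewrite ?w' ?t2 ?s2.
case: y E lt t1 t2 ep step => [a|c] E lt t1 t2 ep step; last first.
  have /andP[/eqP sb /eqP ta] := valP c.
  apply: step => /=; first exact: src_in_neq ta.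
  rewrite -(compositeE c) -br_composite //; apply: bracketed_br.
  by rewrite !mulrA vtx_arr eqxx -mulrA arr_vtx eqxx.
have [ta|ta] := eqVneq (tgt a) k; last first.
  have [sa|sa] := eqVneq (src a) k; first by rewrite t1 tgt_il_out ?eqxx in tp.
  apply: step; first by rewrite src_il.
  rewrite tgt_il // src_il // -br_arr //; apply: bracketed_br; exact: arrow_ends.
have t2' : ptgt p' = k by rewrite t2 src_il_in.
have t1' : ptgt p = src a by rewrite t1 tgt_il_in.
case: s E lt w' => [|y2 s] E lt w'.
  by move: sp; rewrite -s2 (qpath_nil w') /psrc /= t2' eqxx.
have [p2 [w2 t3 t4 s4 ep2]] := qpath_cons K w'.
rewrite ep2 mulrA -s4 t1'.
case: y2 E lt w' t3 t4 ep2 => [b|c] E lt w' t3 t4 ep2; last first.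
  (* A composite arrow ending at [k] would have a loop of [Q] at [k] as its left factor. *)
  have /andP[/eqP sb _] := valP c.
  case/eqP: (nl (val c).1); exact: etrans sb (etrans (esym t2') t3).
have sb : src b = k.
  move: t3; rewrite t2' /=; case: eqP => //= _; case: eqP => // tb.
  by move/esym.
have tb : tgt b != k by rewrite -sb eq_sym.
apply: (bracketed_mul tb); first exact: bracketed_starred.
have {1}-> : tgt b = ptgt p2 by rewrite t4 src_il_out.
apply: IH; [by rewrite w2; move: lt => /=; lia | by rewrite t4 src_il_out |].
by rewrite s4 s2.
Qed.

Lemma deg_ge_premut : deg_ge 2 W'.
Proof.
have [_ _ _ w2] := Ww; apply: deg_geD => //; rewrite DeltaE.
apply: (@two_sided_sum _ _ _ (deg_ge 2)) => [|c _]; first exact: two_sided_deg_ge.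
apply: (@deg_ge_le _ _ _ (1 + 1 + 1)) => //.
by apply: deg_ge_mul; [apply: deg_ge_mul|]; apply: deg_ge_arr.
Qed.

Lemma aug_br x v : v != k -> aug v (br x) = aug v x.
Proof.
move=> vk; move: x; apply: palg_basis_ind => [|l x y hx hy|p].
- by rewrite br0 /aug !path_coef0.
- by rewrite br_linear /aug !path_coef_linear -!/(aug _ _) hx hy.
case E: (word p) => [|a s].
  rewrite (qpath_nil E) -[path_elt _ _]/(e (ptgt p)) br_idem aug_vtx.
  case: eqP => [->|_] /=; last by rewrite aug_vtx.
  by rewrite /aug path_coef0 (negbTE vk).
have /deg_ge1P -> : deg_ge 1 (pb p).
  by apply: (@deg_ge_le _ _ _ (size (word p))); [rewrite E | apply: deg_ge_basis].
case: (boolP ((ptgt p != k) && (psrc p != k))) => [/andP[tp sp]|/negbTE h].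
  have /deg_ge1P -> // : deg_ge 1 (br (pb p)).
  by apply: deg_ge_le (deg_ge_br_path tp sp); rewrite E.
by rewrite br_path h /aug path_coef0.
Qed.

Lemma frozen_trivial_premut (F : pred V) : ~~ F k ->
  frozen_trivial F W -> frozen_trivial F W'.
Proof.
move=> Fk WF u v y Fu Fv ye y1.
have uk : u != k by apply: contraNneq Fk => <-.
have vk : v != k by apply: contraNneq Fk => <-.
have [x xe hx] : bracketed v u y.
  move: y ye y1; apply: deg_ge1_paths_ind => [|l y z [x xe hx] [x' xe' hx']|p _ tp sp].
  - by rewrite -br0; apply: bracketed_br; rewrite mulr0 mul0r.
  - exists (l *: x + x').
      by rewrite mulrDr mulrDl scaleA_r scaleA_l xe xe'.
    rewrite br_linear opprD addrACA -scalerBr.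
    by apply: (two_sidedD W'J) => //; apply: two_sidedZ.
  - by rewrite -tp -sp; apply: bracketed_path; rewrite ?tp ?sp.
have h1 : deg_ge 1 (y - br x).
  apply: (@jac_min _ _ _ W' (deg_ge 1)) hx => [|c]; first exact: two_sided_deg_ge.
  (* The potential has degree at least 2, so its Jacobian ideal has no constant terms. Hence [x]
     inherits positive degree from [y], and the hypothesis on [W] applies to it. *)
  exact: (@deg_ge_cut _ _ _ c 2 _ 1 deg_ge_premut).
have x1 : deg_ge 1 x.
  apply/deg_ge1P => z; case: (eqVneq z k) => [->|zk].
    by rewrite -xe !augM !aug_vtx eq_sym (negbTE vk) !mul0r.
  have /deg_ge1P/(_ z) h1z := h1; have /deg_ge1P/(_ z) y1z := y1.
  rewrite -(aug_br x zk); apply/eqP; rewrite -oppr_eq0; apply/eqP.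
  rewrite -h1z /aug addrC -scaleN1r path_coef_linear mulN1r.
  by rewrite -/(aug z y) y1z addr0.
have -> : y = (y - br x) + br x by rewrite subrK.
by apply: (two_sidedD W'J) => //; apply: jac_br; apply: (WF u v).
Qed.

End JacobianBracket.
End Premutation.

(** * Sign coherence *)

Section SignCoherence.
Variables (K : fieldType) (V : finType) (F : pred V).
Implicit Types N : V -> V -> nat.

(* Each column of the frozen part of the exchange matrix has a definite sign. *)
Definition sign_coherent N : Prop :=
  forall i j l, F j -> F l -> N j i = 0%N \/ N i l = 0%N.

Fixpoint sign_coherent_along N (ks : seq V) : Prop :=
  sign_coherent N /\
  if ks is k :: ks' then sign_coherent_along (mutate_numbers k N) ks' else True.

Lemma eq_sign_coherent_along N N' ks :
  N =2 N' -> sign_coherent_along N ks -> sign_coherent_along N' ks.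
Proof.
elim: ks N N' => [|k ks IH] N N' NN /= [h h'].
  by split=> // i j l Fj Fl; rewrite -!NN; apply: h.
split; first by move=> i j l Fj Fl; rewrite -!NN; apply: h.
by apply: IH h'; apply: eq_mutate_numbers.
Qed.

Lemma frozen_trivial_coherent (P : qp K V) :
  is_potential (qp_pot P) -> no_loops (qp_quiver P) -> no_two_cycles (qp_quiver P) ->
  no_frozen_arrows F (qp_quiver P) -> frozen_trivial F (to_palg (qp_pot P)) ->
  sign_coherent (narrows (qp_quiver P)).
Proof.
move=> pW nl n2 nF WF i j l Fj Fl.
case: (posnP (narrows (qp_quiver P) j i)) => [|/narrows_gt0[a sa ta]]; first by left.
case: (posnP (narrows (qp_quiver P) i l)) => [|/narrows_gt0[b sb tb]]; first by right.
have W3 := deg_ge_potential nl n2 pW.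
exfalso; apply: (@frozen_trivial_no_transit K V F _ _ a b nF W3 WF).
- by rewrite sa.
- by rewrite tb.
- by rewrite sb ta.
Qed.

Lemma succ_f_mutatable_coherent (P : qp K V) ks :
  is_potential (qp_pot P) -> no_loops (qp_quiver P) -> no_two_cycles (qp_quiver P) ->
  no_frozen_arrows F (qp_quiver P) -> frozen_trivial F (to_palg (qp_pot P)) ->
  all (predC F) ks -> succ_f_mutatable P ks ->
  sign_coherent_along (narrows (qp_quiver P)) ks.
Proof.
elim: ks P => [|k ks IH] P pW nl n2 nF WF.
  by split=> //; apply: frozen_trivial_coherent.
have coh : sign_coherent (narrows (qp_quiver P)) by apply: frozen_trivial_coherent.
move=> /= /andP[Fk Fks] [R [[red iso] hR]]; split=> //.
have NE : narrows (qp_quiver R) =2 mutate_numbers k (narrows (qp_quiver P)).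
  by move=> i j; rewrite (quiver_iso_narrows iso) narrows_mutation.
apply: (eq_sign_coherent_along NE); apply: IH => //.
- by case: red.
- by apply: no_loops_iso iso _; apply: no_loops_mutation.
- by apply: no_two_cycles_iso iso _; apply: no_two_cycles_cancel.
- move=> a; apply/negP => /andP[Fs Ft].
  have : (0 < narrows (qp_quiver R) (src a) (tgt a))%N by apply/narrows_gt0; exists a.
  have sk : src a != k by apply: contraNneq Fk => <-.
  have tk : tgt a != k by apply: contraNneq Fk => <-.
  rewrite NE /mutate_numbers (negbTE sk) (negbTE tk) /=.
  have -> : narrows (qp_quiver P) (src a) (tgt a) = 0%N.
    by apply: narrows_eq0 => b sb tb; have := nF b; rewrite sb tb Fs Ft.
  by case: (coh k _ _ Fs Ft) => ->; rewrite ?mul0n ?muln0.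
have [w hw] := bracketing_potential k nl n2 pW.
have WE : to_palg (qp_pot (premut_qp k P)) = br k w + to_palg (Delta K k (qp_quiver P)).
  by case: hw => _ _ h _; rewrite to_palgD h.
apply: frozen_trivial_reduced red _; first exact: no_loops_premut.
  by rewrite WE; apply: deg_ge_premut hw.
by rewrite WE; apply: frozen_trivial_premut hw _ _ _.
Qed.

End SignCoherence.

(** * The framed quiver as starting point *)

Section Framing.
Variables (K : fieldType) (V : finType) (Q : quiver V).

Definition frozen : pred (V + V)%type := fun v => if v is inr _ then true else false.

Lemma no_loops_framed : no_loops Q -> no_loops (framed Q).
Proof. by move=> nl [a|i] //=; apply: nl. Qed.

Lemma no_two_cycles_framed : no_two_cycles Q -> no_two_cycles (framed Q).
Proof.
by move=> n2 [a|i] [b|j]; rewrite /two_cycle /= ?andbF //; apply: n2.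
Qed.

Lemma narrows_framed_inl i j : narrows (framed Q) (inl i) (inl j) = narrows Q i j.
Proof.
pose il a : arrow (framed Q) := inl a.
have il_inj : injective il by move=> a b [].
rewrite /narrows -(card_imset _ il_inj); apply: eq_card => -[a|v].
  by rewrite mem_imset // !inE.
by rewrite !inE /=; apply/esym/negbTE/imsetP => -[].
Qed.

Lemma narrows_framed_inr i j : narrows (framed Q) (inr i) (inl j) = (i == j).
Proof.
have [<-|ij] := eqVneq i j; last first.
  by apply: narrows_eq0 => -[a|v] //= [->] [e]; rewrite e eqxx in ij.
apply/eqP/cards1P; exists (inr i : arrow (framed Q)).
apply/setP => -[a|v]; rewrite !inE //=.
by rewrite -[inr v == inr i :> arrow (framed Q)]/(v == i) -[inr v == inr i]/(v == i)
           -[inl v == inl i]/(v == i) andbb.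
Qed.

Lemma narrows_framed_to_inr x j : narrows (framed Q) x (inr j) = 0%N.
Proof. by apply: narrows_eq0 => -[a|v]. Qed.

Lemma no_frozen_arrows_framed : no_frozen_arrows frozen (framed Q).
Proof. by case=> a; rewrite /= ?andbF. Qed.

(* The frozen vertices of [framed Q] are sources. *)
Lemma frozen_trivial_framed (W : palg K (framed Q)) : frozen_trivial frozen W.
Proof.
move=> u v x Fu Fv; apply: deg_ge1_paths_ind; first exact: jac0.
  move=> l y z hy hz; have J := jac_ideal W.
  by apply: (two_sidedD J) => //; apply: two_sidedZ.
move=> p; case E: (word p) => [|a s] // _ tp _.
have [_ [_ ta _ _ _]] := qpath_cons K E.
by move: Fv; rewrite -tp ta; case: (a).
Qed.

Lemma word_prod_path (V0 : finType) (Q0 : quiver V0) (s : seq (arrow Q0)) : s != [::] ->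
  word_prod K s = 0 \/ exists2 p, word p = s & word_prod K s = path_elt K p.
Proof.
elim: s => [|a s IH] // _; rewrite word_cons; have [->|s0] := eqVneq s [::].
  by right; exists (arrow_path a) => //; rewrite word_nil mulr1.
case: (IH s0) => [->|[p wp ->]]; first by left; rewrite mulr0.
rewrite mul_path -[psrc _]/(src a); case: eqP => [sa|_]; last by left.
right; exists (pcat (arrow_path a) p) => //.
by rewrite /word val_pcat //= -wp.
Qed.

Lemma potential_framed (W : pathalg K Q) :
  is_potential W -> is_potential (qp_pot (framed_qp W)).
Proof.
move=> pW.
pose L (x : palg K Q) : palg K (framed Q) := to_palg (qp_pot (framed_qp (of_palg x))).
have Llin : linear L.
  by move=> l x y; rewrite /L of_palg_linear /= /push extend_is_linear to_palg_linear.
suff h p : path_coef (L (to_palg W)) p != 0 -> cyclic_word (word p) by [].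
rewrite [to_palg W]palgE big_seq; elim/big_rec: _ p => [|q x qW IH] p.
  by rewrite (lin0 Llin) path_coef0 eqxx.
rewrite Llin path_coef_linear.
have cq : cyclic_word (word q) by apply: pW; rewrite /pcoef monalg.mcoeff_neq0.
have [->|cx _] := eqVneq (path_coef (L x) p) 0; last exact: IH.
rewrite addr0 mulf_eq0 negb_or => /andP[_].
have -> : L (path_elt K q) = idem K (framed Q) (inl (ptgt q)) *
                             word_prod K (map (inl : _ -> arrow (framed Q)) (word q)).
  by rewrite -path_eltE /L /= /push extend_basis to_palgM vtxE word_eltE.
case/andP: cq => q0 cq.
have m0 : map (inl : _ -> arrow (framed Q)) (word q) != [::] by case: (word q) q0.
have [->|[r wr ->]] := word_prod_path m0.
  by rewrite mulr0 path_coef0 eqxx.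
rewrite vtx_basis; case: ifP => _; last by rewrite path_coef0 eqxx.
rewrite path_coef_basis; case: (r =P p) => [<- _|_]; last by rewrite eqxx.
rewrite /cyclic_word wr; apply/andP; split; first by case: (word q) q0.
by rewrite cycle_map; apply: sub_cycle cq => a b.
Qed.

Lemma framed_coherent (W : pathalg K Q) (ks : seq V) :
  no_loops Q -> no_two_cycles Q -> is_potential W ->
  succ_f_mutatable (framed_qp W) [seq inl k | k <- ks] ->
  sign_coherent_along frozen (narrows (framed Q)) [seq inl k | k <- ks].
Proof.
move=> nl n2 pW; apply: (@succ_f_mutatable_coherent K _ frozen (framed_qp W)).
- exact: potential_framed.
- exact: no_loops_framed.
- exact: no_two_cycles_framed.
- exact: no_frozen_arrows_framed.
- exact: frozen_trivial_framed.
- by rewrite all_map; apply/allP.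
Qed.

End Framing.

(** * Subtraction-free expressions *)

Section SubtractionFree.

(** Parametricity: a cluster variable is built from the initial ones by 1, products, sums and
    inverses alone. Suitable relations give positivity and compatibility with evaluation. *)
Lemma FZ_rel (V : finType) (K K' : fieldType) (R : K -> K' -> Prop) (Q : quiver V)
    (x : V -> K) (x' : V -> K') (ks : seq V) (i : V) :
  R 1 1 -> (forall a a' b b', R a a' -> R b b' -> R (a * b) (a' * b')) ->
  (forall a a' b b', R a a' -> R b b' -> R (a + b) (a' + b')) ->
  (forall a a', R a a' -> R a^-1 a'^-1) ->
  (forall v, R (x v) (x' v)) -> R (FZ Q x ks i) (FZ Q x' ks i).
Proof.
move=> R1 RM RD RV; rewrite /FZ; elim: ks Q x x' => [|k ks IH] Q x x' Rx //=.
have RX a a' m : R a a' -> R (a ^+ m) (a' ^+ m).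
  by move=> Ra; elim: m => [|m IHm]; rewrite ?expr0 // !exprS; apply: RM.
apply: IH => v; case: ifP => _ //; apply: (RM); first exact: RV.
by apply: (RD); apply: (big_ind2 R) => // j _; apply: RX.
Qed.

(** These polynomials stay nonzero under every substitution of positive functions, so they can serve
    as denominators in every evaluation below. *)
Inductive subtraction_free m : {mpoly rat[m]} -> Prop :=
| sf_one : subtraction_free 1
| sf_var j : subtraction_free 'X_j
| sf_add p q : subtraction_free p -> subtraction_free q -> subtraction_free (p + q)
| sf_mul p q : subtraction_free p -> subtraction_free q -> subtraction_free (p * q).

Lemma subtraction_free_neq0 m (p : {mpoly rat[m]}) : subtraction_free p -> p != 0.
Proof.
(* At the point with all coordinates 1 the value is a positive rational. *)
move=> sp; suff : 0 < meval (fun=> 1) p.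
  by apply: contraTneq => ->; rewrite meval0 ltxx.
elim: sp => [|j|q r _ q0 _ r0|q r _ q0 _ r0].
- by rewrite meval1.
- by rewrite mevalXU.
- by rewrite mevalD addr_gt0.
- by rewrite mevalM mulr_gt0.
Qed.

Lemma to_ratfun_sf_neq0 m (p : {mpoly rat[m]}) :
  subtraction_free p -> to_ratfun p != 0.
Proof. by move=> /subtraction_free_neq0; rewrite /to_ratfun tofrac_eq0. Qed.

Definition positive m (f : ratfun m) : Prop := exists p q,
  [/\ subtraction_free p, subtraction_free q & f = to_ratfun p / to_ratfun q].

Lemma to_ratfunD m : {morph @to_ratfun m : p q / p + q}.
Proof. exact: (@tofracD {mpoly rat[m]}). Qed.

Lemma to_ratfun1 m : @to_ratfun m 1 = 1.
Proof. exact: (@tofrac1 {mpoly rat[m]}). Qed.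

Lemma positive_neq0 m (f : ratfun m) : positive f -> f != 0.
Proof. by case=> p [q [sp sq ->]]; rewrite mulf_neq0 ?invr_eq0 ?to_ratfun_sf_neq0. Qed.

Lemma positive1 m : positive (1 : ratfun m).
Proof. by exists 1, 1; split; rewrite ?to_ratfun1 ?divr1 //; apply: sf_one. Qed.

Lemma positiveM m (f g : ratfun m) : positive f -> positive g -> positive (f * g).
Proof.
case=> p [q [sp sq ->]] [p' [q' [sp' sq' ->]]]; exists (p * p'), (q * q').
by split; rewrite ?mulf_div ?to_ratfunM //; apply: sf_mul.
Qed.

Lemma positiveD m (f g : ratfun m) : positive f -> positive g -> positive (f + g).
Proof.
case=> p [q [sp sq ->]] [p' [q' [sp' sq' ->]]]; exists (p * q' + p' * q), (q * q').
split; [by apply: sf_add; apply: sf_mul | exact: sf_mul |].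
by rewrite addf_div ?to_ratfun_sf_neq0 // to_ratfunD !to_ratfunM.
Qed.

Lemma positiveV m (f : ratfun m) : positive f -> positive f^-1.
Proof. by case=> p [q [sp sq ->]]; exists q, p; rewrite invf_div. Qed.

Lemma positive_rvar m (j : 'I_m) : positive (rvar j).
Proof. by exists 'X_j, 1; rewrite to_ratfun1 divr1; split=> //; constructor. Qed.

Lemma positive_prod m (I : finType) (F : I -> ratfun m) :
  (forall i, positive (F i)) -> positive (\prod_i F i).
Proof.
by move=> h; elim/big_ind: _ => //; [apply: positive1 | apply: positiveM].
Qed.

Lemma positiveX m (f : ratfun m) d : positive f -> positive (f ^+ d).
Proof.
move=> h; elim: d => [|d IH]; first by rewrite expr0; apply: positive1.
by rewrite exprS; apply: positiveM.
Qed.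

Lemma positiveXz m (f : ratfun m) (z : int) : positive f -> positive (f ^ z).
Proof.
move=> h; case: z => d; first by rewrite -exprnP; apply: positiveX.
by rewrite NegzE -exprnN; apply: positiveV; apply: positiveX.
Qed.

Section Evaluation.
Variables (m m' : nat) (v : 'I_m -> ratfun m').
Hypothesis v_pos : forall j, positive (v j).

Lemma poly_eval1 : poly_eval v 1 = 1.
Proof.
exact: (rmorph1 (mpoly.mmap (@tofrac {mpoly rat[m']} \o @mpolyC m' rat) v)).
Qed.

Lemma poly_evalD : {morph poly_eval v : p q / p + q}.
Proof.
exact: (rmorphD (mpoly.mmap (@tofrac {mpoly rat[m']} \o @mpolyC m' rat) v)).
Qed.

Lemma poly_evalX j : poly_eval v 'X_j = v j.
Proof.
have := mmapX v (@tofrac {mpoly rat[m']} \o @mpolyC m' rat) U_(j).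
by rewrite mmap1U.
Qed.

Lemma positive_poly_eval p : subtraction_free p -> positive (poly_eval v p).
Proof.
elim=> [|j|q r _ hq _ hr|q r _ hq _ hr].
- by rewrite poly_eval1; apply: positive1.
- by rewrite poly_evalX.
- by rewrite poly_evalD; apply: positiveD.
- by rewrite poly_evalM; apply: positiveM.
Qed.

(** Unlike [ratfun_eval], which picks a value by choice, this relation is visibly closed under the
    operations that occur in mutations. *)
Definition evaluates (f : ratfun m) (w : ratfun m') : Prop := exists p q,
  [/\ subtraction_free p, subtraction_free q, f = to_ratfun p / to_ratfun q
    & w = poly_eval v p / poly_eval v q].

Lemma evaluates_ratfun_eval f w : evaluates f w -> ratfun_eval f v = w.
Proof.
case=> p [q [sp sq -> ->]]; apply: ratfun_evalE.
exact: positive_neq0 (positive_poly_eval sq).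
Qed.

Lemma evaluates_rvar j : evaluates (rvar j) (v j).
Proof.
exists 'X_j, 1; split; [exact: sf_var|exact: sf_one| |].
  by rewrite to_ratfun1 divr1.
by rewrite poly_eval1 poly_evalX divr1.
Qed.

Lemma evaluates1 : evaluates 1 1.
Proof.
exists 1, 1; split; [exact: sf_one|exact: sf_one| |].
  by rewrite to_ratfun1 divr1.
by rewrite poly_eval1 divr1.
Qed.

Lemma evaluates_FZ (V : finType) (Q : quiver V) z z' ks i :
  (forall x, evaluates (z x) (z' x)) -> evaluates (FZ Q z ks i) (FZ Q z' ks i).
Proof.
apply: FZ_rel.
- exact: evaluates1.
- move=> _ _ _ _ [p [q [sp sq -> ->]]] [p' [q' [sp' sq' -> ->]]].
  exists (p * p'), (q * q'); rewrite !mulf_div !poly_evalM !to_ratfunM.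
  by split=> //; apply: sf_mul.
- move=> _ _ _ _ [p [q [sp sq -> ->]]] [p' [q' [sp' sq' -> ->]]].
  exists (p * q' + p' * q), (q * q').
  split; [by apply: sf_add; apply: sf_mul | exact: sf_mul | |].
    by rewrite addf_div ?to_ratfun_sf_neq0 // to_ratfunD !to_ratfunM.
  rewrite addf_div ?positive_neq0 //; try exact: positive_poly_eval.
  by rewrite poly_evalD !poly_evalM.
- by move=> _ _ [p [q [sp sq -> ->]]]; exists q, p; rewrite !invf_div.
Qed.

End Evaluation.
End SubtractionFree.

(** * The recursion for g-vectors *)

Section Bases.
Variable n : nat.
Implicit Types g : 'I_n -> 'rV[int]_n.

Lemma eq_Zbasis g g' : g =1 g' -> is_Zbasis g -> is_Zbasis g'.
Proof.
move=> gg h v; have [c [cv cu]] := h v; exists c; split.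
  by rewrite cv; apply: eq_bigr => i _; rewrite gg.
by move=> c' c'v; apply: cu; rewrite c'v; apply: eq_bigr => i _; rewrite gg.
Qed.

Lemma Zbasis_delta : is_Zbasis (fun i : 'I_n => delta_mx 0 i).
Proof.
move=> v; exists v; split; first by rewrite -row_sum_delta.
by move=> c ->; rewrite -row_sum_delta.
Qed.

(** Coordinates in the two families correspond under the involution [r], so existence and uniqueness
    carry over without inverting a matrix. *)
Lemma Zbasis_reflect g (k : 'I_n) (c : 'I_n -> int) : c k = 0 -> is_Zbasis g ->
  is_Zbasis (fun i => if i == k then - g k + \sum_l c l *: g l else g i).
Proof.
move=> ck gB.
pose r (x : 'rV[int]_n) : 'rV[int]_n :=
  \row_i (if i == k then - x 0 k else x 0 i + x 0 k * c i).
have rK : involutive r.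
  move=> x; apply/rowP => i; rewrite !mxE eqxx; case: eqP => [->|_]; first by rewrite opprK.
  by rewrite mulNr addrK.
have rE (x : 'rV[int]_n) : \sum_i x 0 i *: (if i == k then - g k + \sum_l c l *: g l else g i)
            = \sum_i r x 0 i *: g i.
  rewrite (bigD1 k) //= eqxx [RHS](bigD1 k) //= mxE eqxx.
  rewrite scalerDr scalerN scaleNr -addrA; congr (_ + _).
  rewrite (bigD1 k) //= ck scale0r add0r scaler_sumr -big_split /=.
  by apply: eq_bigr => i /negbTE ik; rewrite mxE ik scalerDl scalerA addrC.
move=> v; have [x [xv xu]] := gB v; exists (r x); split; first by rewrite rE rK.
by move=> y; rewrite rE => /xu ->; rewrite rK.
Qed.

End Bases.

Definition pos_part (z : int) : nat := if z is Posz d then d else 0%N.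
Definition neg_part (z : int) : nat := if z is Negz d then d.+1 else 0%N.

Lemma exprz_parts (L : fieldType) (x : L) z :
  x != 0 -> x ^ z * x ^+ neg_part z = x ^+ pos_part z.
Proof.
move=> x0; case: z => d; first by rewrite expr0 mulr1.
by rewrite NegzE -exprnN mulVf // expf_neq0.
Qed.

(** * Laurent monomials and their exponent vectors *)

Section Monomials.
Variable n : nat.
Implicit Types g h : 'rV[int]_n.

Definition monomial g : ratfun n := \prod_j rvar j ^ g 0 j.

Let rvar0 (j : 'I_n) : rvar j != 0. Proof. exact: positive_neq0 (positive_rvar j). Qed.

Lemma monomial_neq0 g : monomial g != 0.
Proof. by apply/prodf_neq0 => j _; rewrite expfz_neq0. Qed.

Lemma monomialD g h : monomial (g + h) = monomial g * monomial h.
Proof. by rewrite -big_split /=; apply: eq_bigr => j _; rewrite mxE expfzDr. Qed.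

Lemma monomial0 : monomial 0 = 1.
Proof. by rewrite /monomial big1 // => j _; rewrite mxE expr0z. Qed.

Lemma monomialN g : monomial (- g) = (monomial g)^-1.
Proof.
apply: (mulfI (monomial_neq0 g)).
by rewrite -monomialD subrr monomial0 divff // monomial_neq0.
Qed.

Lemma monomialZ (d : nat) g : monomial (d%:Z *: g) = monomial g ^+ d.
Proof.
rewrite -natz scaler_nat; elim: d => [|d IH]; first by rewrite mulr0n expr0 monomial0.
by rewrite mulrS monomialD IH exprS.
Qed.

Lemma monomial_sum (I : finType) (F : I -> 'rV[int]_n) :
  monomial (\sum_i F i) = \prod_i monomial (F i).
Proof. exact: (big_morph monomial monomialD monomial0). Qed.

Lemma monomial_delta j : monomial (delta_mx 0 j) = rvar j.
Proof.
rewrite /monomial (bigD1 j) //= big1 ?mulr1 => [|i ij]; rewrite mxE eqxx ?eqxx /=.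
  by rewrite expr1z.
by rewrite (negbTE ij) expr0z.
Qed.

(** Clearing negative powers turns a relation between Laurent monomials into an equality of
    monomials of the polynomial ring, whose exponents must agree. This gives the uniqueness of
    g-vectors. *)
Lemma monomial_inj : injective monomial.
Proof.
suff h g : monomial g = 1 -> g = 0.
  move=> g h' e; apply/eqP; rewrite -subr_eq0; apply/eqP; apply: h.
  by rewrite monomialD monomialN e divff // monomial_neq0.
move=> g1.
have XE (m : 'X_{1..n}) : to_ratfun 'X_[m] = \prod_j rvar j ^+ m j.
  rewrite mpolyXE_id (big_morph (@to_ratfun n) (@to_ratfunM n) (@to_ratfun1 n)).
  apply: eq_bigr => j _; rewrite /rvar; elim: (m j) => [|d IH].
    by rewrite !expr0 to_ratfun1.
  by rewrite !exprS to_ratfunM IH.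
pose P : 'X_{1..n} := [multinom pos_part (g 0%R j) | j < n].
pose N : 'X_{1..n} := [multinom neg_part (g 0%R j) | j < n].
have PN : 'X_[rat, N] = 'X_[rat, P].
  apply: (@to_ratfun_inj n); rewrite !XE; transitivity (monomial g * \prod_j rvar j ^+ N j).
    by rewrite g1 mul1r.
  rewrite /monomial -big_split /=; by apply: eq_bigr => j _; rewrite !mnmE exprz_parts.
have /eqP eNP : N == P.
  have := congr1 (mcoeff P) PN; rewrite !mcoeffX eqxx.
  by case: (N =P P) => // _ /eqP; rewrite eq_sym oner_eq0.
apply/rowP => j; have := congr1 (fun m : 'X_{1..n} => m j) eNP.
(* The positive and negative parts of an integer are never both nonzero, so their equality makes
   both vanish. *)
by rewrite !mnmE mxE; case: (g 0%R j) => d //= <-.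
Qed.

End Monomials.

Section GVectorRecursion.
Variables (n : nat) (b0 : 'I_n -> 'rV[int]_n).
Implicit Types (N : 'I_n + 'I_n -> 'I_n + 'I_n -> nat) (g : 'I_n -> 'rV[int]_n).

Definition exch N x y : int := (N x y)%:Z - (N y x)%:Z.

Lemma exch_mutate k N x y : exch (mutate_numbers k N) x y =
  if (x == k) || (y == k) then - exch N x y
  else exch N x y + (N x k)%:Z * (N k y)%:Z - (N y k)%:Z * (N k x)%:Z.
Proof.
rewrite /exch /mutate_numbers [(y == k) || _]orbC; case: ifP => _; first by rewrite opprB.
set p := (N x k * N k y)%N; set q := (N y k * N k x)%N.
rewrite -!PoszM -/p -/q; lia.
Qed.

(* [G B = B_0 C] for the matrices [G] of g-vectors and [C] of c-vectors. *)
Definition degree_relation N g : Prop := forall i,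
  \sum_l exch N (inl l) (inl i) *: g l = \sum_j exch N (inr j) (inl i) *: b0 j.

Definition new_gvector N (k : 'I_n) g : 'rV[int]_n :=
  - g k + \sum_l (N (inl l) (inl k))%:Z *: g l - \sum_j (N (inr j) (inl k))%:Z *: b0 j.

Definition mutate_gvectors N k g i := if i == k then new_gvector N k g else g i.

Lemma degree_relation_at N g k : degree_relation N g ->
  \sum_l (N (inl l) (inl k))%:Z *: g l - \sum_j (N (inr j) (inl k))%:Z *: b0 j =
  \sum_l (N (inl k) (inl l))%:Z *: g l - \sum_j (N (inl k) (inr j))%:Z *: b0 j.
Proof.
move=> /(_ k); rewrite /exch; under eq_bigr do rewrite scalerBl.
under [in RHS]eq_bigr do rewrite scalerBl.
rewrite !sumrB => /eqP; rewrite subr_eq => /eqP ->.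
by rewrite addrC -!addrA addKr addrC.
Qed.

Lemma degree_relation_mutate N g k : N (inl k) (inl k) = 0%N ->
  degree_relation N g ->
  degree_relation (mutate_numbers (inl k) N) (mutate_gvectors N k g).
Proof.
move=> Nk h i.
have exk : exch N (inl k) (inl k) = 0 by rewrite /exch subrr.
have [->|ik] := eqVneq i k.
  transitivity (- \sum_l exch N (inl l) (inl k) *: g l).
    rewrite -sumrN; apply: eq_bigr => l _.
    rewrite exch_mutate eqxx orbT scaleNr /mutate_gvectors; case: eqP => // ->.
    by rewrite exk !scale0r.
  rewrite h -sumrN; apply: eq_bigr => j _.
  by rewrite exch_mutate eqxx orbT scaleNr.
have hk := degree_relation_at k h; have hi := h i; move: hk hi.
set A1 := \sum_l (N (inl l) (inl k))%:Z *: g l.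
set B1 := \sum_j (N (inr j) (inl k))%:Z *: b0 j.
set A2 := \sum_l (N (inl k) (inl l))%:Z *: g l.
set B2 := \sum_j (N (inl k) (inr j))%:Z *: b0 j.
set S := \sum_l exch N (inl l) (inl i) *: g l.
set T := \sum_j exch N (inr j) (inl i) *: b0 j => hk hi.
pose p := (N (inl k) (inl i))%:Z; pose q := (N (inl i) (inl k))%:Z.
have -> : \sum_j exch (mutate_numbers (inl k) N) (inr j) (inl i) *: b0 j =
          T + p *: B1 - q *: B2.
  rewrite !scaler_sumr -big_split -sumrB /=; apply: eq_bigr => j _.
  rewrite exch_mutate /= [inl i == inl k](negbTE (_ : _ != _)) //.
  by rewrite scalerBl scalerDl !scalerA [p * _]mulrC.
have inE2 (x y : 'I_n) : (inl x == inl y :> 'I_n + 'I_n) = (x == y) by [].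
have GE : \sum_l (exch N (inl l) (inl i) *: g l + p *: ((N (inl l) (inl k))%:Z *: g l)
           - q *: ((N (inl k) (inl l))%:Z *: g l)) = S + p *: A1 - q *: A2.
  by rewrite sumrB big_split /= !scaler_sumr.
rewrite (bigD1 k) //= exch_mutate eqxx /=.
have -> : \sum_(l | l != k) exch (mutate_numbers (inl k) N) (inl l) (inl i) *:
     mutate_gvectors N k g l = S + p *: A1 - q *: A2 - exch N (inl k) (inl i) *: g k.
  rewrite -GE [in RHS](bigD1 k) //= Nk !scale0r !scaler0 addr0 subr0 [RHS]addrC addKr.
  apply: eq_bigr => l lk; rewrite exch_mutate !inE2 (negbTE lk) (negbTE ik) /=.
  rewrite /mutate_gvectors (negbTE lk) scalerBl scalerDl !scalerA.
  by rewrite [p * _]mulrC.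
rewrite /mutate_gvectors eqxx /new_gvector -/A1 -/B1 /exch -/p -/q hi.
have -> : A2 = A1 - B1 + B2 by rewrite hk subrK.
apply/rowP => j; rewrite !mxE; ring.
Qed.

Lemma Zbasis_mutate N g k : N (inl k) (inl k) = 0%N ->
  sign_coherent (@frozen 'I_n) N -> degree_relation N g -> is_Zbasis g ->
  is_Zbasis (mutate_gvectors N k g).
Proof.
move=> Nk coh h gB.
(* A frozen arrow into [k] rules out arrows from [k] to frozen vertices, so the formula over arrows
   out of [k] is free of [b0]. Otherwise the defining formula is. *)
have [/existsP[j0 Nj0]|] := boolP [exists j, N (inr j) (inl k) != 0%N].
  apply: eq_Zbasis (Zbasis_reflect (k := k) (c := fun l => (N (inl k) (inl l))%:Z) _ gB);
    last by rewrite Nk.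
  move=> i; rewrite /mutate_gvectors; case: ifP => // _.
  rewrite /new_gvector -addrA (degree_relation_at k h) [X in _ - X]big1 ?subr0 // => l _.
  have [Nj|->] := coh (inl k) (inr j0) (inr l) isT isT; last by rewrite scale0r.
  by rewrite Nj in Nj0.
rewrite negb_exists => /forallP B0.
apply: eq_Zbasis (Zbasis_reflect (k := k) (c := fun l => (N (inl l) (inl k))%:Z) _ gB);
  last by rewrite Nk.
move=> i; rewrite /mutate_gvectors; case: ifP => // _.
rewrite /new_gvector [X in _ - X]big1 ?subr0 // => j _.
by have := B0 j; rewrite negbK => /eqP ->; rewrite scale0r.
Qed.

Lemma separation_step (Q : quiver 'I_n) (Q' : quiver ('I_n + 'I_n)%type)
    (u : 'I_n -> ratfun n) (w : 'I_n + 'I_n -> ratfun n) g k :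
  (forall i j, narrows Q i j = narrows Q' (inl i) (inl j)) ->
  degree_relation (narrows Q') g ->
  (forall i, u i = monomial (g i) * w (inl i)) ->
  (forall j, w (inr j) = monomial (b0 j)) ->
  forall i, (seed_mutation (Q, u) k).2 i =
    monomial (mutate_gvectors (narrows Q') k g i) *
    (seed_mutation (Q', w) (inl k)).2 (inl i).
Proof.
move=> QQ h uw wb i /=; rewrite /mutate_gvectors -[inl i == inl k]/(i == k).
case: eqP => // _; have := degree_relation_at k h; rewrite /new_gvector.
set N := narrows Q'; rewrite -addrA.
set A1 := \sum_l (N (inl l) (inl k))%:Z *: g l.
set B1 := \sum_j (N (inr j) (inl k))%:Z *: b0 j.
set A2 := \sum_l (N (inl k) (inl l))%:Z *: g l.
set B2 := \sum_j (N (inl k) (inr j))%:Z *: b0 j => AB.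
have produ (F : 'I_n -> nat) : \prod_l u l ^+ F l =
    monomial (\sum_l (F l)%:Z *: g l) * \prod_l w (inl l) ^+ F l.
  rewrite monomial_sum -big_split /=; apply: eq_bigr => l _.
  by rewrite monomialZ uw exprMn.
have prodw (F : 'I_n + 'I_n -> nat) : \prod_v w v ^+ F v =
    (\prod_l w (inl l) ^+ F (inl l)) * monomial (\sum_j (F (inr j))%:Z *: b0 j).
  rewrite big_sumType /=; congr (_ * _); rewrite monomial_sum.
  by apply: eq_bigr => j _; rewrite wb monomialZ.
rewrite !prodw -/B1 -/B2.
under eq_bigr do rewrite QQ.
under [X in _ * (_ + X) = _]eq_bigr do rewrite QQ.
rewrite !produ -/A1 -/A2 uw invfM.
rewrite monomialD monomialN -!mulrA; congr (_ * _).
rewrite mulrCA; congr (_ * _); rewrite mulrDr.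
have E1 : monomial (A1 - B1) * monomial B1 = monomial A1 by rewrite -monomialD subrK.
have E2 : monomial (A1 - B1) * monomial B2 = monomial A2 by rewrite AB -monomialD subrK.
congr (_ + _); first by rewrite mulrCA E1 mulrC.
by rewrite mulrCA E2 mulrC.
Qed.

Lemma separation (Q : quiver 'I_n) (Q' : quiver ('I_n + 'I_n)%type)
    (u : 'I_n -> ratfun n) (w : 'I_n + 'I_n -> ratfun n) g ks :
  no_loops Q -> no_two_cycles Q -> no_loops Q' -> no_two_cycles Q' ->
  (forall i j, narrows Q i j = narrows Q' (inl i) (inl j)) ->
  degree_relation (narrows Q') g ->
  (forall i, u i = monomial (g i) * w (inl i)) ->
  (forall j, w (inr j) = monomial (b0 j)) ->
  is_Zbasis g ->
  sign_coherent_along (@frozen 'I_n) (narrows Q') [seq inl k | k <- ks] ->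
  exists2 g', is_Zbasis g' & forall i,
    FZ Q u ks i = monomial (g' i) * FZ Q' w [seq inl k | k <- ks] (inl i).
Proof.
rewrite /FZ; elim: ks Q Q' u w g => [|k ks IH] Q Q' u w g nl n2 nl' n2' QQ h uw wb gB /=.
  by move=> _; exists g.
case=> coh cohs; have Nk := narrows_loop (inl k) nl'.
have step := separation_step k QQ h uw wb.
apply: (IH _ _ _ _ (mutate_gvectors (narrows Q') k g)).
- exact: no_loops_mutation.
- exact: no_two_cycles_cancel.
- exact: no_loops_mutation.
- exact: no_two_cycles_cancel.
- by move=> i j; rewrite !narrows_mutation // /mutate_numbers !QQ.
- have := degree_relation_mutate Nk h; rewrite /degree_relation => h' i.
  rewrite /exch; under eq_bigr do rewrite !narrows_mutation //.
  under [in RHS]eq_bigr do rewrite !narrows_mutation //.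
  exact: h'.
- exact: step.
- by move=> j /=; rewrite wb.
- exact: Zbasis_mutate.
- by apply: eq_sign_coherent_along cohs => x y; rewrite narrows_mutation.
Qed.

End GVectorRecursion.

(** * F-polynomials as specialized cluster variables *)

Section FramedSeparation.
Variables (n : nat) (Q : quiver 'I_n) (ks : seq 'I_n).
Hypotheses (nl : no_loops Q) (n2 : no_two_cycles Q).

(** The sign is opposite to that of [barQ], because g-vectors are defined by evaluating at the
    inverses of the [yvar Q j]. *)
Let b0 j : 'rV[int]_n := \row_i ((narrows Q i j)%:Z - (narrows Q j i)%:Z).

Let yvarV j : (yvar Q j)^-1 = monomial (b0 j).
Proof.
rewrite -[yvar Q j]/(\prod_i rvar i ^ barQ Q i j).
have -> : \prod_i rvar i ^ barQ Q i j = monomial (- b0 j).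
  by apply: eq_bigr => i _; rewrite /barQ !mxE opprB.
by rewrite monomialN invrK.
Qed.

(* The initial cluster of [framed Q] with [X_j = 1] and [X_{j^*}] given. *)
Definition framed_cluster m (y : 'I_n -> ratfun m) (v : 'I_n + 'I_n) : ratfun m :=
  match v with inl _ => 1 | inr j => y j end.

Lemma Fpolynomial_FZ i : Fpolynomial Q ks i =
  FZ (framed Q) (framed_cluster (@rvar n)) [seq inl k | k <- ks] (inl i).
Proof.
rewrite /Fpolynomial /FZpf_var.
set v := (X in ratfun_eval _ X).
have v_pos j : positive (v j).
  by rewrite /v; case: (fintype.split j) => l; [apply: positive1 | apply: positive_rvar].
apply: (evaluates_ratfun_eval v_pos); apply: (evaluates_FZ v_pos) => x.
have -> : framed_cluster (@rvar n) x = v (unsplit x) by rewrite /v unsplitK.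
exact: evaluates_rvar.
Qed.

Lemma Fpolynomial_eval m (y : 'I_n -> ratfun m) i : (forall j, positive (y j)) ->
  ratfun_eval (Fpolynomial Q ks i) y =
  FZ (framed Q) (framed_cluster y) [seq inl k | k <- ks] (inl i).
Proof.
move=> y_pos; rewrite Fpolynomial_FZ.
apply: (evaluates_ratfun_eval y_pos); apply: (evaluates_FZ y_pos) => -[j|j] /=.
  exact: evaluates1.
exact: evaluates_rvar.
Qed.

Lemma positive_FZ (V : finType) (Q0 : quiver V) m (x : V -> ratfun m) ks0 i :
  (forall v, positive (x v)) -> positive (FZ Q0 x ks0 i).
Proof.
(* The binary [FZ_rel] serves a unary predicate here; the copy over [rat] is a dummy. *)
move=> xp; apply: (@FZ_rel V _ rat (fun a _ => positive a) Q0 x (fun=> 1) ks0 i) => //.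
- exact: positive1.
- by move=> a _ b _; apply: positiveM.
- by move=> a _ b _; apply: positiveD.
- by move=> a _; apply: positiveV.
Qed.

(** Initially the matrices of g-vectors and c-vectors are identities, and the relation only says
    that the [b0 j] are the columns of the exchange matrix. *)
Lemma degree_relation_framed :
  degree_relation b0 (narrows (framed Q)) (fun i => delta_mx 0 i).
Proof.
move=> i; rewrite [RHS](bigD1 i) //= [X in _ = _ + X]big1 => [|j /negbTE ji].
  rewrite /exch narrows_framed_inr narrows_framed_to_inr eqxx subr0 scale1r addr0.
  rewrite [RHS]row_sum_delta; apply: eq_bigr => l _.
  by rewrite mxE !narrows_framed_inl.
by rewrite /exch narrows_framed_inr narrows_framed_to_inr ji scale0r.
Qed.

Lemma gvectors_Zbasis :
  sign_coherent_along (@frozen 'I_n) (narrows (framed Q)) [seq inl k | k <- ks] ->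
  is_Zbasis (gvector Q ks).
Proof.
move=> coh; pose y j := (yvar Q j)^-1.
have y_pos j : positive (y j).
  apply: positiveV; apply: positive_prod => i.
  by apply: positiveXz; apply: positive_rvar.
have [g gB gE] : exists2 g, is_Zbasis g & forall i, FZ Q (@rvar n) ks i =
    monomial (g i) * FZ (framed Q) (framed_cluster y) [seq inl k | k <- ks] (inl i).
  apply: (@separation n b0 Q (framed Q) _ _ (fun i => delta_mx 0 i)) => //.
  - exact: no_loops_framed.
  - exact: no_two_cycles_framed.
  - by move=> i j; rewrite narrows_framed_inl.
  - exact: degree_relation_framed.
  - by move=> i; rewrite monomial_delta mulr1.
  - exact: Zbasis_delta.
apply: eq_Zbasis gB => i.
have gi : is_gvector Q ks i (g i) by rewrite /is_gvector Fpolynomial_eval // -gE.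
(* [gvector] is defined by choice: a solution exists, so the chosen vector is one too. It equals
   [g i] because the nonzero F-factor can be cancelled. *)
have gvi : is_gvector Q ks i (gvector Q ks i) by apply: (xgetPex 0); exists (g i).
apply: monomial_inj; move: gi; rewrite /is_gvector gvi.
set f := ratfun_eval _ _; have f0 : f != 0.
  rewrite /f Fpolynomial_eval //; apply: positive_neq0; apply: positive_FZ.
  by case=> j /=; [apply: positive1 | apply: y_pos].
by move/(mulIf f0).
Qed.

End FramedSeparation.

Theorem theorem8p10 (R : realType) (n : nat) (Q : quiver 'I_n)
    (W : pathalg (R[i])%C Q) (ks : seq 'I_n) :
  no_loops Q -> no_two_cycles Q -> is_potential W ->
  succ_f_mutatable (framed_qp W) [seq inl k | k <- ks] ->
  is_Zbasis (gvector Q ks).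
Proof.
move=> nl n2 pW hW; apply: gvectors_Zbasis => //.
exact: framed_coherent hW.
Qed.
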